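(* For every integer $k$ there exists an integer $c=c(k)$ such that every graph in $\mathcal{F}_2$ with no star cutset and with treewidth more than $c$ contains a subdivision of $W_{k\times k}$ as an induced subgraph.
   Context: A hole is an induced cycle of length at least four. $G$ is sparse if for every hole $H$ and vertex $v\notin V(H)$ there is an edge $ab$ of $H$ with $N(v)\cap V(H)\subseteq\{a,b\}$. A pyramid consists of a vertex $a$, a triangle $\{b_1,b_2,b_3\}$ and three paths $P_i$ from $a$ to $b_i$ of length at least one such that for $i\neq j$ the sets $P_i\setminus\{a\},P_j\setminus\{a\}$ are disjoint with the only edge between them being $b_ib_j$, and at most one $P_i$ has length one. A prism consists of two disjoint triangles $\{a_1,a_2,a_3\},\{b_1,b_2,b_3\}$ and three pairwise disjoint paths $P_i$ from $a_i$ to $b_i$ of length at least one such that for $i\ne j$ the only edges between $P_i$ and $P_j$ are $a_ia_j,b_ib_j$. $\mathcal{F}_2$ is the class of triangle-free sparse graphs with no induced pyramid or prism. A separation is a partition $(A,C,B)$ of $V(G)$ with no edges between $A$ and $B$; it is a star separation if some $v\in C$ has $C\subseteq N[v]$, proper if $A,B\neq\emptyset$; $G$ has a star cutset if it has a proper star separation. Walls: $\Gamma_k$ has vertex set $\{(i,j):1\le i\le k,0\le j\le 2k-1\}$, $(i,j)\sim(i,j+1)$ for $0\le j\le 2k-2$, $(i,j)\sim(i+1,j)$ when $1\le i\le k-1$ and $i+j$ odd; $W_{k\times k}$ is obtained by deleting degree-one vertices and suppressing each remaining vertex of row $1$ or $k$ with no neighbor in another row. A subdivision replaces edges by paths. 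*)

(* Defs.v *)
From HB Require Import structures.
From mathcomp Require Import all_boot.
From mathcomp Require boolp.

Set Implicit Arguments.
Unset Strict Implicit.
Unset Printing Implicit Defensive.

Record sgraph := SGraph {
  svertex :> finType;
  sedge : rel svertex;
  sedge_sym : symmetric sedge;
  sedge_irrefl : irreflexive sedge }.

Notation "x -- y" := (sedge x y) (at level 30).

Definition nbh (G : sgraph) (x : G) : {set G} := [set y | x -- y].
Definition cnbh (G : sgraph) (x : G) : {set G} := x |: nbh x.

Section InducedSubgraph.
Variables (G : sgraph) (S : {set G}).

Definition induced_edge : rel {x : G | x \in S} :=
  [rel x y | val x -- val y].

Lemma induced_edge_sym : symmetric induced_edge.
Proof. by move=> x y; exact: sedge_sym. Qed.

Lemma induced_edge_irrefl : irreflexive induced_edge.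
Proof. by move=> x; exact: sedge_irrefl. Qed.

Definition induced : sgraph := SGraph induced_edge_sym induced_edge_irrefl.
End InducedSubgraph.

Definition contains_induced (P : sgraph -> Prop) (G : sgraph) : Prop :=
  exists S : {set G}, P (induced S).

Definition connected (G : sgraph) : Prop :=
  forall x y : G, connect (@sedge G) x y.

Definition acyclic (G : sgraph) : Prop :=
  forall c : seq G, 2 < size c -> uniq c -> ~~ cycle (@sedge G) c.

Definition consecutive (T : eqType) (s : seq T) (x y : T) : bool :=
  infix [:: x; y] s || infix [:: y; x] s.

(* The vertices of the path are x :: p, so its length is size p. *)
Definition induced_path (G : sgraph) (x : G) (p : seq G) (y : G) : Prop :=
  [/\ uniq (x :: p), last x p = y
    & {in x :: p &, forall u v : G, u -- v = consecutive (x :: p) u v}].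

Definition triangle (G : sgraph) (b : 'I_3 -> G) : Prop :=
  forall i j : 'I_3, i != j -> b i -- b j.

Definition triangle_free (G : sgraph) : Prop :=
  forall b : 'I_3 -> G, ~ triangle b.

Definition hole (G : sgraph) (c : seq G) : Prop :=
  [/\ 4 <= size c, uniq c
    & {in c &, forall x y : G, x -- y = (y == next c x) || (x == next c y)}].

Definition sparse (G : sgraph) : Prop :=
  forall (c : seq G) (v : G), hole c -> v \notin c ->
    exists a b : G, [/\ a \in c, b \in c, a -- b
      & nbh v :&: [set x in c] \subset [set a; b]].

(* In [pyramid] and [prism] the whole graph is the configuration: the paths
   and triangles cover all vertices, and a path has no edges of G among its
   vertices other than its own, hence [induced_path].  In [pyramid], p i lists
   the vertices of the i-th path other than a. *)
Definition pyramid (G : sgraph) : Prop :=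
  exists (a : G) (b : 'I_3 -> G) (p : 'I_3 -> seq G),
    [/\ triangle b,
        forall i, induced_path a (p i) (b i) /\ 1 <= size (p i),
        forall i j, i != j ->
          [/\ [disjoint p i & p j],
              {in p i & p j, forall x y : G,
                 x -- y -> x = b i /\ y = b j}
            & ~ (size (p i) = 1 /\ size (p j) = 1)]
      & forall x : G, x = a \/ exists i, x \in p i].

Definition prism (G : sgraph) : Prop :=
  exists (a b : 'I_3 -> G) (p : 'I_3 -> seq G),
    [/\ [/\ triangle a, triangle b & forall i j, a i != b j],
        forall i, induced_path (a i) (p i) (b i) /\ 1 <= size (p i),
        forall i j, i != j ->
          [disjoint a i :: p i & a j :: p j] /\
          {in a i :: p i & a j :: p j, forall x y : G, x -- y ->
             (x = a i /\ y = a j) \/ (x = b i /\ y = b j)}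
      & forall x : G, exists i, x \in a i :: p i].

Definition class_F2 (G : sgraph) : Prop :=
  [/\ triangle_free G, sparse G,
      ~ contains_induced pyramid G & ~ contains_induced prism G].

(* The three parts may be empty. *)
Definition separation (G : sgraph) (A C B : {set G}) : Prop :=
  [/\ A :|: C :|: B = [set: G],
      [/\ [disjoint A & C], [disjoint C & B] & [disjoint A & B]]
    & {in A & B, forall x y : G, ~~ (x -- y)}].

Definition star_separation (G : sgraph) (A C B : {set G}) : Prop :=
  separation A C B /\ exists2 v : G, v \in C & C \subset cnbh v.

Definition has_star_cutset (G : sgraph) : Prop :=
  exists A C B : {set G},
    [/\ star_separation A C B, A != set0 & B != set0].

Definition tree (T : sgraph) : Prop :=
  [/\ 0 < #|T|, connected T & acyclic T].

Definition tree_decomposition (G T : sgraph) (B : T -> {set G}) : Prop :=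
  [/\ tree T,
      forall v : G, exists t : T, v \in B t,
      forall u v : G, u -- v -> exists t : T, (u \in B t) && (v \in B t)
    & forall v : G, connected (induced [set t | v \in B t])].

Definition width (G T : sgraph) (B : T -> {set G}) : nat :=
  (\max_(t : T) #|B t|).-1.

Definition has_width (G : sgraph) (w : nat) : Prop :=
  exists (T : sgraph) (B : T -> {set G}),
    tree_decomposition B /\ width B = w.

Lemma has_width_ex (G : sgraph) : exists w, boolp.asbool (has_width G w).
Proof.
have sym : symmetric (fun _ _ : unit => false) by [].
have irr : irreflexive (fun _ : unit => fun _ : unit => false) by [].
pose T := SGraph sym irr; pose B (_ : T) := [set: G].
exists (width B); apply/boolp.asboolP; exists T, B; split=> //; split.
- split; first by rewrite card_unit.
  + by move=> [] []; exact: connect0.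
  + by case=> [|[] [|[] c]].
- by move=> v; exists tt; rewrite inE.
- by move=> u v _; exists tt; rewrite !inE.
- move=> v [[] p] [[] q]; suff -> : p = q by exact: connect0.
  exact: bool_irrelevance.
Qed.

(* The graph without vertices gets treewidth 0 rather than -1. *)
Definition treewidth (G : sgraph) : nat := ex_minn (has_width_ex G).

(* f gives the branch vertices, and p u v the inner vertices, in order from
   f u to f v, of the path replacing the edge uv. *)
Definition subdivision_of (W H : sgraph) : Prop :=
  exists (f : W -> H) (p : W -> W -> seq H),
    [/\ injective f,
        forall u v : W, u -- v ->
          [/\ p v u = rev (p u v), uniq (p u v)
            & forall w : W, f w \notin p u v],
        forall (u v u' v' : W) (x : H), u -- v -> u' -- v' ->
          x \in p u v -> x \in p u' v' ->
          (u' = u /\ v' = v) \/ (u' = v /\ v' = u),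
        forall x : H, (exists u : W, x = f u) \/
          (exists u v : W, u -- v /\ x \in p u v)
      & forall x y : H, x -- y <->
          exists u v : W, u -- v /\
            infix [:: x; y] (f u :: rcons (p u v) (f v))].

Section Suppress.
Variables (G : sgraph) (S : {set G}).

(* Suppressing the vertices of S, provided that each has degree two and that
   no two of them are adjacent: z in S is deleted and its two neighbors are
   joined. *)
Definition suppress_edge : rel {x : G | x \notin S} :=
  [rel x y | (val x -- val y) ||
    (x != y) && [exists z in S, (val x -- z) && (z -- val y)]].

Lemma suppress_edge_sym : symmetric suppress_edge.
Proof.
move=> x y; rewrite /suppress_edge /= sedge_sym eq_sym; congr (_ || (_ && _)).
by apply/existsP/existsP => -[z /and3P[zS xz zy]]; exists z;
  rewrite zS sedge_sym zy sedge_sym xz.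
Qed.

Lemma suppress_edge_irrefl : irreflexive suppress_edge.
Proof. by move=> x; rewrite /suppress_edge /= sedge_irrefl eqxx. Qed.

Definition suppress : sgraph := SGraph suppress_edge_sym suppress_edge_irrefl.
End Suppress.

Section Wall.
Variable k : nat.

(* Rows are numbered 1, ..., k and columns 0, ..., 2k-1. *)
Definition gamma_row (x : 'I_k * 'I_(2 * k)) : nat := x.1.+1.
Definition gamma_col (x : 'I_k * 'I_(2 * k)) : nat := x.2.

Definition gamma_arc : rel ('I_k * 'I_(2 * k)) :=
  [rel x y |
    (gamma_row y == gamma_row x) && (gamma_col y == (gamma_col x).+1)
    || [&& gamma_row y == (gamma_row x).+1, gamma_col y == gamma_col x
         & odd (gamma_row x + gamma_col x)]].

Definition gamma_edge : rel ('I_k * 'I_(2 * k)) :=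
  [rel x y | gamma_arc x y || gamma_arc y x].

Lemma gamma_edge_sym : symmetric gamma_edge.
Proof. by move=> x y; rewrite /gamma_edge /= orbC. Qed.

Lemma gamma_edge_irrefl : irreflexive gamma_edge.
Proof.
by move=> x; rewrite /gamma_edge /gamma_arc /= !(ltn_eqF (ltnSn _)) !andbF.
Qed.

Definition Gamma : sgraph := SGraph gamma_edge_sym gamma_edge_irrefl.

Definition Gamma_trim : sgraph := induced [set x : Gamma | #|nbh x| != 1].

(* For k >= 2, of two adjacent vertices of row 1 or k of Gamma one has a
   neighbor in another row, so the conditions of [suppress] hold; for k <= 1,
   Gamma_trim has no vertices, and so neither has the wall. *)
Definition wall_suppressed : {set Gamma_trim} :=
  [set x : Gamma_trim |
    ((gamma_row (val x) == 1) || (gamma_row (val x) == k)) &&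
    [forall y in nbh x, gamma_row (val y) == gamma_row (val x)]].

Definition wall : sgraph := suppress wall_suppressed.
End Wall.

(* Main.v *)
Require Import Defs.
From mathcomp Require Import all_boot.
From mathcomp Require Import boolp zify.

(** In a graph of the class every vertex off a hole has at most one neighbour on it.  Large
    treewidth gives a bramble of large order [N]; restrict to a minimal induced subgraph [H]
    carrying one.  Minimality forbids cut vertices and makes the far side of a small separation a
    path; with the sparsity of holes this shows that the components of the graph [bb] on the
    vertices of degree at least three are stars or double stars, and that contracting them keeps
    a bramble of order [N / 2].

    The contracted graph therefore has a model of a large grid, hence of the wall.  Pulled back to
    [H], the model consists of sets closed under [bb].  In each of them choose a center with
    induced legs, at most three, towards the neighbouring sets; this is possible because there are
    no triangles.  An edge between the spiders of two different sets has an end of degree two in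
    [H], and both edges at that end are already used, so the union of the spiders is an induced
    subdivision of the wall.

    The grid comes from linkages through a connected set [K] whose boundary is well linked: either
    all required pairs of boundary blocks can be joined by disjoint paths, or many disjoint paths
    of one kind cross many of another kind.  If the latter use as few edges off the former as
    possible, a Menger separator at each such edge shows that the two families cross in a fixed
    order. *)

(** A grid minor says nothing about induced subgraphs, since its sets may be joined by edges that
    the wall lacks. Contracting the edges between vertices of degree at least three forces all of
    them into single sets of the model. The price is the number of vertices that represent a
    contracted component in a hitting set; a double star needs its two centers.

    The shape of the components rests on one operation on brambles. Let [K] cut off a part of the
    graph, and let [K] minus some vertex [u] be a clique. That part can be replaced by any set [V]
    in it for which [u |: V] is connected and sees the rest of [K]: members containing [u] receive
    [V], and the order does not drop. In a minimal graph [V] is then the whole part, so choosing [V]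
    as an induced path determines it.

    Cliques enter through holes: two nonadjacent vertices that no clique separates lie on a common
    hole, and a third vertex cannot see both. Hence the separators that matter consist of a vertex
    and at most one edge. The largest separator used has one vertex more, that is four, which is why
    [N] is at least 5. *)

Set Implicit Arguments.
Unset Strict Implicit.
Unset Printing Implicit Defensive.

(* [lia] restricted to the arithmetic hypotheses, for speed. *)
Ltac slia :=
  repeat match goal with
  | H : ?P |- _ =>
    lazymatch P with
    | nat => fail
    | @eq nat _ _ => fail
    | is_true (leq _ _) => fail
    | is_true (negb (leq _ _)) => fail
    | _ => clear H
    end
  end; lia.

(** * Splitting sequences *)

Section SortedSplit.
Variables (T : eqType) (e : rel T).

Lemma sorted_split s1 a t :
  sorted e (s1 ++ a :: t) = sorted e (rcons s1 a) && path e a t.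
Proof.
by case: s1 => [|x s1] //=; rewrite cat_path rcons_path /= andbA.
Qed.

Lemma sorted_split2 s1 a s2 b s3 :
  sorted e (s1 ++ a :: s2 ++ b :: s3) =
  [&& sorted e (rcons s1 a), path e a s2, e (last a s2) b & path e b s3].
Proof. by rewrite sorted_split cat_path /=. Qed.

End SortedSplit.

Lemma first_split (T : Type) (a : pred T) s : has a s -> exists s1 b s2, [/\ s = s1 ++ b :: s2, a b & ~~ has a s1].
Proof.
elim: s => //= b R IH; case: (boolP (a b)) => ab /=.
  by move=> _; exists [::], b, R.
move=> /IH[R1 [c [R2 [-> ac nR]]]]; exists (b :: R1), c, R2; split=> //=.
by rewrite negb_or ab.
Qed.

Lemma last_split (T : Type) (a : pred T) s : has a s -> exists s1 b s2, [/\ s = s1 ++ b :: s2, a b & ~~ has a s2].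
Proof.
move=> h; have : has a (rev s) by rewrite has_rev.
case/first_split => R1 [b [R2 [E ab nR]]]; exists (rev R2), b, (rev R1).
by rewrite has_rev -[s]revK E rev_cat rev_cons cat_rcons.
Qed.

(** * Connected sets, boundaries and induced paths *)

Section Conn.
Variable G : sgraph.
Implicit Types (A B F X Y : {set G}) (x y z : G) (s p : seq G).

Lemma sedgeC x y : (x -- y) = (y -- x).
Proof. exact: sedge_sym. Qed.

Lemma sedgexx x : (x -- x) = false.
Proof. exact: sedge_irrefl. Qed.

Lemma sedge_neq x y : x -- y -> x != y.
Proof. by apply: contraTneq => ->; rewrite sedgexx. Qed.

Definition rin A : rel G := [rel x y | [&& x -- y, x \in A & y \in A]].

Lemma rin_sym A : symmetric (rin A).
Proof. by move=> x y; rewrite /rin /= sedge_sym [(x \in A) && _]andbC. Qed.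

Lemma connect_rinC A : connect_sym (rin A).
Proof. exact/sym_connect_sym/rin_sym. Qed.

Definition conn A := [forall x in A, forall y in A, connect (rin A) x y].

Lemma connP A : reflect {in A &, forall x y, connect (rin A) x y} (conn A).
Proof.
apply: (iffP forall_inP) => [h x y xA yA|h x xA].
  by have /forall_inP/(_ _ yA) := h _ xA.
by apply/forall_inP => y; exact: h.
Qed.

Lemma conn_from A x :
  x \in A -> {in A, forall y, connect (rin A) x y} -> conn A.
Proof.
move=> xA h; apply/connP => y z yA zA.
by apply: connect_trans (h _ zA); rewrite connect_rinC h.
Qed.

Lemma connect_rinS A B x y :
  A \subset B -> connect (rin A) x y -> connect (rin B) x y.
Proof.
move=> AB; apply: connect_sub => u v /and3P[uv uA vA].
by apply: connect1; rewrite /rin /= uv !(subsetP AB).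
Qed.

Lemma connect_rin_in A x y : connect (rin A) x y -> x \in A -> y \in A.
Proof.
move=> /connectP[p]; elim: p x => [|z p IH] x /=; first by move=> _ ->.
by move=> /andP[/and3P[_ _ zA] pz] Ey _; apply: (IH z).
Qed.

Lemma conn_closed A B x :
  conn A -> x \in B -> x \in A ->
  (forall y z, y \in A -> z \in A -> y \in B -> y -- z -> z \in B) ->
  A \subset B.
Proof.
move=> /connP cA xB xA cl; apply/subsetP => y yA.
have /connectP[p pp ->] := cA _ _ xA yA.
elim: p x xB {xA} pp => [|z p IH] x xB //= /andP[/and3P[xz xA zA] pp].
by apply: IH pp; apply: cl xz.
Qed.

(** Applied to the set of vertices reachable from [x]. Connectedness can thus be proved without
    exhibiting walks, which is how modified bramble members are treated below. *)
Lemma connI A :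
  (forall B x y, B \subset A -> x \in B -> y \in A -> 
    (forall y z, y \in B -> z \in A -> y -- z -> z \in B) -> y \in B) ->
  conn A.
Proof.
move=> h; apply/connP => x y xA yA.
have := h [set z in A | connect (rin A) x z] x y.
rewrite !inE xA connect0 yA /=; apply=> //.
  by apply/subsetP => z; rewrite inE => /andP[].
move=> u v; rewrite !inE => /andP[uA xu] vA uv; rewrite vA /=.
by apply: connect_trans xu _; apply: connect1; rewrite /rin /= uv uA.
Qed.

Lemma conn1 x : conn [set x].
Proof. by apply/connP => y z /set1P-> /set1P->; exact: connect0. Qed.

Lemma conn0 : conn set0.
Proof. by apply/connP => x y; rewrite inE. Qed.

Definition touch A B :=
  [exists x in A, exists y in B, (x == y) || (x -- y)].

Lemma touchP A B :
  reflect (exists x y, [/\ x \in A, y \in B & x = y \/ x -- y]) (touch A B).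
Proof.
apply: (iffP exists_inP) => [[x xA /exists_inP[y yB h]]|[x [y [xA yB h]]]].
  by exists x, y; split=> //; case/orP: h => [/eqP|]; [left|right].
exists x => //; apply/exists_inP; exists y => //.
by case: h => ->; rewrite ?eqxx ?orbT.
Qed.

Lemma touchC A B : touch A B = touch B A.
Proof.
by apply/touchP/touchP => -[x [y [xA yB h]]]; exists y, x; split=> //;
  case: h => [->|]; rewrite 1?sedgeC; auto.
Qed.

Lemma conn_setU A B : conn A -> conn B -> touch A B -> conn (A :|: B).
Proof.
move=> /connP cA /connP cB /touchP[x [y [xA yB xy]]].
have xyc : connect (rin (A :|: B)) x y.
  case: xy => [->|xy]; first exact: connect0.
  by apply: connect1; rewrite /rin /= xy !inE xA yB orbT.
apply: (@conn_from _ x); first by rewrite inE xA.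
move=> z; rewrite inE => /orP[zA|zB].
  by apply: (@connect_rinS A); [exact: subsetUl | exact: cA].
apply: connect_trans xyc _.
by apply: (@connect_rinS B); [exact: subsetUr | exact: cB].
Qed.

Lemma conn_bigcup (I : Type) (r : seq I) (P : pred I) (C : I -> {set G}) A :
  conn A -> (forall i, P i -> conn (C i) /\ touch A (C i)) ->
  conn (A :|: \bigcup_(i <- r | P i) C i).
Proof.
move=> cA h; elim: r => [|i r IH]; first by rewrite big_nil setU0.
rewrite big_cons; case: ifP => // Pi; rewrite setUCA setUC.
have [cC /touchP[x [y [xA yC xy]]]] := h _ Pi.
apply: conn_setU => //; apply/touchP; exists x, y.
by rewrite inE xA.
Qed.

(** The component of [x] in the subgraph on [F]; for [x] outside [F] it is the singleton of [x]. *)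
Definition comp F x := [set y | connect (rin F) x y].

Lemma comp_refl F x : x \in comp F x.
Proof. by rewrite inE connect0. Qed.

Lemma comp_sub F x : x \in F -> comp F x \subset F.
Proof. by move=> xF; apply/subsetP => y; rewrite inE => /connect_rin_in; apply. Qed.

Lemma comp_closed F x y z :
  x \in F -> y \in comp F x -> z \in F -> y -- z -> z \in comp F x.
Proof.
move=> xF; rewrite !inE => xy zF yz; apply: (connect_trans xy).
by apply: connect1; rewrite /rin /= yz zF (connect_rin_in xy).
Qed.

Lemma conn_comp F x : x \in F -> conn (comp F x).
Proof.
move=> xF; apply: (@conn_from _ x); first exact: comp_refl.
move=> y; rewrite inE => /connectP[p pp ->].
suff: path (rin (comp F x)) x p by move=> pp'; apply/connectP; exists p.
suff aux q w : w \in comp F x -> path (rin F) w q -> path (rin (comp F x)) w q.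
  exact: aux (comp_refl F x) pp.
elim: q w => [|z q IH] w //= wc /andP[wz pq].
have /and3P[wz' wF zF] := wz.
have zc : z \in comp F x by apply: comp_closed wz'.
by rewrite /rin /= wz' wc zc /=; apply: IH.
Qed.

Lemma comp_max F x A :
  x \in F -> conn A -> A \subset F -> x \in A -> A \subset comp F x.
Proof.
move=> xF /connP cA AF xA; apply/subsetP => y yA; rewrite inE.
by apply: (connect_rinS AF); exact: cA.
Qed.

Lemma comp_eq F x y : x \in F -> y \in comp F x -> comp F y = comp F x.
Proof.
move=> xF; rewrite inE => xy; apply/setP => z; rewrite !inE.
by rewrite (same_connect (@connect_rinC F) xy).
Qed.

Definition NB A := [set y | (y \notin A) && [exists x in A, x -- y]].

Lemma NBP A y : reflect (y \notin A /\ exists2 x, x \in A & x -- y) (y \in NB A).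
Proof.
rewrite inE; apply: (iffP andP) => -[yA].
  by case/exists_inP=> x ? ?; split=> //; exists x.
by move=> h; split=> //; apply/exists_inP.
Qed.

Lemma NB_comp F x : x \in F -> NB (comp F x) \subset ~: F.
Proof.
move=> xF; apply/subsetP => y /NBP[yC [z zC zy]]; rewrite inE.
by apply: contra yC => yF; apply: comp_closed zy.
Qed.

Lemma conn_exit A X x y :
  conn A -> x \in A -> y \in A -> x \in X -> y \notin X ->
  exists u v, [/\ u \in A, v \in A, u \in X, v \notin X & u -- v].
Proof.
move=> cA xA yA xX yX; apply: contrapT => h.
move/negP: yX; apply; apply: (subsetP (conn_closed cA xX xA _)) => // u v uA vA uX uv.
by apply/negPn/negP => vX; apply: h; exists u, v.
Qed.

(** A recursive form of an induced path without distinguished ends, convenient for splitting,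
    joining and reversing. *)
Fixpoint ipath s := if s is x :: s' then
  [&& x \notin s',
      (if s' is y :: s'' then (x -- y) && all (fun z => ~~ (x -- z)) s'' else true)
    & ipath s'] else true.

Lemma ipath_uniq s : ipath s -> uniq s.
Proof. by elim: s => //= x s IH /and3P[-> _ /IH]. Qed.

Lemma ipath_sorted s : ipath s -> sorted (@sedge G) s.
Proof.
by elim: s => //= x [|y s] // IH /and3P[_ /andP[xy _] /IH] /=; rewrite xy.
Qed.

Lemma ipath_cross s1 a s2 b s3 : ipath (s1 ++ a :: s2 ++ b :: s3) ->
  a != b /\ (s2 != [::] -> ~~ (a -- b)).
Proof.
elim: s1 => [|x s1 IH] /=; last by move=> /and3P[_ _ /IH].
case/and3P; rewrite mem_cat in_cons !negb_or => /and3P[_ -> _] h _; split=> //.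
case: s2 h => //= y s2 /andP[_]; rewrite all_cat /= => /and3P[_ -> _] //.
Qed.

Lemma ipath_intro s : sorted (@sedge G) s ->
  (forall s1 a s2 b s3, s = s1 ++ a :: s2 ++ b :: s3 ->
     a != b /\ (s2 != [::] -> ~~ (a -- b))) -> ipath s.
Proof.
elim: s => //= x s IH ps h; apply/and3P; split.
- apply/negP => /path.splitPr xs; case: xs h {IH ps} => p1 p2 h.
  by have [] := h [::] x p1 x p2 erefl; rewrite eqxx.
- case: s {IH} ps h => //= y s /andP[-> ps] h /=; apply/allP => z /path.splitPr zs.
  case: zs h {ps} => p1 p2 h.
  by have [_ ->] := h [::] x (y :: p1) z p2 erefl.
apply: IH; first by move/path_sorted: ps.
by move=> s1 a s2 b s3 E; apply: (h (x :: s1)); rewrite E.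
Qed.

Lemma ipath_catI s1 x y s2 :
  ipath (rcons s1 x) -> ipath (y :: s2) -> x -- y ->
  {in rcons s1 x & y :: s2, forall a b, a != b /\ (a -- b -> a = x /\ b = y)} ->
  ipath (rcons s1 x ++ y :: s2).
Proof.
elim: s1 => [|z s1 IH] /=.
  move=> _ ps xy cr; have /and3P[ys _ _] := ps; rewrite ps xy andbT /=.
  apply/andP; split.
    by apply/negP => xs; have [] := cr x x; rewrite ?inE ?eqxx.
  apply/allP => z zs; apply/negP => xz.
  have [_ /(_ xz)[_ zy]] := cr x z (mem_head _ _) (mem_behead (zs : z \in behead (y :: s2))).
  by rewrite -zy zs in ys.
case/and3P => zs1 h ps ps2 xy cr; apply/and3P; split.
- rewrite mem_cat negb_or zs1 /=; apply/negP => zs2.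
  by have [] := cr z z; rewrite ?mem_head ?eqxx.
- have zx b : b \in y :: s2 -> ~~ (z -- b).
    move=> bs; apply/negP => zb; have [_ /(_ zb)[zx _]] := cr z b (mem_head _ _) bs.
    by rewrite zx mem_rcons mem_head in zs1.
  case E: (rcons s1 x) h => [|w s] /=; first by case: (s1) E.
  case/andP => -> /= hs; rewrite all_cat hs /=; apply/andP; split; first exact: zx (mem_head _ _).
  by apply/allP => b bs; apply: zx; rewrite inE bs orbT.
apply: IH => // a b aS bS; apply: cr => //.
by rewrite in_cons aS orbT.
Qed.

Lemma ipath_cat s1 s2 : ipath (s1 ++ s2) -> ipath s1 /\ ipath s2.
Proof.
elim: s1 => //= x s1 IH /and3P[xs h /IH[-> ->]]; split=> //.
move: xs h; rewrite mem_cat negb_or => /andP[-> _].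
by case: s1 {IH} => //= y s1 /andP[-> ]; rewrite all_cat => /andP[->].
Qed.

Lemma ipath_rev s : ipath s -> ipath (rev s).
Proof.
elim: s => //= x s IH /and3P[xs h ps]; have := IH ps.
case: s xs h ps {IH} => [|y s] xs h ps; first by [].
rewrite !rev_cons => ps'; rewrite -cats1; apply: ipath_catI => //.
  by case/andP: h; rewrite sedgeC.
move=> a b; rewrite -rev_cons mem_rev => aS; rewrite inE => /eqP ->; split.
  by apply: contraNneq xs => <-.
case/andP: h => _ /allP h; rewrite sedgeC => xa; split=> //.
by move: aS; rewrite inE => /orP[/eqP //|/h]; rewrite xa.
Qed.

(* Take a shortest walk. *)
Lemma min_walk F X Y x p :
  x \in X -> last x p \in Y -> x \in F -> path (rin F) x p ->
  exists z q, [/\ ipath (z :: q), {subset z :: q <= F}, z \in X, last z q \in Y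
    & [/\ {in q, forall w, w \notin X}, {in belast z q, forall w, w \notin Y}
        & size q <= size p]].
Proof.
move=> xX yY xF pp.
have [n] := ubnP (size p); elim: n x p xX xF yY pp => // n IH x p xX xF yY pp sp.
(* Either the walk is already as required, or a shortcut gives a shorter one and the induction
   hypothesis applies. *)
suff : (exists x' p', [/\ x' \in X, x' \in F, last x' p' \in Y, path (rin F) x' p' & size p' < size p]) \/
  (exists z q, [/\ ipath (z :: q), {subset z :: q <= F}, z \in X, last z q \in Y
    & [/\ {in q, forall w, w \notin X}, {in belast z q, forall w, w \notin Y}
        & size q <= size p]]).
  case=> // -[x' [p' [x'X x'F yY' pp' sp']]].
  have [|z [q [h1 h2 h3 h4 [h5 h6 h7]]]] := IH x' p' x'X x'F yY' pp'; first by slia.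
  by exists z, q; split=> //; split=> //; slia.
have subF : {subset x :: p <= F}.
  move=> z; rewrite inE => /orP[/eqP -> //|].
  elim: (p) (x) pp => //= u q IHq w /andP[/and3P[_ _ uF] pq].
  by rewrite inE => /orP[/eqP ->//|]; exact: IHq pq.
have [[w wp wX]|nX] := pselect (exists2 w, w \in p & w \in X).
  case/path.splitPr: wp pp yY subF => p1 p2.
  rewrite cat_path /= last_cat /= => /and3P[_ _ pp] yY subF.
  left; exists w, p2; split=> //; last by rewrite size_cat /=; slia.
  by apply: subF; rewrite inE mem_cat mem_head !orbT.
have [[w wp wY]|nY] := pselect (exists2 w, w \in belast x p & w \in Y).
  have : exists p1 p2, p = p1 ++ p2 /\ last x p1 = w /\ p2 != [::].
    elim: (p) (x) wp => //= a q IHq b; rewrite inE => /orP[/eqP ->|/IHq].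
      by exists [::], (a :: q).
    by case=> p1 [p2 [-> [<- ?]]]; exists (a :: p1), p2.
  case=> p1 [p2 [Ep [Ew p20]]]; rewrite Ep cat_path in pp.
  left; exists x, p1; split=> //; first by rewrite Ew.
    by case/andP: pp.
  by rewrite Ep size_cat; case: p2 p20 {Ep pp} => //=; slia.
have srt : sorted (rin F) (x :: p) by [].
have [ip|nip] := boolP (ipath (x :: p)).
  right; exists x, p; split=> //; split=> // w wp; apply/negP => wX.
    by apply: nX; exists w.
  by apply: nY; exists w.
(* A walk that is not an induced path has a repeated vertex or a chord; what lies in between is cut
   out. *)
have [s1 [a [s2 [b [s3 [E ab]]]]]] : exists s1 a s2 b s3, x :: p = s1 ++ a :: s2 ++ b :: s3 /\
     (a = b \/ s2 != [::] /\ a -- b).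
  apply: contrapT => h; move/negP: nip; apply; apply: ipath_intro.
    by apply: sub_sorted srt => u v /and3P[].
  move=> s1 a s2 b s3 E; split.
    by apply/eqP => ab; apply: h; exists s1, a, s2, b, s3; split=> //; left.
  move=> s20; apply/negP => ab; apply: h; exists s1, a, s2, b, s3; split=> //; right; split=> //.
have [aF bF] : a \in F /\ b \in F.
  by split; apply: subF; rewrite E !(mem_cat, inE) eqxx !orbT.
have [x' [p' [E' sp' srt']]] : exists x' p', [/\ head x s1 = head x s1 /\ x' = head a s1, 
    size p' < size p & sorted (rin F) (x' :: p') /\ last x' p' = last x p].
  have sE : (size p).+1 = size s1 + (size s2 + (size s3).+1).+1.
    by rewrite -[LHS]/(size (x :: p)) E size_cat /= size_cat.
  have lE : last x p = last b s3.
    by rewrite -[LHS]/(last x (x :: p)) E last_cat /= last_cat.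
  move: srt; rewrite E sorted_split2 => /and4P[h1 h2 h3 h4].
  case: ab => [ab|[s20 ab]].
    exists (head a s1), (behead (s1 ++ b :: s3)); split=> //.
      by rewrite size_behead size_cat /=; slia.
    have -> : head a s1 :: behead (s1 ++ b :: s3) = s1 ++ b :: s3.
      by case: (s1); rewrite //= ab.
    rewrite sorted_split -ab h1 ab h4 lE; split=> //.
    by case: (s1) => [|c s] /=; rewrite ?last_cat.
  exists (head a s1), (behead (s1 ++ a :: b :: s3)); split=> //.
    by rewrite size_behead size_cat /=; case: s2 s20 sE {h2 h3 E} => //=; slia.
  have -> : head a s1 :: behead (s1 ++ a :: b :: s3) = s1 ++ a :: b :: s3.
    by case: (s1).
  rewrite sorted_split h1 /= /rin /= ab aF bF h4 lE; split=> //.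
  by case: (s1) => [|c s] /=; rewrite ?last_cat.
case: E' => _ E'.
have Ex' : x' = x by rewrite E'; case: (s1) E => [|? ?] /= [->].
rewrite Ex' in srt' => {E' x' Ex'}.
by case: srt' => srt' l; left; exists x, p'; split=> //; rewrite l.
Qed.

Lemma min_link F X Y x y :
  x \in X -> y \in Y -> x \in F -> connect (rin F) x y ->
  exists z p, [/\ ipath (z :: p), {subset z :: p <= F}, z \in X, last z p \in Y
    & {in p, forall w, w \notin X} /\ {in belast z p, forall w, w \notin Y}].
Proof.
move=> xX yY xF /connectP[p pp Ey]; rewrite Ey in yY.
have [z [q [? ? ? ? [? ? _]]]] := min_walk xX yY xF pp.
by exists z, q.
Qed.

Lemma connect_closed A B x y : connect (rin A) x y -> x \in B ->
  (forall u v, u \in A -> v \in A -> u \in B -> u -- v -> v \in B) -> y \in B.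
Proof.
move=> /connectP[p]; elim: p x => [|z p IH] x /=; first by move=> _ ->.
move=> /andP[/and3P[xz xA zA] pp] Ey xB cl; exact: (IH z pp Ey (cl _ _ xA zA xB xz) cl).
Qed.

End Conn.

(** * Holes in sparse triangle-free graphs *)

Section Holes.
Variable G : sgraph.
Implicit Types (A B F : {set G}) (x y z p q : G) (s t : seq G).

(** A hole cut open at [x]. The choice of [x] is immaterial: rotations and reversals bring any
    vertex or edge of the cycle to the front. *)
Definition ihole x s :=
  [&& ipath s, 2 < size s, x \notin s
    & all (fun y => (x -- y) == (y == head x s) || (y == last x s)) s].

Lemma ihole_intro x s : ipath s -> 2 < size s -> x \notin s ->
  x -- head x s -> x -- last x s ->
  (forall y, y \in s -> x -- y -> y = head x s \/ y = last x s) -> ihole x s.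
Proof.
rewrite /ihole => -> -> -> h l o /=; apply/allP => y ys; apply/eqP.
apply/idP/idP => [/(o _ ys)[] -> | /orP[] /eqP -> //]; by rewrite eqxx ?orbT.
Qed.

Lemma iholeP x s : ihole x s ->
  [/\ ipath s, 2 < size s, x \notin s, x -- head x s & x -- last x s] /\
  (forall y, y \in s -> x -- y -> y = head x s \/ y = last x s).
Proof.
move=> /and4P[ip sz xs /allP h].
have [hs ls] : head x s \in s /\ last x s \in s.
  by case: (s) sz => //= a u _; rewrite mem_head mem_last.
split; first by split=> //; apply/idP; rewrite (eqP (h _ _)) ?eqxx ?orbT.
by move=> y ys xy; have := h _ ys; rewrite xy eq_sym => /eqP/orP[/eqP|/eqP]; [left|right].
Qed.

Lemma ipath_adj s u v : ipath s -> u \in s -> v \in s ->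
  (u -- v) = (index v s == (index u s).+1) || (index u s == (index v s).+1).
Proof.
elim: s => //= x s IH /and3P[xs hx ps]; rewrite !inE.
have adj y : y \in s -> (x -- y) = (0 == index y s).
  case: (s) hx {IH ps xs} => //= z s' /andP[xz /allP h].
  rewrite inE [z == y]eq_sym; case: eqP => [-> //|_] /= ys.
  by apply/negbTE; exact: h.
case: (eqVneq x u) => [<-|xu]; case: (eqVneq x v) => [<-|xv] /=.
- by rewrite sedgexx.
- by move=> _ vs; rewrite adj // orbF eqSS eq_sym.
- by move=> us _; rewrite sedgeC adj // eqSS eq_sym.
by move=> us vs; rewrite IH // !eqSS.
Qed.

Lemma ihole_hole x s : ihole x s -> hole (x :: s).
Proof.
case/iholeP=> -[ip sz xs xh xl] xo; have us := ipath_uniq ip.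
split=> //; first by rewrite /= xs.
have sp : 0 < size s by slia.
have nx : next (x :: s) x = head x s by rewrite next_nth mem_head /= eqxx; case: (s).
have ns u : u \in s -> next (x :: s) u = nth x s (index u s).+1.
  move=> uS; rewrite next_nth inE uS orbT /=; case: eqP => // E.
  by rewrite E uS in xs.
have h0 : index (head x s) s = 0 by case: (s) sp => //= a t; rewrite eqxx.
have il : index (last x s) s = (size s).-1.
  by case: (s) us sp => // a t us' _; rewrite /last -/(last a t) index_last.
have xadj v : v \in s -> (x -- v) = (v == next (x :: s) x) || (x == next (x :: s) v).
  move=> vS; rewrite nx ns //; apply/idP/idP.
    case/(xo _ vS) => ->; first by rewrite eqxx.
    by rewrite il prednK // nth_default ?eqxx ?orbT.
  case/orP => /eqP; first by move=> ->.
  have [lt E|le _] := ltnP (index v s).+1 (size s).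
    by rewrite E mem_nth in xs.
  have -> // : v = last x s.
  rewrite -(nth_index x vS) (last_nth x) /=.
  have -> : index v s = (size s).-1.
    by apply/eqP; rewrite eqn_leq -ltnS prednK // index_mem vS -subn1 leq_subLR add1n.
  by case: (s) sp.
move=> u v; rewrite !inE => /orP[/eqP->|uS] /orP[/eqP->|vS].
- rewrite sedgexx nx orbb; apply/esym/negbTE; apply: contraNneq xs => ->.
  by case: (s) sp => // a t _; rewrite mem_head.
- exact: xadj.
- by rewrite sedgeC xadj // orbC.
rewrite (ipath_adj ip) // !ns //.
have E a b : a \in s -> b \in s -> (b == nth x s (index a s).+1) = (index b s == (index a s).+1).
  move=> aS bS; have [lt|le] := ltnP (index a s).+1 (size s).
    by rewrite -{1}(nth_index x bS) nth_uniq ?index_mem.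
  rewrite nth_default //; apply/idP/idP => [/eqP E|/eqP E]; first by rewrite E (negbTE xs) in bS.
  by rewrite leqNgt -E index_mem bS in le.
by rewrite !E.
Qed.

Lemma ihole_rot x y s : ihole x (y :: s) -> ihole y (rcons s x).
Proof.
case/iholeP=> -[/=/and3P[ys hy ps] sz xs xh xl] xo.
have s0 : s = rcons (belast (head y s) (behead s)) (last x s).
  by case: (s) sz => //= a t _; rewrite -lastI.
move: xs; rewrite inE negb_or => /andP[xy xs].
have hr : head y (rcons s x) = head y s by case: (s) sz.
have ll : last y s = last x s by case: (s) sz.
apply: ihole_intro.
- rewrite s0 -cats1; apply: ipath_catI => //; rewrite -?s0 //.
    by rewrite sedgeC -ll.
  move=> a b aS; rewrite inE => /eqP ->; split; first by apply: contraNneq xs => <-.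
  rewrite sedgeC => /xo[]; rewrite ?inE ?aS ?orbT //=; last by rewrite -ll.
  by move=> E; rewrite -E aS in ys.
- by rewrite size_rcons.
- by rewrite mem_rcons inE negb_or eq_sym xy.
- by rewrite hr; case: (s) sz hy => //= a t _ /andP[].
- by rewrite last_rcons sedgeC.
move=> z; rewrite mem_rcons inE last_rcons hr => /orP[/eqP->|]; first by right.
case: (s) hy => //= a t /andP[_ /allP h]; rewrite inE => /orP[/eqP ->|/h /negP //]; by left.
Qed.

Lemma ihole_rev x s : ihole x s -> ihole x (rev s).
Proof.
case/iholeP=> -[ip sz xs xh xl] xo.
have E : (head x (rev s) = last x s) * (last x (rev s) = head x s).
  split; first by case/lastP: (s) => // t a; rewrite rev_rcons last_rcons.
  by case: (s) => // t a; rewrite rev_cons last_rcons.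
apply: ihole_intro; rewrite ?mem_rev ?size_rev ?E //; first exact: ipath_rev.
by move=> y; rewrite mem_rev => ys /(xo _ ys)[]; [right|left].
Qed.

Lemma ihole_at x s z : ihole x s -> z \in x :: s ->
  exists2 t, ihole z t & x :: s =i z :: t.
Proof.
rewrite inE => h /orP[/eqP->|zs]; first by exists s.
elim: {s}(index z s) {-2}s x (erefl (index z s)) zs h => [|n IH] [|y s] x //=.
  case: eqP => // <- _ _ h; exists (rcons s x); first exact: ihole_rot.
  by move=> w; rewrite !inE mem_rcons inE; do 2!case: eqP.
case: eqP => // yz [E]; rewrite inE => /orP[/eqP|zs h]; first by move=> /esym.
have [||t ht Et] := IH (rcons s x) y _ _ (ihole_rot h).
- by rewrite -cats1 index_cat zs.
- by rewrite mem_rcons inE zs orbT.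
exists t => // w; rewrite -Et !inE mem_rcons inE; by do 2!case: eqP.
Qed.

Lemma ihole_edge x s p q : ihole x s -> p \in x :: s -> q \in x :: s -> p -- q ->
  exists2 t, ihole q (p :: t) & x :: s =i q :: p :: t.
Proof.
move=> h pS qS pq; have [t ht E] := ihole_at h qS.
have pt : p \in t.
  by move: pS; rewrite E inE => /orP[/eqP pq'|//]; rewrite pq' sedgexx in pq.
have [_ ho] := iholeP ht; rewrite sedgeC in pq.
have [Ep|Ep] := ho _ pt pq.
  exists (behead t); first by case: (t) pt ht Ep => //= a u _ ht ->.
  by move=> w; rewrite E; case: (t) pt Ep => //= a u _ ->.
exists (behead (rev t)).
  have := ihole_rev ht; case/lastP: (t) pt Ep => // u a _; rewrite last_rcons => ->.
  by rewrite rev_rcons.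
move=> w; rewrite E !inE; case/lastP: (t) pt Ep => // u a _; rewrite last_rcons => ->.
by rewrite rev_rcons /= mem_rcons inE mem_rev.
Qed.

Lemma ipath_catE d s1 s2 : ipath s1 -> ipath s2 -> s1 != [::] -> s2 != [::] ->
  last d s1 -- head d s2 ->
  {in s1 & s2, forall a b, a != b /\ (a -- b -> a = last d s1 /\ b = head d s2)} ->
  ipath (s1 ++ s2).
Proof.
case/lastP: s1 => // s1 x; case: s2 => // y s2 p1 p2 _ _; rewrite last_rcons => xy cr.
exact: ipath_catI.
Qed.

End Holes.

Definition tfree (G : sgraph) := forall x y z : G, x -- y -> y -- z -> x -- z -> False.

Definition hole1 (G : sgraph) := forall (x : G) s v y1 y2, ihole x s ->
  v \notin x :: s -> y1 \in x :: s -> y2 \in x :: s -> v -- y1 -> v -- y2 -> y1 = y2.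

Definition clean (G : sgraph) := tfree G /\ hole1 G.

(** By sparsity two neighbours on a hole would be the ends of one of its edges, and this edge would
    form a triangle with [v]. *)
Lemma class_F2_clean G : class_F2 G -> clean G.
Proof.
move=> [tf sp _ _]; have tf' : tfree G.
  move=> x y z xy yz xz; apply: (tf (fun i : 'I_3 => nth x [:: x; y; z] i)).
  by move=> [[|[|[|i]]] hi] [[|[|[|j]]] hj] //= _; rewrite // sedgeC.
split=> // x s v y1 y2 h vs y1s y2s v1 v2.
have [a [b [aS bS ab sub]]] := sp _ _ (ihole_hole h) vs.
have inab y : y \in x :: s -> v -- y -> y = a \/ y = b.
  move=> ys vy; have : y \in [set a; b] by apply: (subsetP sub); rewrite !inE in ys *; rewrite vy.
  by rewrite !inE => /orP[/eqP|/eqP]; auto.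
case: (inab _ y1s v1) (inab _ y2s v2) => E1 [] E2; rewrite E1 E2 //; exfalso.
  by apply: (tf' v a b); rewrite -?E1 -?E2 // ?E1 ?E2.
by apply: (tf' v b a); rewrite -?E1 -?E2 // ?E1 ?E2 // sedgeC.
Qed.

(** * Two holes sharing an edge, joined by a path *)

Section K4.
Variable G : sgraph.
Implicit Types (A B F : {set G}) (x y z p q r s : G) (t X Y R S : seq G).
Hypothesis cG : clean G.

Lemma ihole_swap q p X : ihole q (p :: X) -> ihole p (q :: rev X).
Proof. by move/ihole_rot/ihole_rev; rewrite rev_rcons. Qed.

Lemma ihole_edgeP q p X : ihole q (p :: X) ->
  [/\ [/\ p \notin X, q \notin X, p != q & p -- q],
      [/\ ipath X, X != [::], p -- head q X & q -- last q X],
      {in X, forall a, p -- a -> a = head q X} & {in X, forall a, q -- a -> a = last q X}].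
Proof.
case/iholeP=> -[/=/and3P[pX hp pX'] sz]; rewrite inE negb_or => /andP[qp qX] qpe ql qo.
have X0 : X != [::] by case: (X) sz.
have lE : last p X = last q X by case: (X) X0.
split.
- by split=> //; rewrite 1?eq_sym 1?sedgeC.
- by split=> //; rewrite -?lE //; case: (X) X0 hp => //= a u _ /andP[].
- move=> a; case: (X) hp => //= b u /andP[_ /allP h]; rewrite inE => /orP[/eqP //|/h /negbTE ->] //.
move=> a aX qa; case: (qo a); rewrite ?inE ?aX ?orbT ?lE // => E.
by rewrite -E aX in pX.
Qed.

(** The part of the hole between [q] and [r] through [p] is exchanged for [S]. If [S] and the kept
    part [r :: X2] are single vertices, they would form a triangle with [q], so the new cycle is
    long enough. *)
Lemma k4hole q p X1 r X2 S : ihole q (p :: X1 ++ r :: X2) ->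
  ipath S -> S != [::] -> q \notin S -> q -- last q S -> head q S -- r ->
  {in S, forall a, q -- a -> a = last q S} ->
  {in r :: X2 & S, forall b a, b != a /\ (b -- a -> b = r /\ a = head q S)} ->
  ihole q (rev (r :: X2) ++ S).
Proof.
move=> /ihole_edgeP [[pX qX pq pqe] [pX' X0 ph ql] po qo] pS S0 qS qlS hr qoS cr.
have [_ pr2] := ipath_cat pX'.
have qX2 : q \notin r :: X2 by apply: contra qX; rewrite mem_cat => ->; rewrite orbT.
have lX : last q (X1 ++ r :: X2) = last r X2 by rewrite last_cat.
have hd d : head d (rev (r :: X2) ++ S) = last r X2.
  by rewrite (lastI r X2 : r :: X2 = _) rev_rcons.
have lst : last q (rev (r :: X2) ++ S) = last q S by rewrite last_cat; case: (S) S0.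
apply: ihole_intro.
- apply: (@ipath_catE _ q) => //; first exact: ipath_rev.
  + by rewrite rev_cons; case: (rev X2).
  + by rewrite rev_cons last_rcons sedgeC.
  move=> a b; rewrite mem_rev rev_cons last_rcons => aX bS.
  exact: cr.
- rewrite size_cat size_rev /=; case: (X2) (S) S0 lX ql qlS hr => [|? ?] [|a [|? ?]] //= _ lX ql qa ar.
    exfalso; apply: (cG.1 a r q) => //; last by rewrite sedgeC.
    by rewrite sedgeC -lX.
  by slia.
  by slia.
- by rewrite mem_cat negb_or mem_rev qX2.
- by rewrite hd -lX.
- by rewrite lst.
move=> y; rewrite hd lst mem_cat mem_rev => /orP[yX|yS] qy.
  by left; rewrite -lX; apply: qo => //; rewrite mem_cat yX orbT.
by right; apply: qoS.
Qed.

(** A subdivision of the complete graph on [p], [q], [r], [s] in which the edge [pq] is not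
    subdivided: [X] leads from [p] over [r] to [q], [Y] from [p] over [s] to [q], and [R] joins [r]
    to [s]. Edges from [p] or [q] to [R] are not excluded here; [k4_noR] excludes them. *)
Record k4 q p X Y R r1 rl r s : Prop := K4cfg {
  k4A : ihole q (p :: X);
  k4B : ihole q (p :: Y);
  k4XY : {in X & Y, forall a b, a != b /\ ~~ (a -- b)};
  k4R : ipath R;
  k4R0 : R != [::];
  k4h : forall d, head d R = r1;
  k4l : forall d, last d R = rl;
  k4rX : r \in X;
  k4sY : s \in Y;
  k4r : r1 -- r;
  k4s : rl -- s;
  k4RX : {in R & X, forall a b, a != b /\ (a -- b -> a = r1 /\ b = r)};
  k4RY : {in R & Y, forall a b, a != b /\ (a -- b -> a = rl /\ b = s)};
  k4Rpq : {in R, forall a, a != p /\ a != q} }.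

Lemma k4_sym q p X Y R r1 rl r s :
  k4 q p X Y R r1 rl r s -> k4 p q (rev X) (rev Y) R r1 rl r s.
Proof.
case=> A B XY pR R0 h l rX sY r1r rls RX RY Rpq.
split=> //; rewrite ?mem_rev //; try exact: ihole_swap.
- by move=> a b; rewrite !mem_rev; exact: XY.
- by move=> a b aR; rewrite mem_rev; exact: RX.
- by move=> a b aR; rewrite mem_rev; exact: RY.
by move=> a /Rpq[].
Qed.

(* [p] sees [q], so by sparsity it sees nothing else on a hole through [q]. *)
Lemma k4_noS q p X Y R r1 rl r s X1 X2 S : k4 q p X Y R r1 rl r s ->
  X = X1 ++ r :: X2 -> 
  ipath S -> S != [::] -> q \notin S -> q -- last q S -> head q S = r1 ->
  {in S, forall a, q -- a -> a = last q S} ->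
  {in r :: X2 & S, forall b a, b != a /\ (b -- a -> b = r /\ a = head q S)} ->
  p \notin S -> {in r :: S, forall y, ~~ (p -- y)}.
Proof.
move=> K EX pS S0 qS qlS hS qo cr pnS y yS.
have A := k4A K; rewrite EX in A.
have H : ihole q (rev (r :: X2) ++ S) by apply: k4hole A _ _ _ _ _ _ _ => //; rewrite hS (k4r K).
have [[pX qX pq pqe] _ _ _] := ihole_edgeP (k4A K).
apply/negP => py; have rX := k4rX K.
have pX2 : p \notin r :: X2 by apply: contra pX; rewrite EX mem_cat => ->; rewrite orbT.
have qy : q = y.
  apply: (cG.2 _ _ _ _ _ H _ _ _ pqe py).
  - by move: pX2 pnS; rewrite !(inE, mem_cat, mem_rev) !negb_or pq => /andP[-> ->] ->.
  - exact: mem_head.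
  by move: yS; rewrite !(inE, mem_cat, mem_rev) => /orP[]->; rewrite !orbT.
move: yS; rewrite -qy inE (negbTE qS) orbF => /eqP qr.
by rewrite qr rX in qX.
Qed.

(** Follow [R] up to the first neighbour of [q] or, if there is none, to [s] and on along [Y] to
    [q]. Either way a hole through [q] arises that contains [a] and avoids [p], and [p] would see
    both [q] and [a]. *)
Lemma k4_first q p X Y R r1 rl r s R1 a R2 : k4 q p X Y R r1 rl r s ->
  R = R1 ++ a :: R2 -> p -- a -> ~~ has (sedge q) (R1 ++ [:: a]) -> False.
Proof.
move=> K ER pa nq.
have := k4rX K => /path.splitPr rX; case EX : X / rX => [X1 X2].
have := k4sY K => /path.splitPr sY; case EY : Y / sY => [Y1 Y2].
have RX2 b c : b \in R -> c \in r :: X2 -> c != b /\ (c -- b -> c = r /\ b = r1).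
  move=> bR cX; have := k4RX K bR (_ : c \in X); rewrite EX mem_cat cX orbT => /(_ isT)[bc h].
  by rewrite eq_sym; split=> //; rewrite sedgeC => /h[].
have qR : q \notin R by apply/negP => /(k4Rpq K)[_ /eqP].
have pR : p \notin R by apply/negP => /(k4Rpq K)[/eqP].
have [hq|hq] := boolP (has (sedge q) R2).
  have [Ra [b [Rb [ER2 qb nRa]]]] := first_split hq.
  pose S := R1 ++ a :: rcons Ra b.
  have ES : R = S ++ Rb by rewrite ER ER2 /S -catA /= cat_rcons.
  have subS : {subset S <= R} by move=> c cS; rewrite ES mem_cat cS.
  have hdS : head q S = r1 by rewrite -(k4h K q) ES; rewrite /S; case: (R1).
  have lS : last q S = b by rewrite /S last_cat /= last_rcons.
  suff: ~~ (p -- a) by rewrite pa.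
apply: (k4_noS K EX (S := S)) => //.
  - by have := k4R K; rewrite ES => /ipath_cat[].
  - by rewrite /S; case: (R1).
  - by apply: contra qR; exact: subS.
  - by rewrite lS.
  - move=> c; rewrite lS /S -cat_rcons mem_cat => /orP[cS qc|].
      by case/hasP: nq; exists c => //; rewrite cats1.
    rewrite mem_rcons inE => /orP[/eqP//|cR qc]; by case/hasP: nRa; exists c.
  - by move=> c d cX dS; rewrite hdS; apply: RX2 => //; exact: subS.
  - by apply: contra pR; exact: subS.
  by rewrite inE /S mem_cat mem_head !orbT.
have nR : ~~ has (sedge q) R.
  by rewrite ER -cat_rcons has_cat negb_or -cats1 nq.
have [[pY qY _ _] [pY' _ _ qlY] _ qoY] := ihole_edgeP (k4B K).
rewrite EY in pY'; have [_ psY2] := ipath_cat pY'.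
have subY : {subset s :: Y2 <= Y} by move=> c cY; rewrite EY mem_cat cY orbT.
have subX : {subset r :: X2 <= X} by move=> c cX; rewrite EX mem_cat cX orbT.
pose S := R ++ s :: Y2.
have hdS : head q S = r1 by rewrite -(k4h K q) /S; case: (R) (k4R0 K).
have lS : last q S = last q Y by rewrite /S EY !last_cat.
suff: ~~ (p -- a) by rewrite pa.
apply: (k4_noS K EX (S := S)) => //.
- apply: (@ipath_catE _ q) => //; [exact: k4R K | exact: k4R0 K | by rewrite (k4l K); exact: k4s K |].
  move=> c d cR /subY dY; have [cd h] := k4RY K cR dY; split=> // /h; by rewrite (k4l K).
- by rewrite /S; case: (R).
- by rewrite mem_cat negb_or qR; apply: contra qY; exact: subY.
- by rewrite lS.
- move=> c; rewrite lS mem_cat => /orP[cR qc|/subY]; last exact: qoY.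
  by case/hasP: nR; exists c.
- move=> c d cX; rewrite mem_cat hdS => /orP[dR|/subY dY]; first exact: RX2.
  have [cd /negP ncd] := k4XY K (subX _ cX) dY; by split.
- by rewrite mem_cat negb_or pR; apply: contra pY; exact: subY.
by rewrite inE mem_cat ER mem_cat mem_head !orbT.
Qed.

(** The first vertex of [R] seen by [p] or [q] is not seen by both, as there are no triangles;
    [k4_first] applies to it, possibly with [p] and [q] exchanged. *)
Lemma k4_noR q p X Y R r1 rl r s : k4 q p X Y R r1 rl r s ->
  {in R, forall a, ~~ (p -- a) /\ ~~ (q -- a)}.
Proof.
move=> K; pose P a := (p -- a) || (q -- a).
have [/first_split[R1 [a [R2 [ER Pa nR]]]]|nR a aR] := boolP (has P R); last first.
  by apply/andP; rewrite -negb_or; apply: contra nR => h; apply/hasP; exists a.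
have [_ _ pq] : [/\ True, True & p -- q] by have [[]] := ihole_edgeP (k4A K).
have nRp : ~~ has (sedge p) R1 /\ ~~ has (sedge q) R1.
  split; apply: contra nR => /hasP[c cR h]; apply/hasP; exists c => //; by rewrite /P h ?orbT.
case/orP: Pa => h; exfalso.
  apply: (k4_first K ER h); rewrite has_cat /= orbF negb_or nRp.2 /=.
  by apply/negP => qa; apply: (cG.1 p q a).
apply: (k4_first (k4_sym K) ER h); rewrite has_cat /= orbF negb_or nRp.1 /=.
by apply/negP => qa; apply: (cG.1 q p a) => //; rewrite sedgeC.
Qed.

(* The cycle avoiding [p]. *)
Lemma k4_hole_q q p X1 X2 Y1 Y2 R r1 rl r s :
  k4 q p (X1 ++ r :: X2) (Y1 ++ s :: Y2) R r1 rl r s ->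
  ihole q (rev (r :: X2) ++ R ++ s :: Y2) /\ ~~ (p -- r) /\ ~~ (p -- s).
Proof.
move=> K; have nR := k4_noR K.
have [[pY qY _ _] [pY' _ _ qlY] _ qoY] := ihole_edgeP (k4B K).
have [[_ _ pq _] _ _ _] := ihole_edgeP (k4A K).
have [_ psY2] := ipath_cat pY'.
have subY : {subset s :: Y2 <= Y1 ++ s :: Y2} by move=> c cY; rewrite mem_cat cY orbT.
have subX : {subset r :: X2 <= X1 ++ r :: X2} by move=> c cX; rewrite mem_cat cX orbT.
have qR : q \notin R by apply/negP => /(k4Rpq K)[_ /eqP].
have pR : p \notin R by apply/negP => /(k4Rpq K)[/eqP].
pose S := R ++ s :: Y2.
have hdS : head q S = r1 by rewrite -(k4h K q) /S; case: (R) (k4R0 K).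
have lS : last q S = last q (Y1 ++ s :: Y2) by rewrite /S !last_cat.
have c1 : ipath S.
  apply: (@ipath_catE _ q) => //; [exact: k4R K | exact: k4R0 K | by rewrite (k4l K); exact: k4s K |].
  move=> c d cR /subY dY; have [cd h] := k4RY K cR dY; split=> // /h; by rewrite (k4l K).
have c2 : S != [::] by rewrite /S; case: (R).
have c3 : q \notin S by rewrite mem_cat negb_or qR; apply: contra qY; exact: subY.
have c4 : q -- last q S by rewrite lS.
have c5 : {in S, forall a, q -- a -> a = last q S}.
  move=> c; rewrite lS mem_cat => /orP[cR|/subY]; last exact: qoY.
  by rewrite (negbTE (nR _ cR).2).
have c6 : {in r :: X2 & S, forall b a, b != a /\ (b -- a -> b = r /\ a = head q S)}.
  move=> c d /subX cX; rewrite mem_cat hdS => /orP[dR|/subY dY].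
    have [cd h] := k4RX K dR cX; rewrite eq_sym; split=> //; by rewrite sedgeC => /h[].
  have [cd /negP ncd] := k4XY K cX dY; by split.
have c7 : p \notin S by rewrite mem_cat negb_or pR; apply: contra pY; exact: subY.
have n := k4_noS K erefl c1 c2 c3 c4 hdS c5 c6 c7.
split; first by apply: k4hole (k4A K) _ _ _ _ _ _ _ => //; rewrite hdS (k4r K).
by split; apply: n; rewrite !inE ?eqxx // mem_cat mem_head !orbT.
Qed.

(** The cycle through all four branch vertices: from [q] backwards along [X] to [r], through [R] to
    [s], backwards along [Y] to [p], and along the edge to [q]. *)
Lemma k4_hole4 q p X1 X2 Y1 Y2 R r1 rl r s :
  k4 q p (X1 ++ r :: X2) (Y1 ++ s :: Y2) R r1 rl r s ->
  ihole q (rev (r :: X2) ++ R ++ rev (p :: rcons Y1 s)).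
Proof.
move=> K; have nR := k4_noR K.
have [_ [npr nps]] := k4_hole_q K.
have K' := k4_sym K; rewrite !rev_cat !rev_cons !cat_rcons in K'.
have [_ [nqr nqs]] := k4_hole_q K'.
have [[pX qX pq pqe] _ pXo _] := ihole_edgeP (k4A K).
have [[pY qY _ _] [pY' Y0 ph qlY] po qoY] := ihole_edgeP (k4B K).
have pp : ipath (p :: rcons Y1 s).
  have [[h _ _ _ _] _] := iholeP (k4B K).
  by have := h; rewrite -cat_rcons -cat_cons => /ipath_cat[].
have subY : {subset rcons Y1 s <= Y1 ++ s :: Y2}.
  by move=> c; rewrite -cat_rcons mem_cat => ->.
have subX : {subset r :: X2 <= X1 ++ r :: X2} by move=> c cX; rewrite mem_cat cX orbT.
have qR : q \notin R by apply/negP => /(k4Rpq K)[_ /eqP].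
have pR : p \notin R by apply/negP => /(k4Rpq K)[/eqP].
pose S := R ++ rev (p :: rcons Y1 s).
have hdS : head q S = r1 by rewrite -(k4h K q) /S; case: (R) (k4R0 K).
have lS : last q S = p by rewrite /S rev_cons last_cat last_rcons.
have hY : head q (rev (p :: rcons Y1 s)) = s by rewrite rev_cons rev_rcons.
apply: k4hole (k4A K) _ _ _ _ _ _ _; rewrite -/S.
- apply: (@ipath_catE _ q); [exact: k4R K| exact: ipath_rev | exact: k4R0 K | | |].
  + by rewrite rev_cons; case: (rev _).
  + by rewrite (k4l K) hY (k4s K).
  move=> a b aR; rewrite hY mem_rev inE => /orP[/eqP ->|/subY bY].
    split; first by have [] := k4Rpq K aR.
    by rewrite sedgeC (negbTE (nR _ aR).1).
  have [ab h] := k4RY K aR bY; split=> // /h; by rewrite (k4l K).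
- by rewrite /S; case: (R) (k4R0 K).
- rewrite mem_cat negb_or qR mem_rev inE negb_or eq_sym pq /=.
  by apply: contra qY; exact: subY.
- by rewrite lS sedgeC.
- by rewrite hdS (k4r K).
- move=> a; rewrite lS mem_cat mem_rev inE => /or3P[aR|/eqP //|aY].
    by rewrite (negbTE (nR _ aR).2).
  move=> qa; have E := qoY _ (subY _ aY) qa.
  move: pY' (aY) nqs => /ipath_uniq; rewrite mem_rcons inE => U /orP[/eqP<-|aY1]; first by rewrite qa.
  have aY2 : a \in s :: Y2 by rewrite E last_cat /= mem_last.
  move: U; rewrite cat_uniq => /and3P[_ /hasPn/(_ _ aY2)]; by rewrite aY1.
move=> a b aX; rewrite hdS mem_cat mem_rev inE => /or3P[bR|/eqP->|/subY bY].
- have [cd h] := k4RX K bR (subX _ aX); rewrite eq_sym; split=> //; by rewrite sedgeC => /h[].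
- split; first by apply: contraNneq pX => <-; exact: subX.
  rewrite sedgeC => pa; have E := pXo _ (subX _ aX) pa.
  have [[_ _ _ _] [/ipath_uniq U _ _ _] _ _] := ihole_edgeP (k4A K).
  move: aX; rewrite inE => /orP[/eqP ar|aX2]; first by rewrite ar (negbTE npr) in pa.
  move: U E; case: (X1) => [/=|d X1'] /=.
    by move=> _ ar; rewrite ar (negbTE npr) in pa.
  case/andP => dX _ ad; rewrite ad in aX2; by rewrite mem_cat inE aX2 !orbT in dX.
have [ab /negP nab] := k4XY K (subX _ aX) bY; by split.
Qed.

(** Two of the cycles suffice: the one avoiding [q] covers [X] up to [r], the one through all branch
    vertices covers [X] from [r] on. Both contain the part of [Y] between [p] and [s], hence the
    vertex next to [p], because [p] does not see [s]. *)
Lemma K4 F q p X Y x : ihole q (p :: X) -> ihole q (p :: Y) ->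
  {in X & Y, forall a b, a != b /\ ~~ (a -- b)} ->
  {subset q :: p :: X ++ Y <= F} -> conn (F :\: [set p; q]) -> x \in X ->
  exists z t, [/\ ihole z t, {subset z :: t <= F} & 
    [/\ x \in z :: t, p \in z :: t & head q Y \in z :: t]].
Proof.
move=> A B XY sF cF xX.
have [[pX qX pq pqe] [_ X0 _ _] _ _] := ihole_edgeP A.
have [[pY qY _ _] [_ Y0 _ _] _ _] := ihole_edgeP B.
have XF a : a \in X -> a \in F :\: [set p; q].
  move=> aX; rewrite !inE negb_or sF ?inE ?mem_cat ?aX ?orbT // andbT.
  by apply/andP; split; [apply: contraNneq pX | apply: contraNneq qX] => <-.
have YF a : a \in Y -> a \in F :\: [set p; q].
  move=> aX; rewrite !inE negb_or sF ?inE ?mem_cat ?aX ?orbT // andbT.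
  by apply/andP; split; [apply: contraNneq pY | apply: contraNneq qY] => <-.
have hYY : head q Y \in Y by case: (Y) Y0 => //= a t _; rewrite mem_head.
have [z [P [iP PF zX lY [nX nY]]]] :
  exists z P, [/\ ipath (z :: P), {subset z :: P <= F :\: [set p; q]}, z \in [set a in X],
     last z P \in [set a in Y] & {in P, forall w, w \notin [set a in X]} /\
     {in belast z P, forall w, w \notin [set a in Y]}].
  apply: (@min_link _ _ _ _ x (head q Y)); rewrite ?inE //.
    by move/XF: xX; rewrite !inE.
  by apply: (connP _ cF); [exact: XF | exact: YF].
rewrite !inE in zX lY.
pose Z := (F :\: [set p; q]) :\: ([set a in X] :|: [set a in Y]).
case/lastP: P iP PF lY nX nY => [|P y] iP PF; first by move=> /(XY _ _ zX)[] /eqP.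
rewrite last_rcons belast_rcons => yY nX nY.
have P0 : P != [::].
  case: (P) iP => //= /and3P[_ /andP[zy _] _]; by have [_] := XY _ _ zX yY; rewrite zy.
have PZ a : a \in P -> a \in Z.
  move=> aP; have := PF a; rewrite !inE mem_rcons inE aP !orbT => /(_ isT) ->.
  rewrite andbT negb_or; have := nX a; rewrite !inE mem_rcons inE aP orbT => /(_ isT) ->.
  by have := nY a; rewrite !inE aP orbT => /(_ isT).
(* The connecting path is shortened once more, now between the neighbourhoods of [X] and [Y], so
   that only its first vertex sees [X] and only its last sees [Y]. *)
have [r1' [R' [iR RZ r1X rlY [nRX nRY]]]] :
  exists z P, [/\ ipath (z :: P), {subset z :: P <= Z}, z \in NB [set a in X],
     last z P \in NB [set a in Y] & {in P, forall w, w \notin NB [set a in X]} /\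
     {in belast z P, forall w, w \notin NB [set a in Y]}].
  have [ip _] : ipath (z :: P) /\ ipath [:: y] by apply: ipath_cat; rewrite cats1.
  have zP : z -- head z P by case: (P) ip P0 => //= a t /and3P[_ /andP[]].
  have Py : last z P -- y.
    have := ipath_sorted iP; by rewrite /= rcons_path => /andP[].
  have hP : head z P \in P by case: (P) P0 => //= a t _; rewrite mem_head.
  have lP : last z P \in P by case: (P) P0 => //= a t _; rewrite mem_last.
  apply: (@min_link _ _ _ _ (head z P) (last z P)).
  - apply/NBP; split; last by exists z; rewrite ?inE.
    by have := PZ _ hP; rewrite !inE negb_or => /andP[/andP[]].
  - apply/NBP; split; last by exists y; rewrite ?inE // sedgeC.
    by have := PZ _ lP; rewrite !inE negb_or => /andP[/andP[]].
  - exact: PZ.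
  apply/connectP; exists (behead P); last by case: (P) P0.
  have [_ /ipath_sorted] : True /\ ipath P by split=> //; have /=/and3P[_ _ ] := ip.
  case: (P) PZ P0 => //= a t PZ _.
  have aZ : a \in Z by apply: PZ; rewrite mem_head.
  have tZ : {subset t <= Z} by move=> w wt; apply: PZ; rewrite inE wt orbT.
  elim: (t) (a) aZ tZ => //= b u IH c cZ bZ /andP[cb pb].
  rewrite /rin /= cb cZ bZ ?mem_head //=; apply: IH => //; first by apply: bZ; rewrite mem_head.
  by move=> w wu; apply: bZ; rewrite inE wu orbT.
set R := r1' :: R' in iR RZ.
case/NBP: (r1X) => _ [r]; rewrite inE => rX; rewrite sedgeC => r1r.
case/NBP: (rlY) => _ [s]; rewrite inE => sY; rewrite sedgeC => rls.
set rl := last r1' R' in rlY rls.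
have Znot a : a \in Z -> [/\ a \notin q :: p :: X, a \notin q :: p :: Y & a \in F].
  by rewrite !inE !negb_or => /andP[/andP[-> ->] /andP[/andP[-> ->] ->]].
have rlR : rl \in R by exact: mem_last.
have K : k4 q p X Y R r1' rl r s.
  split=> //.
  - move=> a b aR bX; have [aX _ _] := Znot _ (RZ _ aR); split.
      by apply: contraNneq aX => ->; rewrite !inE bX !orbT.
    move=> ab; have ar : a = r1'.
      apply/eqP; move: (aR); rewrite inE => /orP[//|aR']; case/negP: (nRX _ aR').
      apply/NBP; split; first by move: aX; rewrite !inE !negb_or => /and3P[].
      by exists b; rewrite ?inE // sedgeC.
    split=> //; rewrite ar in aX ab *; apply: (cG.2 _ _ _ _ _ A aX) ab r1r => //.
      by rewrite !inE bX !orbT.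
    by rewrite !inE rX !orbT.
  - move=> a b aR bX; have [_ aX _] := Znot _ (RZ _ aR); split.
      by apply: contraNneq aX => ->; rewrite !inE bX !orbT.
    move=> ab; have ar : a = rl.
      apply/eqP; move: (aR); rewrite /R lastI mem_rcons inE => /orP[//|aR'].
      case/negP: (nRY _ aR').
      apply/NBP; split; first by move: aX; rewrite !inE !negb_or => /and3P[].
      by exists b; rewrite ?inE // sedgeC.
    split=> //; rewrite ar in aX ab *; apply: (cG.2 _ _ _ _ _ B aX) ab rls => //.
      by rewrite !inE bX !orbT.
    by rewrite !inE sY !orbT.
  move=> a /RZ /Znot[]; by rewrite !inE !negb_or => /and3P[-> ->].
have RF : {subset R <= F} by move=> a /RZ/Znot[].
clear - cG K sF xX RF; clearbody rl R.
have [X1 [X2 EX]] : exists X1 X2, X = X1 ++ r :: X2.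
  by have /path.splitPr[X1 X2] := k4rX K; exists X1, X2.
have [Y1 [Y2 EY]] : exists Y1 Y2, Y = Y1 ++ s :: Y2.
  by have /path.splitPr[Y1 Y2] := k4sY K; exists Y1, Y2.
subst X Y.
have [_ [npr nps]] := k4_hole_q K.
have [_ [_ _ phY _] _ _] := ihole_edgeP (k4B K).
have hY : head q (Y1 ++ s :: Y2) \in Y1.
  case: (Y1) phY => [|b u] /=; last by rewrite mem_head.
  by rewrite (negbTE nps).
have K' := k4_sym K; rewrite !rev_cat !rev_cons !cat_rcons in K'.
have sF' a : [|| a == q, a == p, a \in X1, a == r, a \in X2, a \in Y1, a == s | a \in Y2] -> a \in F.
  by move=> h; apply: sF; move: h; rewrite !(inE, mem_cat) !orbA.
move: xX; rewrite -cat_rcons mem_cat => /orP[xX|xX].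
  have [H _] := k4_hole_q K'.
  exists p, (rev (r :: rev X1) ++ R ++ s :: rev Y1); split=> //.
    move=> a; rewrite !(inE, mem_cat, mem_rev) => /orP[aE|/or3P[aX|/RF//|aY]]; apply: sF'.
    - by rewrite aE !orbT.
    - by case/orP: aX => ->; rewrite !orbT.
    by case/orP: aY => ->; rewrite !orbT.
  rewrite !(inE, mem_cat, mem_rev) hY eqxx !orbT; split=> //.
  by move: xX; rewrite mem_rcons inE => ->; rewrite !orbT.
have H := k4_hole4 K.
exists q, (rev (r :: X2) ++ R ++ rev (p :: rcons Y1 s)); split=> //.
  move=> a; rewrite !(inE, mem_cat, mem_rev, mem_rcons) => /orP[aE|/or3P[aX|/RF//|aY]]; apply: sF'.
  - by rewrite aE.
  - by case/orP: aX => ->; rewrite !orbT.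
  by case/or3P: aY => ->; rewrite !orbT.
rewrite !(inE, mem_cat, mem_rev, mem_rcons) hY xX eqxx !orbT; split=> //.
Qed.

End K4.

(** * Holes through two vertices that no clique separates *)

Section Star.
Variable G : sgraph.
Implicit Types (A B F K : {set G}) (x y z p q r s : G) (t X Y R S Q : seq G).
Hypothesis cG : clean G.

(** In a triangle-free graph every clique is of this form. The empty set is included, so that a
    solid set is connected. *)
Definition clq K := #|K| <= 2 /\ {in K &, forall a b, a != b -> a -- b}.

Definition solid F := forall K, K \subset F -> clq K -> conn (F :\: K).

Definition onhole F x v :=
  exists z t, [/\ ihole z t, {subset z :: t <= F}, x \in z :: t & v \in z :: t].

Lemma clq0 : clq set0.
Proof. by split=> [|a b]; rewrite ?cards0 ?inE. Qed.

Lemma clq1 c : clq [set c].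
Proof. by split=> [|a b]; rewrite ?cards1 // !inE => /eqP-> /eqP->; rewrite eqxx. Qed.

Lemma clq2 c d : c -- d -> clq [set c; d].
Proof.
move=> cd; split=> [|a b]; first by rewrite cards2; case: eqP.
by rewrite !inE => /orP[] /eqP-> /orP[] /eqP->; rewrite ?eqxx // sedgeC.
Qed.

Lemma solid_conn F : solid F -> conn F.
Proof. by move=> /(_ set0 (sub0set _) clq0); rewrite setD0. Qed.

(** The hole and [S] form a theta with ends [y] and [c]. This is the cycle through [T1] and [S]; the
    one through [T2] results from reversing the hole. *)
Lemma theta_hole y T1 c T2 S w : ihole y (T1 ++ c :: T2) -> ~~ (y -- c) ->
  ipath S -> S != [::] -> head y S -- y -> last y S = w -> w -- c ->
  {in S, forall d, d \notin y :: T1 ++ c :: T2 /\ (y -- d -> d = head y S)} ->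
  {in S & T1 ++ c :: T2, forall d a, d -- a -> d = w /\ a = c} ->
  ihole y (rcons T1 c ++ rev S).
Proof.
move=> /iholeP[[ip sz yT yh yl] yo] nyc iS S0 hS lS wc Sd cr.
have sub a : a \in rcons T1 c -> a \in T1 ++ c :: T2 by rewrite -cat_rcons mem_cat => ->.
have T10 : T1 != [::].
  by apply: contraNneq nyc => E; move: yh; rewrite E.
have hd : head y (rcons T1 c ++ rev S) = head y (T1 ++ c :: T2).
  by case: (T1) T10.
have lst : last y (rcons T1 c ++ rev S) = head y S.
  by rewrite last_cat; case: (S) S0 => //= a u _; rewrite rev_cons last_rcons.
have ST d : d \in S -> d \notin y :: T1 ++ c :: T2 by case/Sd.
apply: ihole_intro; rewrite ?hd ?lst //.
- move: ip; rewrite -cat_rcons => /ipath_cat[ip1 _].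
  apply: (@ipath_catE _ y) => //; first exact: ipath_rev.
  + by case: (T1).
  + by case: (S) S0 => //= a u; rewrite rev_cons; case: (rev u).
  + by rewrite last_rcons; case/lastP: (S) S0 lS => // u a _; rewrite last_rcons rev_rcons /= sedgeC => ->.
  move=> a d aT; rewrite mem_rev last_rcons => dS; split.
    by apply: contraNneq (ST _ dS) => <-; rewrite inE sub // orbT.
  rewrite sedgeC => /(cr _ _ dS (sub _ aT))[-> ->]; split=> //.
  by case/lastP: (S) S0 lS => // u e _; rewrite last_rcons rev_rcons /= => ->.
- rewrite size_cat size_rcons size_rev.
  by case: (T1) (S) T10 S0 => //= ? ? [|? ?] //=; slia.
- rewrite mem_cat negb_or mem_rev; apply/andP; split.
    by apply: contra yT; exact: sub.
  by apply/negP => /ST; rewrite mem_head.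
- by rewrite sedgeC.
move=> a; rewrite mem_cat mem_rev => /orP[aT|aS] ya; last by right; case: (Sd _ aS) => _; apply.
left; have [//|E] := yo _ (sub _ aT) ya.
have aE : a = last c T2 by rewrite E last_cat.
case: (T2) aE ip aT => [/=|e u] /=; first by move=> ac; rewrite ac (negbTE nyc) in ya.
move=> aE /ipath_uniq; rewrite -cat_rcons cat_uniq => /and3P[_ /hasPn h _] aT.
by have := h a; rewrite aE mem_last -aE aT => /(_ isT).
Qed.

(** Moves from a hole through [x] and [y] towards a neighbour [v] of [y]. The walk [Q] leads from
    [v] back to the hole at a place other than [y]. The part of a shortest such walk after the last
    neighbour [b] of [y] gives a hole through [x], [y] and [b]. If that hole misses [v], the walk
    from [v] reaches it earlier, and induction applies. *)
Lemma onhole_step F (sF : solid F) n Q z t x y v : size Q < n ->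
  ihole z t -> {subset z :: t <= F} -> x \in z :: t -> y \in z :: t ->
  v \in F -> path (rin F) v Q -> {in v :: Q, forall w, w \notin z :: t} -> v -- y ->
  (exists c, [/\ c \in z :: t, c != y & last v Q -- c]) -> onhole F x v.
Proof.
elim: n Q z t x y v => // n IH Q z t x y v sq H HF xH yH vF pq nH vy [c0 [c0H c0y lc0]].
pose Z := F :\: [set a in z :: t].
pose C := [set w | [exists c, [&& c \in z :: t, c != y & w -- c]]].
have ZH w : w \in Z -> w \in F /\ w \notin z :: t.
  by rewrite 2!inE inE => /andP[].
have vZ : v \in Z by rewrite 2!inE vF andbT inE nH // mem_head.
have pZ : path (rin Z) v Q.
  elim: (Q) (v) vZ pq nH => //= a u IHu b bZ /andP[/and3P[ba _ aF] pu] nH'.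
  have aZ : a \in Z by rewrite 2!inE aF andbT inE nH' // !inE eqxx orbT.
  rewrite /rin /= ba bZ aZ /=; apply: IHu => // w wu; apply: nH'.
  by rewrite inE wu orbT.
have [|v' [W [iW WZ]]] := min_walk (set11 v) _ vZ pZ (Y := C).
  by rewrite inE; apply/existsP; exists c0; rewrite c0H c0y.
move/set1P=> Ev; subst v' => lC [_ nC sW].
have {pq nH lc0 c0H c0y c0 pZ} sWn : size W < n.+1 by slia.
move: lC; rewrite inE => /existsP[c /and3P[cH cy wc]].
set w := last v W in wc.
have wW : w \in v :: W by exact: mem_last.
have nHW d : d \in v :: W -> d \notin z :: t by move=> /WZ/ZH[].
have FW d : d \in v :: W -> d \in F by move=> /WZ/ZH[].
have nwy : ~~ (y -- w).
  apply: contra cy => yw; apply/eqP; apply: (cG.2 _ _ _ _ _ H (nHW _ wW)) => //; by rewrite sedgeC.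
have inner d a : d \in v :: W -> a \in z :: t -> a != y -> d -- a -> d = w /\ a = c.
  move=> dW aH ay da; have dw : d = w.
    apply/eqP; move: (dW); rewrite lastI mem_rcons inE => /orP[//|dB].
    by case/negP: (nC _ dB); rewrite inE; apply/existsP; exists a; rewrite aH ay.
  split=> //; rewrite dw in da; exact: (cG.2 _ _ _ _ _ H (nHW _ wW)) da wc.
have [W1 [b [W2 [EW yb nW2]]]] : exists W1 b W2, [/\ v :: W = W1 ++ b :: W2, y -- b & ~~ has (sedge y) W2].
  by apply: last_split; rewrite /= sedgeC vy.
pose S := b :: W2.
have iS : ipath S by move: iW; rewrite EW => /ipath_cat[].
have SW : {subset S <= v :: W} by move=> d dS; rewrite EW mem_cat dS orbT.
have lS d : last d S = w by rewrite /w -[last v W]/(last v (v :: W)) EW last_cat.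
have W20 : W2 != [::].
  by apply: contraNneq nwy => E; rewrite -(lS b) /S E.
suff [z' [t' [H' HF' [xH' yH' bH']]]] : exists z' t', [/\ ihole z' t', {subset z' :: t' <= F} &
    [/\ x \in z' :: t', y \in z' :: t' & b \in z' :: t']].
  have [vH'|vH'] := boolP (v \in z' :: t'); first by exists z', t'.
  have bW : b \in W.
    have : b \in v :: W by rewrite SW // mem_head.
    by rewrite inE => /orP[/eqP E|//]; rewrite -E bH' in vH'.
  have : has (mem (z' :: t')) W by apply/hasP; exists b.
  case/first_split => p1 [k [p2 [Ep kH' np1]]].
  have pW : path (@sedge G) v W by exact: (ipath_sorted iW).
  have kW : k \in v :: W by rewrite Ep inE mem_cat mem_head !orbT.
  apply: (IH p1 z' t' x y v) => //.
  - by move: sWn; rewrite Ep size_cat /=; slia.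
  - move: pW; rewrite Ep cat_path => /andP[pp _].
    have : {subset v :: p1 <= F}.
      by move=> d dp; apply: FW; rewrite Ep -cat_cons mem_cat dp.
    elim: (p1) (v) pp => //= a u IHu d /andP[da pu] sub.
    rewrite /rin /= da (sub d) ?(sub a) ?inE ?eqxx ?orbT //=.
    by apply: IHu => // e eu; apply: sub; rewrite inE eu orbT.
  - move=> d; rewrite inE => /orP[/eqP->//|dp]; apply: contra np1 => dH.
    by apply/hasP; exists d.
  exists k; split=> //.
    by apply: contraTneq kW => ->; apply/negP => /nHW; rewrite yH.
  by move: pW; rewrite Ep cat_path /= => /and3P[_ ].
have Sy d : d \in S -> d \notin z :: t /\ (y -- d -> d = b).
  move=> dS; split; first exact/nHW/SW.
  move: dS; rewrite inE => /orP[/eqP//|dW yd]; by case/hasP: nW2; exists d.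
(* If [y] and [c] are adjacent, [S] closes a second hole through the edge [yc] and [K4] applies;
   otherwise the hole and [S] form a theta. *)
have [yc|nyc] := boolP (y -- c).
  have B : ihole c (y :: S).
    apply: ihole_intro => /=.
    - rewrite yb /=; apply/and3P; split=> //; last first.
        by have := nW2; rewrite -all_predC.
      by apply/negP => /Sy[]; rewrite yH.
    - by rewrite /S /=; case: (W2) W20.
    - by rewrite inE negb_or cy; apply/negP => /Sy[]; rewrite cH.
    - by rewrite sedgeC.
    - by rewrite (lS b : last b W2 = w) sedgeC.
    move=> d; rewrite inE => /orP[/eqP ->|dS]; first by left.
    by rewrite sedgeC => /(inner _ _ (SW _ dS) cH cy)[-> _]; right; rewrite (lS b : last b W2 = w).
  have BF : {subset c :: y :: S <= F}.
    by move=> d; rewrite !inE => /or3P[/eqP->|/eqP->|/SW/FW//]; apply: HF.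
  have [t' H' E'] := ihole_edge H yH cH yc.
  have [[yX cX _ _] _ _ _] := ihole_edgeP H'.
  move: (xH); rewrite E' !inE => /or3P[/eqP xc|/eqP xy|xX].
  - exists c, (y :: S); split=> //; by rewrite xc !inE !eqxx ?orbT.
  - exists c, (y :: S); split=> //; by rewrite xy !inE !eqxx ?orbT.
  apply: (K4 cG H' B _ _ _ xX (F := F)).
  - move=> a d aX dS; have aH : a \in z :: t by rewrite E' !inE aX !orbT.
    split; first by apply: contraNneq (nHW _ (SW _ dS)) => <-.
    rewrite sedgeC; apply/negP => da; have ay : a != y by apply: contraNneq yX => <-.
    by have [_ ac] := inner _ _ (SW _ dS) aH ay da; rewrite -ac aX in cX.
  - move=> d; rewrite !(inE, mem_cat) => dd; case: (boolP (d \in S)) => [/SW/FW//|dS].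
    apply: HF; rewrite E' !inE; move: dd dS; rewrite !inE negb_or.
    by case/or4P=> [->|->|->|/orP[]->]; rewrite ?orbT ?andbF.
  by apply: sF; [apply/subsetP => d; rewrite !inE => /orP[]/eqP->; apply: HF | exact: clq2].
have [t' H' E'] := ihole_at H yH.
have ct : c \in t' by move: cH; rewrite E' inE (negbTE cy).
have Hth T1 T2 : ihole y (T1 ++ c :: T2) -> T1 ++ c :: T2 =i t' -> x \in y :: rcons T1 c ->
   exists z' t', [/\ ihole z' t', {subset z' :: t' <= F} &
    [/\ x \in z' :: t', y \in z' :: t' & b \in z' :: t']].
  move=> HT ET xT; exists y, (rcons T1 c ++ rev S).
  have yT : y \notin T1 ++ c :: T2 by case/iholeP: HT => -[].
  split; first apply: (theta_hole HT nyc iS _ _ (lS y) wc) => //=.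
  - by rewrite sedgeC.
  - move=> d dS; rewrite inE ET -in_cons -E'; exact: Sy.
  - move=> d a dS aT; apply: inner; [exact: SW | | ].
      by rewrite E' inE -ET aT orbT.
    by apply: contraNneq yT => <-.
  - move=> d; rewrite inE mem_cat mem_rev => /or3P[/eqP->|dT|/SW/FW//]; apply: HF => //.
    by rewrite E' inE -ET -cat_rcons mem_cat dT orbT.
  rewrite !(inE, mem_cat, mem_rev) !eqxx !orbT; split=> //.
  by move: xT; rewrite inE => /orP[]->; rewrite ?orbT.
have /path.splitPr Ect := ct; case: t' / Ect H' E' ct Hth => T1 T2 H' E' ct Hth.
move: (xH); rewrite E' -cat_rcons -cat_cons mem_cat => /orP[xT|xT].
  by apply: (Hth T1 T2).
apply: (Hth (rev T2) (rev T1)).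
- by have := ihole_rev H'; rewrite rev_cat rev_cons cat_rcons.
- by move=> d; rewrite !(mem_cat, inE, mem_rev) orbCA orbA orbC [(d == c) || _]orbC orbA.
by rewrite inE mem_rcons inE mem_rev xT !orbT.
Qed.

Lemma conn_nbr A x y : conn A -> x \in A -> y \in A -> x != y ->
  exists2 a, a \in A & x -- a.
Proof.
move=> cA xA yA xy; have [|u [v [uA vA /set1P-> _ xv]]] := conn_exit cA xA yA (set11 x).
  by rewrite inE eq_sym.
by exists v.
Qed.

(** No neighbour of [x] separates it from [v], so [x] has two neighbours. They are joined by a path
    avoiding [x], and an induced one that stops at the first return to the neighbourhood of [x]
    closes a hole. *)
Lemma solid_hole F x v : solid F -> x \in F -> v \in F -> x != v -> ~~ (x -- v) ->
  onhole F x x.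
Proof.
move=> sF xF vF xv nxv; have cF := solid_conn sF.
have [a aF xa] := conn_nbr cF xF vF xv.
have va : v != a by apply: contraNneq nxv => ->.
have xNa : x != a by exact: sedge_neq.
have c1 : conn (F :\: [set a]) by apply: sF; [rewrite sub1set | exact: clq1].
have [||b] := conn_nbr c1 _ _ xv; rewrite ?inE ?xNa ?va //.
move=> /andP[ba bF] xb.
have c2 : conn (F :\: [set x]) by apply: sF; [rewrite sub1set | exact: clq1].
have inF u : u \in F -> x -- u -> u \in F :\: [set x].
  by move=> uF xu; rewrite !inE uF eq_sym sedge_neq.
have [||||u [p [ip pF /set1P Eu lp [_ np]]]] :=
    @min_link _ (F :\: [set x]) [set a] [set w | (x -- w) && (w != a)] a b.
- by rewrite inE.
- by rewrite inE xb.
- exact: inF.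
- by apply: (connP _ c2); apply: inF.
subst u; move: lp; rewrite inE => /andP[xl la].
have p0 : p != [::] by apply: contraNneq la => ->.
exists x, (a :: p); rewrite !mem_head; split=> //.
  apply: ihole_intro => //.
  - case: p p0 ip xl {np la pF} => // c [|d p] // _ ip xc.
    have := ipath_sorted ip; rewrite /= andbT => ac.
    by exfalso; apply: (cG.1 x a c).
  - by apply/negP => /pF; rewrite !inE eqxx.
  move=> y yp' xy; have : y \in rcons (belast a p) (last a p) by rewrite -lastI.
  rewrite mem_rcons inE => /orP[/eqP|yp]; first by right.
  left; apply/eqP; have := np _ yp; rewrite inE xy /=; by rewrite negbK.
by move=> w; rewrite inE => /orP[/eqP->//|/pF]; rewrite inE => /andP[].
Qed.

(** The vertices sharing a hole with [x] are closed under adjacency in [F]: since [y] is no cut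
    vertex, a neighbour of [y] off the hole has a walk to the rest of the hole that avoids [y], as
    [onhole_step] requires. *)
Lemma solid_onhole F x v : solid F -> x \in F -> v \in F -> x != v -> ~~ (x -- v) ->
  onhole F x v.
Proof.
move=> sF xF vF xv nxv; have cF := solid_conn sF.
pose B := [set w in F | `[< onhole F x w >]].
suff : F \subset B by move/subsetP/(_ _ vF); rewrite inE => /andP[_ /asboolP].
have xB : x \in B by rewrite inE xF; apply/asboolP; apply: solid_hole xv nxv.
apply: (conn_closed cF xB xF) => y w yF wF; rewrite !inE => /andP[_ /asboolP[z [t [H HF xH yH]]]] yw.
rewrite wF /=; apply/asboolP; have [wH|wH] := boolP (w \in z :: t); first by exists z, t.
pose A := F :\: [set y]; have cA : conn A by apply: sF; [rewrite sub1set | exact: clq1].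
have wA : w \in A by rewrite !inE wF eq_sym sedge_neq.
pose X := [set c | (c \in z :: t) && (c != y)].
have [c cX] : exists c, c \in X.
  have [t' H' E'] := ihole_at H yH; have [[_ _ _ yh _] _] := iholeP H'.
  exists (head y t'); rewrite inE [_ == y]eq_sym sedge_neq // andbT E' inE.
  by case: (t') H' => //= a u _; rewrite mem_head orbT.
have cA' : c \in A by move: cX; rewrite !inE => /andP[/HF-> ->].
have [|d [q [iq qA /set1P Ed lq [_ nq]]]] := @min_link _ A [set w] X w c (set11 _) cX wA.
  exact: (connP _ cA).
subst d; case/lastP: q iq qA lq nq => [|q e] iq qA /=.
  by rewrite inE (negbTE wH).
rewrite last_rcons inE => /andP[eH ey]; rewrite belast_rcons => nq.
have pq := ipath_sorted iq; rewrite /= rcons_path in pq; case/andP: pq => pq le.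
apply: (onhole_step sF (ltnSn _) H HF xH yH wF (Q := q)).
- have sub : {subset w :: q <= F}.
    move=> u uq; have : u \in A by apply: qA; rewrite -rcons_cons mem_rcons inE uq orbT.
    by rewrite !inE => /andP[].
  elim: (q) (w) sub pq => //= a u IHu b sub /andP[ba pu].
  rewrite /rin /= ba !sub ?inE ?eqxx ?orbT //=; apply: IHu => // f fu.
  by apply: sub; rewrite inE fu orbT.
- move=> u uq; have := nq _ uq; rewrite inE negb_and => /orP[//|]; rewrite negbK => /eqP uy.
  have : u \in A by apply: qA; rewrite -rcons_cons mem_rcons inE uq orbT.
  by rewrite !inE uy eqxx.
- by rewrite sedgeC.
by exists e.
Qed.

(* Passing to a smallest set in which no clique separates [x] from [v] makes it solid. *)
Lemma star F x v : x \in F -> v \in F -> x != v -> ~~ (x -- v) ->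
  (forall K, K \subset F -> clq K -> x \notin K -> v \notin K -> v \in comp (F :\: K) x) ->
  onhole F x v.
Proof.
have [n] := ubnP #|F|; elim: n F => // n IH F sn xF vF xv nxv sep.
have [sF|] := pselect (solid F); first exact: solid_onhole.
move/existsNP => [K] /not_implyP[KF] /not_implyP[cK /negP nconn].
have disjK : x \notin K \/ v \notin K.
  have [xK|] := boolP (x \in K); last by left.
  by right; apply/negP => vK; rewrite (cK.2 x v) in nxv.
(* [K] is a clique, so it does not contain both [x] and [v]. The component of one outside [K],
   together with [K], contains both, and it is smaller than [F] because [F :\: K] is not
   connected. *)
pose y0 := if x \in K then v else x.
have y0F : y0 \in F :\: K.
  rewrite /y0; case: ifP => xK; rewrite !inE ?xK ?xF //; case: disjK => [|->]; first by rewrite xK.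
  by rewrite vF.
pose C := comp (F :\: K) y0; pose F' := K :|: C.
have CF : C \subset F :\: K by exact: comp_sub.
have F'F : F' \subset F.
  by rewrite subUset KF; apply: subset_trans CF (subsetDl _ _).
have xF' : x \in F'.
  rewrite inE; case: (boolP (x \in K)) => //= xK.
  by rewrite /C /y0 (negbTE xK) comp_refl.
have vF' : v \in F'.
  rewrite inE; case: (boolP (v \in K)) => //= vK; rewrite /C /y0.
  by case: ifP => xK; [exact: comp_refl | apply: sep => //; rewrite xK].
have lt : #|F'| < #|F|.
  rewrite proper_card // properE F'F; apply/negP => FF'; case/negP: nconn.
  suff -> : F :\: K = C by apply: conn_comp.
  apply/eqP; rewrite eqEsubset CF andbT; apply/subsetP => u; rewrite !inE => /andP[uK uF].
  by have := subsetP FF' _ uF; rewrite inE (negbTE uK) inE.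
have [|z [t [H HF' h1 h2]]] := IH F' (leq_trans lt sn) xF' vF' xv nxv; last first.
  by exists z, t; split=> // u /HF'; apply: (subsetP F'F).
move=> L LF' cL xL vL; set D := comp (F' :\: L) x.
have xFL : x \in F' :\: L by rewrite inE xL.
have con : connect (rin (F :\: L)) x v.
  by have := sep L (subset_trans LF' F'F) cL xL vL; rewrite inE.
(* A walk avoiding [L] leaves [F'] and comes back to it only through [K]; as [K] is a clique, the
   excursion can be short-cut inside [F']. *)
pose B := D :|: [set w in F :\: F' | ~~ [disjoint D & K]].
have inB a : (a \in B) = (a \in D) || [&& a \notin F', a \in F & ~~ [disjoint D & K]].
  by rewrite in_setU; congr (_ || _); rewrite inE in_setD andbA.
suff : v \in B by rewrite inB vF' /= orbF.
have Dcl a b : a \in D -> b \in F' -> b \notin L -> a -- b -> b \in D.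
  by move=> aD bF' bL; apply: comp_closed => //; rewrite inE bL.
have DF' a : a \in D -> a \in F'.
  by move/(subsetP (comp_sub xFL)); rewrite inE => /andP[].
have outC a b : a \in C -> b \in F -> a -- b -> b \in F'.
  move=> aC bF ab; rewrite inE; case: (boolP (b \in K)) => //= bK.
  by apply: comp_closed ab => //; rewrite inE bK.
apply: connect_closed con _ _; first by rewrite inB comp_refl.
move=> a b; rewrite !in_setD !inB => /andP[aL aF] /andP[bL bF] /orP[aD|/and3P[aF' _ nd]] ab.
  have [bF'|bF'] := boolP (b \in F'); first by rewrite (Dcl a b).
  rewrite /= bF; apply/orP; right.
  have := DF' _ aD; rewrite inE => /orP[aK|aC].
    by apply/negP => /pred0P/(_ a); rewrite /= aD aK.
  by rewrite (outC a b) in bF'.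
have [bF'|bF'] := boolP (b \in F'); last by rewrite bF nd /= orbT.
have bK : b \in K.
  move: bF'; rewrite inE => /orP[//|bC]; case/negP: aF'.
  by apply: outC bC aF _; rewrite sedgeC.
have /pred0Pn[k /andP[/= kD kK]] := nd.
apply/orP; left; have [<-//|kb] := eqVneq k b.
by apply: Dcl kD bF' bL _; apply: cK.2.
Qed.

End Star.

(** * Brambles and minimal graphs carrying them *)

Section Bramble.
Variable G : sgraph.
Implicit Types (A B F K U V X b : {set G}) (x y z p q u v : G) (P : {set {set G}}) (s : seq G).

Definition bramble P N := [/\ {in P, forall b, conn b}, {in P &, forall b b', touch b b'}
  & forall Y : {set G}, #|Y| < N -> exists2 b, b \in P & [disjoint b & Y]].

Definition bramble_in U N := exists2 P, bramble P N & {in P, forall b, b \subset U}.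

(** What remains of a bramble member when all that lies beyond the separator [K] is replaced by a
    set [V] hanging on [u]. *)
Definition red X K V u b := (b :&: (X :|: K)) :|: (if u \in b then V else set0).

Lemma disjointNP A B : reflect (exists2 x, x \in A & x \in B) (~~ [disjoint A & B]).
Proof.
apply: (iffP pred0Pn) => [[x /andP[/= ? ?]]|[x ? ?]]; first by exists x.
by exists x; apply/andP.
Qed.

Lemma disjP A B x : [disjoint A & B] -> x \in A -> x \in B -> False.
Proof. move=> h xA xB; have : ~~ [disjoint A & B] by apply/disjointNP; exists x.
by rewrite h. Qed.

Lemma touch_neq0 b b' : touch b b' -> exists x, x \in b.
Proof. by case/touchP => x [y [? _ _]]; exists x. Qed.

Section Red.
Variables (P : {set {set G}}) (N : nat) (X K V : {set G}) (u : G).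
Hypothesis brP : bramble P N.
Hypothesis uK : u \in K.
Hypothesis XK : forall x y, x \in X -> y \notin X -> x -- y -> y \in K.
Hypothesis PX : {in P, forall b, [disjoint b & K] -> b \subset X}.
Hypothesis VXK : [disjoint V & X :|: K].
Hypothesis cV : conn (u |: V).
Hypothesis KV : forall k, k \in K -> k != u -> exists2 y, y \in u |: V & k -- y.
Hypothesis clK : {in K &, forall k k', k != u -> k' != u -> k != k' -> k -- k'}.

Let inred b y : (y \in red X K V u b) = (y \in b) && (y \in X :|: K) || (u \in b) && (y \in V).
Proof. by rewrite /red in_setU in_setI; case: (u \in b); rewrite ?in_set0. Qed.

(** A connected member can leave [X] only through [K], so every piece of its trace on [X :|: K]
    reaches [K]. *)
Let red_reach b B x : b \in P -> ~~ [disjoint b & K] -> x \in B -> x \in b -> x \in X :|: K ->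
  (forall y z, y \in B -> z \in b -> z \in X :|: K -> y -- z -> z \in B) -> 
  {in B, forall y, y \in X :|: K} -> exists2 k, k \in B & k \in K.
Proof.
move=> bP /disjointNP[k kb kK] xB xb xXK cl BXK.
have [kB|kB] := boolP (k \in B); first by exists k.
have [cb _ _] := brP.
have [w [v [wb vb wB vB wv]]] := conn_exit (cb _ bP) xb kb xB kB.
exists w => //; move: (BXK _ wB); rewrite inE => /orP[wX|//].
have vXK : v \notin X :|: K by apply: contra vB => vXK; apply: (cl _ _ wB vb vXK wv).
move: vXK; rewrite inE negb_or => /andP[vX vK].
by case/negP: vK; apply: XK wX vX wv.
Qed.

(** The pieces of the trace all reach [K]. If [u] is in [b], they are joined by [u |: V], which sees
    all of [K]; if not, the part of [K] in [b] is a clique. *)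
Lemma red_conn b : b \in P -> conn (red X K V u b).
Proof.
move=> bP; have [cb _ _] := brP.
have [dK|mK] := boolP [disjoint b & K].
  suff -> : red X K V u b = b by exact: cb.
  have ub : u \notin b by apply: contraL dK => ub; apply/disjointNP; exists u.
  apply/setP => y; rewrite inred (negbTE ub) orbF; case yb : (y \in b) => //=.
  by rewrite inE (subsetP (PX bP dK)).
apply: connI => B x y BA xB yA cl; apply: contraT => yB.
have BA' a : a \in B -> a \in red X K V u b by apply: (subsetP BA).
have key : (u \in b -> u \in B) -> (exists2 k, k \in B & (k \in b) && (k \in K)) -> 
     {in b :&: K, forall k, k \in B}.
  move=> uB [k0 k0B /andP[k0b k0K]] k /setIP[kb kK].
  have kA : k \in red X K V u b by rewrite inred kb inE kK orbT.
  have [ub|ub] := boolP (u \in b); last first.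
    have [<-//|kk0] := eqVneq k0 k; apply: (cl _ _ k0B kA); apply: clK => //.
      by apply: contraNneq ub => <-.
    by apply: contraNneq ub => <-.
  have [->|ku] := eqVneq k u; first exact: uB.
  have [w wV kw] := KV kK ku; apply: (cl w) => //; last by rewrite sedgeC.
  have sub : u |: V \subset B.
    apply: (conn_closed cV (uB ub)); first by rewrite !inE eqxx.
    move=> c d _ dV cB; apply: (cl _ _ cB); rewrite inred.
    by move: dV; rewrite !inE => /orP[/eqP->|->]; rewrite ?ub ?uK ?orbT.
  exact: (subsetP sub).
have uB : u \in b -> u \in B.
  move=> ub.
  have subB a : a \in u |: V -> a \in B -> u \in B.
    move=> aV aB; have : u |: V \subset B.
      apply: (conn_closed cV aB aV) => c d _ dV cB; apply: (cl _ _ cB); rewrite inred.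
      by move: dV; rewrite !inE => /orP[/eqP->|->]; rewrite ?ub ?uK ?orbT.
    by move/subsetP; apply; rewrite !inE eqxx.
  have [xV|xV] := boolP (x \in V); first by apply: (subB x); rewrite // !inE xV orbT.
  have /andP[xb xXK] : (x \in b) && (x \in X :|: K).
    by have := BA' _ xB; rewrite inred (negbTE xV) andbF orbF.
  have [|||k kB kK] := @red_reach b (B :&: (X :|: K)) x bP mK _ xb xXK.
  - by rewrite inE xB.
  - move=> c d /setIP[cB _] db dXK cd; rewrite inE dXK andbT; apply: (cl _ _ cB _ cd).
    by rewrite inred db dXK.
  - by move=> c /setIP[].
  case/setIP: kB => kB _.
  have [ku|ku] := eqVneq k u; first by rewrite -ku.
  have [w wV kw] := KV kK ku; apply: (subB w) => //; apply: (cl _ _ kB _ kw).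
  by rewrite inred; move: wV; rewrite !inE => /orP[/eqP->|->]; rewrite ?ub ?uK ?orbT.
have exk : exists2 k, k \in B & (k \in b) && (k \in K).
  have [ub|ub] := boolP (u \in b); first by exists u; rewrite ?uB ?ub.
  have inr c : (c \in red X K V u b) = (c \in b) && (c \in X :|: K).
    by rewrite inred (negbTE ub) orbF.
  have [||||k kB kK] := @red_reach b B x bP mK xB.
  - by have := BA' _ xB; rewrite inr => /andP[].
  - by have := BA' _ xB; rewrite inr => /andP[].
  - by move=> c d cB db dXK cd; apply: (cl _ _ cB _ cd); rewrite inr db.
  - by move=> c /BA'; rewrite inr => /andP[].
  by exists k; rewrite // kK andbT; have := BA' _ kB; rewrite inr => /andP[].
have allK := key uB exk.
have [uyV|] := boolP ((u \in b) && (y \in V)).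
  case/andP: uyV => ub yV; case/negP: yB.
  suff : u |: V \subset B by move/subsetP; apply; rewrite !inE yV orbT.
  apply: (conn_closed cV (uB ub)); first by rewrite !inE eqxx.
  move=> c d _ dV cB; apply: (cl _ _ cB); rewrite inred.
  by move: dV; rewrite !inE => /orP[/eqP->|->]; rewrite ?ub ?uK ?orbT.
move=> nV; have /andP[yb yXK] : (y \in b) && (y \in X :|: K).
  by move: yA; rewrite inred (negbTE nV) orbF.
have [|||k] := @red_reach b ((b :&: (X :|: K)) :\: B) y bP mK _ yb yXK.
- by rewrite in_setD yB in_setI yb.
- move=> c d; rewrite !in_setD !in_setI => /andP[cB /andP[cb' cXK]] db dXK cd.
  rewrite db dXK !andbT; apply: contra cB => dB; apply: (cl _ _ dB); last by rewrite sedgeC.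
  by rewrite inred cb' cXK.
- by move=> c; rewrite !in_setD !in_setI => /and3P[].
rewrite !in_setD !in_setI => /and3P[kB kb _] kK.
by case/negP: kB; apply: allK; rewrite inE kb.
Qed.

(** Touching members that meet beyond [K] both meet [K], and touch there or through [V]. For the
    order, the elements of a hitting set in [V] are traded for the single vertex [u]: a member that
    received [V] contains [u]. *)
Lemma red_bramble : bramble [set red X K V u b | b in P] N.
Proof.
have [cb tb hb] := brP; split.
- by move=> _ /imsetP[b bP ->]; exact: red_conn.
- have exK c : c \in P -> (exists2 y, y \in c & y \notin X :|: K) -> exists2 k, k \in c & k \in K.
    move=> cP [y yc]; rewrite inE negb_or => /andP[yX _].
    apply/disjointNP; apply/negP => /(PX cP)/subsetP/(_ _ yc); exact/negP.
  have outK c c' x y : c \in P -> c' \in P -> x \in c -> y \in c' -> x = y \/ x -- y -> 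
      x \notin X :|: K -> (exists2 k, k \in c & k \in K) /\ (exists2 k, k \in c' & k \in K).
    move=> cP cP' xc yc' xy xXK; split; first by apply: exK => //; exists x.
    have [yXK|yXK] := boolP (y \in X :|: K); last by apply: exK => //; exists y.
    case: xy => [E|xy]; first by rewrite E yXK in xXK.
    move: yXK xXK; rewrite !inE negb_or => /orP[yX|yK] /andP[xX xK]; last by exists y.
    by case/negP: xK; apply: XK yX xX _; rewrite sedgeC.
  have uV (c : {set G}) w : u \in c -> w \in u |: V -> w \in red X K V u c.
    by move=> uc; rewrite inred !inE => /orP[/eqP->|->]; rewrite ?uc ?uK ?orbT.
  have Kr (c : {set G}) k : k \in c -> k \in K -> k \in red X K V u c.
    by move=> kc kK; rewrite inred kc inE kK orbT.
  have uT (c c' : {set G}) k' : u \in c -> k' \in c' -> k' \in K -> touch (red X K V u c) (red X K V u c').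
    move=> uc kc' kK'; apply/touchP; have [E|ku] := eqVneq k' u.
      by exists u, u; split; [exact: Kr | apply: Kr => //; rewrite -E | left].
    have [w wV kw] := KV kK' ku; exists w, k'; split; [exact: uV | exact: Kr |].
    by right; rewrite sedgeC.
  move=> _ _ /imsetP[c cP ->] /imsetP[c' cP' ->].
  have /touchP[x [y [xc yc' xy]]] := tb _ _ cP cP'.
  have [/andP[xXK yXK]|] := boolP ((x \in X :|: K) && (y \in X :|: K)).
    by apply/touchP; exists x, y; rewrite !inred xc yc' xXK yXK.
  move=> out; have [[k kc kK] [k' kc' kK']] :
    (exists2 k, k \in c & k \in K) /\ (exists2 k, k \in c' & k \in K).
    move: out; rewrite negb_and => /orP[h|h]; first exact: outK xy h.
    have [] := outK _ _ _ _ cP' cP yc' xc _ h => //.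
    by case: xy => [->|]; rewrite 1?sedgeC; auto.
  have [uc|uc] := boolP (u \in c); first exact: uT kK'.
  have [uc'|uc'] := boolP (u \in c'); first by rewrite touchC; exact: uT kK.
  apply/touchP; exists k, k'; split; [exact: Kr | exact: Kr |].
  have [|kk'] := eqVneq k k'; first by left.
  by right; apply: clK => //; [apply: contraNneq uc => <- | apply: contraNneq uc' => <-].
move=> Y sY; pose Y' := (Y :\: V) :|: (if [disjoint Y & V] then set0 else [set u]).
have sY' : #|Y'| < N.
  apply: leq_ltn_trans sY; rewrite /Y'; case: ifP => [_|/negbT/disjointNP[y yY yV]].
    by rewrite setU0 subset_leq_card // subsetDl.
  rewrite (leq_trans (leq_card_setU _ _)) // cards1 addn1.
  apply: (leq_trans (_ : #|Y :\: V| < #|Y|)) => //; apply: proper_card.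
  rewrite properE subsetDl; apply/negP => /subsetP/(_ _ yY).
  by rewrite inE yV.
have [b bP dis] := hb _ sY'; exists (red X K V u b); first exact: imset_f.
have nYb y : y \in b -> y \notin Y'.
  by move=> yb; apply: contraL dis => yY; apply/disjointNP; exists y.
rewrite -[_ (mem _) _]negbK; apply/disjointNP => -[y]; rewrite inred => /orP[/andP[yb yXK]|/andP[ub yV]] yY.
  have := nYb _ yb; rewrite !inE yY andbT negb_or negbK => /andP[yV _].
  exact: disjP VXK yV yXK.
have := nYb _ ub; rewrite inE negb_or => /andP[_].
have /negbTE -> : ~~ [disjoint Y & V] by apply/disjointNP; exists y.
by rewrite inE eqxx.
Qed.

End Red.
End Bramble.

(** * Minimal induced paths between two sets *)

Section Link.
Variable G : sgraph.
Implicit Types (A B F K U V X Y : {set G}) (x y z p q u v w d : G) (s S : seq G).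

Definition link F X Y s := [/\ ipath s, s != [::], {subset s <= F} &
  forall s1 v s2, s = s1 ++ v :: s2 ->
    (v \in X) = (s1 == [::]) /\ (v \in Y) = (s2 == [::])].

Lemma linkI F X Y x y : x \in X -> y \in Y -> x \in F -> connect (rin F) x y ->
  exists s, link F X Y s.
Proof.
move=> xX yY xF /(min_link xX yY xF)[z [p [ip pF zX lY [nX nY]]]].
exists (z :: p); split=> // s1 v s2 E; split.
  case: s1 E => [|c s1] /= [<- E] //=; apply/negbTE/nX.
  by rewrite E mem_cat mem_head orbT.
case/lastP: s2 E => [|s2 e] E.
  by move: lY; rewrite -[last z p]/(last z (z :: p)) E last_cat.
have -> : (rcons s2 e == [::]) = false by case: (s2).
apply/negbTE/nY; move: E; rewrite -rcons_cons -rcons_cat lastI => /rcons_inj[-> _].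
by rewrite mem_cat mem_head orbT.
Qed.

Lemma link_conn F X Y x y : conn F -> x \in X -> y \in Y -> x \in F -> y \in F ->
  exists s, link F X Y s.
Proof. by move=> /connP cF xX yY xF yF; apply: linkI xX yY xF (cF _ _ xF yF). Qed.

Lemma link_head F X Y s d : link F X Y s -> head d s \in X /\ head d s \in s.
Proof.
case: s => [|c s] [ip s0 sF h] //; rewrite mem_head.
by have [-> _] := h [::] c s erefl.
Qed.

Lemma link_last F X Y s d : link F X Y s -> last d s \in Y /\ last d s \in s.
Proof.
case/lastP: s => [|s c] [ip s0 sF h] //; rewrite last_rcons mem_rcons mem_head.
by have [|_ ->] := h s c [::]; rewrite ?cats1.
Qed.

Lemma link_X F X Y s v d : link F X Y s -> v \in s -> v \in X -> v = head d s.
Proof.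
case=> _ _ _ h /path.splitPr vs; case: s / vs h => s1 s2 h vX.
by have [] := h s1 v s2 erefl; rewrite vX; case: (s1).
Qed.

Lemma link_Y F X Y s v d : link F X Y s -> v \in s -> v \in Y -> v = last d s.
Proof.
case=> _ _ _ h /path.splitPr vs; case: s / vs h => s1 s2 h vY.
by have [_] := h s1 v s2 erefl; rewrite vY last_cat; case: (s2).
Qed.

Lemma conn_sorted s : sorted (@sedge G) s -> conn [set y in s].
Proof.
case: s => [|x p] /=; first by move=> _; apply/connP => a b; rewrite inE.
move=> pp; apply: (@conn_from _ _ x); first by rewrite inE mem_head.
move=> y; rewrite inE => yp; elim: p x pp yp => [|z p IH] x /=.
  by move=> _; rewrite inE => /eqP->; exact: connect0.
move=> /andP[xz pp]; rewrite inE => /orP[/eqP->|yp]; first exact: connect0.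
apply: connect_trans (connect_rinS _ (IH z pp yp)).
  by apply: connect1; rewrite /rin /= xz !inE !eqxx !orbT.
by apply/subsetP => a; rewrite !inE => ->; rewrite orbT.
Qed.

Lemma conn_ipath s : ipath s -> conn [set y in s].
Proof. by move/ipath_sorted; exact: conn_sorted. Qed.

Lemma conn_U1 V u y : conn V -> y \in V -> u -- y -> conn (u |: V).
Proof.
move=> cV yV uy; apply: conn_setU => //; first exact: conn1.
by apply/touchP; exists u, y; rewrite inE; split=> //; right.
Qed.

Lemma ipath_nbr s1 v s2 w : ipath (s1 ++ v :: s2) -> w \in s1 ++ v :: s2 -> v -- w ->
  (s1 != [::] /\ forall d, last d s1 = w) \/ (s2 != [::] /\ forall d, head d s2 = w).
Proof.
move=> ip; rewrite mem_cat inE => /or3P[|/eqP->|]; last 2 first.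
- by rewrite sedgexx.
- move=> /path.splitPr ws; case: s2 / ws ip => a b ip vw; right.
  have [_] := ipath_cross ip; rewrite vw; case: a ip => //= c a _.
  by move=> /(_ isT).
move=> /path.splitPr ws; case: s1 / ws ip => a b ip vw; left.
move: ip; rewrite -catA /= => /ipath_cross[_]; rewrite sedgeC vw.
case: b => [_|c b /(_ isT)//]; split; first by case: (a).
by move=> d; rewrite last_cat.
Qed.

Lemma reach_NB A B x d : conn A -> x \in A -> x \notin B -> d \in B -> d \in A ->
  exists y, [/\ y \in NB B, y \in A & connect (rin (A :\: B)) x y].
Proof.
move=> cA xA xB dB dA.
have xAB : x \in A :\: B by rewrite inE xB.
have dC : d \notin comp (A :\: B) x.
  by apply/negP => /(subsetP (comp_sub xAB)); rewrite inE dB.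
have [a [b [aA bA aC bC ab]]] := conn_exit cA xA dA (comp_refl _ x) dC.
have aAB : a \in A :\: B by apply: (subsetP (comp_sub xAB)).
have bB : b \in B.
  by apply: contraNT bC => bB; apply: comp_closed ab => //; rewrite inE bB.
exists a; split=> //; last by rewrite inE in aC.
apply/NBP; split; first by move: aAB; rewrite inE => /andP[].
by exists b; rewrite // sedgeC.
Qed.

End Link.

(** * Small separations of a minimal graph *)

Section Min.
Variables (G : sgraph) (N : nat).
Implicit Types (A B F K U V X Y b : {set G}) (x y z p q u v w d : G) (P : {set {set G}}) (s S : seq G).
Hypothesis cG : clean G.
Hypothesis N5 : 4 < N.
Hypothesis minG : forall U, bramble_in U N -> U = [set: G].

(** The component of the graph without [K] that contains the members of [P] missing [K]. *)
Definition bigside P K X := [/\ conn X, [disjoint X & K],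
  forall x y, x \in X -> y \notin X -> x -- y -> y \in K,
  exists2 b, b \in P & b \subset X & {in P, forall b, [disjoint b & K] -> b \subset X}].

Lemma mk_bigside P K X b0 : bramble P N -> conn X -> [disjoint X & K] ->
  (forall x y, x \in X -> y \notin X -> x -- y -> y \in K) ->
  b0 \in P -> b0 \subset X -> bigside P K X.
Proof.
move=> [cb tb _] cX dX nX b0P b0X; split=> //; first by exists b0.
move=> b bP dbK; have /touchP[x [y [xb yb0 xy]]] := tb _ _ bP b0P.
have stay u v : u \in X -> v \in b -> u -- v -> v \in X.
  move=> uX vb uv; apply: contraT => vX; exfalso.
  exact: disjP dbK vb (nX _ _ uX vX uv).
have yX := subsetP b0X _ yb0.
have xX : x \in X.
  by case: xy => [->//|xy]; apply: stay yX xb _; rewrite sedgeC.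
by apply: (conn_closed (cb _ bP) xX xb) => u v _ vb uX; exact: stay.
Qed.

Lemma bigsideP P K : bramble P N -> #|K| < N -> exists X, bigside P K X.
Proof.
move=> brP sK; have [cb tb hb] := brP; have [b0 b0P db0] := hb _ sK.
have [x xb0] := touch_neq0 (tb _ _ b0P b0P).
have b0K : b0 \subset ~: K.
  by apply/subsetP => y yb; rewrite inE; apply/negP; exact: disjP db0 yb.
have xK : x \in ~: K by exact: (subsetP b0K).
exists (comp (~: K) x); apply: (mk_bigside brP _ _ _ b0P).
- exact: conn_comp.
- rewrite -[_ (mem _) _]negbK; apply/disjointNP => -[y /(subsetP (comp_sub xK))].
  by rewrite inE => /negbTE->.
- move=> u v uC vC uv; apply: contraT => vK; case/negP: vC.
  by apply: comp_closed uv => //; rewrite inE.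
by apply: comp_max => //; exact: cb.
Qed.

(** The bramble modified by [red] lives in [X], [K] and [V], so minimality leaves no other
    vertices. *)
Lemma min_all P K X V u : bramble P N -> bigside P K X -> u \in K ->
  [disjoint V & X :|: K] -> conn (u |: V) ->
  (forall k, k \in K -> k != u -> exists2 y, y \in u |: V & k -- y) ->
  {in K &, forall k k', k != u -> k' != u -> k != k' -> k -- k'} ->
  (X :|: K) :|: V = [set: G].
Proof.
move=> brP [cX dX nX _ PX] uK dV cV KV clK; apply: minG.
exists [set red X K V u b | b in P]; first exact: red_bramble.
move=> _ /imsetP[b bP ->]; rewrite /red; apply: setUSS; first exact: subsetIr.
by case: ifP => // _; exact: sub0set.
Qed.

(** A separator of one vertex needs no replacement for the far side: [V] is empty. *)
Lemma no_cutvertex P c X v : bramble P N -> bigside P [set c] X -> v != c -> v \in X.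
Proof.
move=> brP bX vc; have E : (X :|: [set c]) :|: set0 = [set: G].
  apply: (min_all brP bX (set11 c)).
  - by rewrite -setI_eq0 set0I.
  - by rewrite setU0; exact: conn1.
  - by move=> k /set1P->; rewrite eqxx.
  by move=> k k' /set1P->; rewrite eqxx.
by have := in_setT v; rewrite -E !inE (negbTE vc) !orbF.
Qed.

Lemma bigside_neq P K X : bramble P N -> bigside P K X -> exists x, x \in X.
Proof.
move=> [_ tb _] [_ _ _ [b bP /subsetP bX] _].
by have [x xb] := touch_neq0 (tb _ _ bP bP); exists x; exact: bX.
Qed.

Lemma comp_disj P K X v : bigside P K X -> v \notin X -> v \notin K ->
  [disjoint comp (~: K) v & X].
Proof.
move=> [cX dX nX _ _] vX vK; have vK' : v \in ~: K by rewrite inE.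
rewrite -[_ (mem _) _]negbK; apply/disjointNP => -[y yC yX].
case/negP: vX; apply: (subsetP (conn_closed (conn_comp vK') yX yC _)) (comp_refl _ v).
move=> a b _ /(subsetP (comp_sub vK')); rewrite inE => bK aX ab.
by apply: contraR bK => bX; exact: nX aX bX ab.
Qed.

Lemma card_set2 (a c : G) A : A \subset [set a; c] -> #|A| <= 2.
Proof. by move=> /subset_leq_card/leq_trans; apply; rewrite cards2; case: eqP. Qed.

Lemma comp_NB K v y z : v \in ~: K -> y \in comp (~: K) v -> z \notin comp (~: K) v ->
  y -- z -> z \in K.
Proof.
move=> vK yV zV yz; apply: contraR zV => zK.
by apply: comp_closed yz => //; rewrite inE.
Qed.

(* A vertex set off from the bramble by two vertices has degree at most two: by
   minimality its side is just an induced path. *)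
Lemma two_cut_degree P p q X v : bramble P N -> bigside P [set p; q] X -> v \notin X ->
  v != p -> v != q -> #|nbh v| <= 2.
Proof.
move=> brP bX vX vp vq; have [cX dX nX _ _] := bX.
have vK : v \notin [set p; q] by rewrite !inE negb_or vp.
have vK' : v \in ~: [set p; q] by rewrite inE.
pose V := comp (~: [set p; q]) v.
have cV : conn V := conn_comp vK'.
have dVX : [disjoint V & X] := comp_disj bX vX vK.
have VK y : y \in V -> y \notin [set p; q].
  by move/(subsetP (comp_sub vK')); rewrite inE.
have nV x y : x \in V -> y \notin V -> x -- y -> y \in [set p; q].
  exact: comp_NB.
(* Both [p] and [q] have neighbours on the side of [v], as otherwise the other one would be a cut
   vertex. *)
have adj c c' : [set p; q] = [set c; c'] -> exists2 y, y \in V & c -- y.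
  move=> EK; apply: contrapT => nc.
  have [|Xc bXc] := @bigsideP P [set c'] brP; first by rewrite cards1 (ltn_trans _ N5).
  have [x xX] := bigside_neq brP bX.
  have nc' y : y \in ~: [set p; q] -> y \in Xc.
    rewrite EK !inE negb_or => /andP[_ yc']; exact: no_cutvertex brP bXc yc'.
  have [cXc dXc _ _ _] := bXc.
  suff /subsetP/(_ x) : Xc \subset V.
    have xK : x \in ~: [set p; q] by rewrite inE; apply/negP; exact: disjP dX xX.
    by move=> /(_ (nc' _ xK)) xV; exact: disjP dVX xV xX.
  apply: (conn_closed cXc (comp_refl _ v) (nc' _ vK')) => y z _ zXc yV yz.
  apply: contraT => zV; have := nV _ _ yV zV yz; rewrite EK !inE => /orP[] /eqP Ez.
    by exfalso; apply: nc; exists y; rewrite // -Ez sedgeC.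
  by exfalso; apply: (disjP dXc zXc); rewrite inE Ez.
have [y1 y1V py1] := adj p q erefl.
have [y2 y2V qy2] := adj q p (setUC _ _).
have [s Ls] := @link_conn _ V (nbh p) (nbh q) y1 y2 cV ltac:(by rewrite inE) ltac:(by rewrite inE) y1V y2V.
have [ip s0 sV hs] := Ls.
have [h1 h2] := link_head p Ls; have [h3 h4] := link_last q Ls.
have E : (X :|: [set p; q]) :|: [set y in s] = [set: G].
  apply: (@min_all P [set p; q] X _ p) => //.
  - by rewrite !inE eqxx.
  - rewrite -[_ (mem _) _]negbK; apply/disjointNP => -[y]; rewrite inE => /sV yV.
    by rewrite in_setU (negbTE (VK _ yV)) orbF => yX; exact: disjP dVX yV yX.
  - apply: (conn_U1 (y := head p s)); [exact: conn_ipath | by rewrite inE | by move: h1; rewrite inE].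
  - move=> k; rewrite !inE => /orP[/eqP->|/eqP-> _]; first by rewrite eqxx.
    by exists (last q s); rewrite ?inE ?h4 ?orbT //; move: h3; rewrite inE.
  by move=> k k'; rewrite !inE => /orP[/eqP->|/eqP->] /orP[/eqP->|/eqP->]; rewrite ?eqxx.
have vs : v \in s.
  have := in_setT v; by rewrite -E 2!in_setU (negbTE vX) (negbTE vK) /= inE.
case/path.splitPr: vs Ls ip E hs => s1 s2 Ls ip E hs.
have [vp' vq'] := hs s1 v s2 erefl.
apply: (@card_set2 (last p s1) (head q s2)); apply/subsetP => w; rewrite inE => vw.
have : w \in [set: G] by rewrite in_setT.
rewrite -E !in_setU => /orP[/orP[wX|]|].
- exfalso; case/negP: vK; apply: nX wX vX _; by rewrite sedgeC.
- rewrite !inE => /orP[/eqP wp|/eqP wq].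
    have /eqP -> : (s1 == [::]) = true by rewrite -vp' inE -wp sedgeC.
    by rewrite wp eqxx.
  have /eqP -> : (s2 == [::]) = true by rewrite -vq' inE -wq sedgeC.
  by rewrite wq eqxx orbT.
rewrite inE => ws; have [[_ l]|[_ l]] := ipath_nbr ip ws vw.
  by rewrite !inE l eqxx.
by rewrite !inE l eqxx orbT.
Qed.

End Min.

(** * Separators consisting of a vertex and an edge *)

Section Apex.
Variables (G : sgraph) (N : nat).
Implicit Types (A B F K U V X Y b : {set G}) (x y z p q u v w d a c : G) (P : {set {set G}}) (s S W : seq G).
Hypothesis cG : clean G.

(* A hole through [u] and [q] that [p] sees twice, at [q] and at [head p S]. *)
Lemma no_double X u p q S : conn X ->
  (forall x y, x \in X -> y \notin X -> x -- y -> y \in u |: [set p; q]) ->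
  [disjoint X & u |: [set p; q]] ->
  (exists2 x, x \in X & u -- x) -> (exists2 x, x \in X & q -- x) ->
  u != p -> u != q -> p -- q ->
  ipath S -> S != [::] -> {in S, forall w, w \notin X :|: (u |: [set p; q])} ->
  {in S, forall w, u -- w -> w = head p S} -> u -- head p S -> p -- head p S ->
  {in S, forall w, q -- w -> w = last p S} -> q -- last p S -> False.
Proof.
move=> cX nX dX [xu xuX uxu] [xq xqX qxq] up uq pq iS S0 SN uS uh ph qS ql.
have hS d : head d S = head p S by case: (S) S0.
have lS d : last d S = last p S by case: (S) S0.
have hin : head p S \in S by case: (S) S0 => //= a s _; rewrite mem_head.
have SK w : w \in S -> [/\ w \notin X, w != u, w != p & w != q].
  by move/SN; rewrite !inE !negb_or => /and4P[].
have XK x : x \in X -> [/\ x != u, x != p & x != q].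
  move=> xX; have := disjP dX xX; rewrite !inE => h.
  by split; apply/eqP => E; apply: h; rewrite E !eqxx ?orbT.
have sz2 : 1 < size S.
  case: (S) S0 ph ql => //= a [|e s] //= _ pa qa; exfalso.
  by apply: (cG.1 p q a).
(* The hole consists of [u], [S], [q] and a way back to [u]: [t] is empty if [u] sees [q], and a
   path through [X] otherwise. *)
suff [t [H qt pt]] : exists t, [/\ ihole u (S ++ q :: t), True & p \notin t].
  have E : head p S = q.
    apply: (cG.2 _ _ p _ _ H); rewrite ?ph ?pq ?(inE, mem_cat) ?hin ?eqxx ?orbT //.
    rewrite !negb_or eq_sym up pt (sedge_neq pq) !andbT.
    by apply/negP => /SK[_ _ /eqP].
  by have [_ _ _] := SK _ hin; rewrite E eqxx.
have [uq'|nuq] := boolP (u -- q).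
  exists [::]; split=> //; apply: ihole_intro.
  - apply: (@ipath_catE _ p) => //=; first by rewrite sedgeC.
    move=> a e aS; rewrite inE => /eqP->; split; first by have [] := SK _ aS.
    by rewrite sedgeC => /(qS _ aS).
  - by rewrite size_cat /=; slia.
  - by rewrite mem_cat inE negb_or uq andbT; apply/negP => /SK[_ /eqP].
  - by case: (S) S0 hS uh => //= a s _ <-.
  - by rewrite last_cat.
  move=> y; rewrite last_cat mem_cat inE => /orP[yS /(uS _ yS)->|/eqP-> _]; last by right.
  by left; case: (S) S0.
have [s Ls] := @link_conn _ X (nbh q) (nbh u) xq xu cX ltac:(by rewrite inE) ltac:(by rewrite inE) xqX xuX.
have [ip s0 sX hs] := Ls.
have [h1 h2] := link_head q Ls; have [h3 h4] := link_last p Ls.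
rewrite !inE in h1 h3.
exists s; split=> //; last by apply/negP => /sX/XK[_ /eqP].
have nSX a x : a \in S -> x \in X -> ~~ (a -- x).
  move=> aS xX; apply/negP; rewrite sedgeC => xa.
  have [aX au ap aq] := SK _ aS.
  by have := nX _ _ xX aX xa; rewrite !inE (negbTE au) (negbTE ap) (negbTE aq).
apply: ihole_intro.
- apply: (@ipath_catE _ p) => //.
  + apply: (@ipath_catE _ q [:: q] s) => //.
    move=> a e; rewrite inE => /eqP-> es; split.
      by have [_ _] := XK _ (sX _ es); rewrite eq_sym.
    by move=> qe; split=> //; apply: (link_X _ Ls) => //; rewrite inE.
  + by rewrite /= sedgeC.
  move=> a e aS; rewrite inE => /orP[/eqP->|es].
    split; first by have [] := SK _ aS.
    by rewrite sedgeC => /(qS _ aS).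
  split; last by move=> ae; rewrite (negbTE (nSX _ _ aS (sX _ es))) in ae.
  by have [aX _ _ _] := SK _ aS; apply: contraNneq aX => ->; exact: sX.
- by rewrite size_cat /=; slia.
- rewrite mem_cat inE !negb_or uq /=; apply/andP; split.
    by apply/negP => /SK[_ /eqP].
  by apply/negP => /sX/XK[/eqP].
- by case: (S) S0 hS uh => //= a r _ <-.
- by rewrite last_cat /=; case: (s) s0 h3.
have -> : last u (S ++ q :: s) = last p s by rewrite last_cat /=; case: (s) s0.
have -> : head u (S ++ q :: s) = head p S by case: (S) S0.
move=> y; rewrite mem_cat inE => /or3P[yS /(uS _ yS)->|/eqP->|ys uy]; [by left| |].
  by rewrite (negbTE nuq).
by right; apply: (link_Y _ Ls) => //; rewrite inE.
Qed.

Hypothesis N5 : 4 < N.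
Hypothesis minG : forall U, bramble_in U N -> U = [set: G].

Section K3.
Variables (P : {set {set G}}) (u p q z : G) (X : {set G}).
Let K := u |: [set p; q].
Hypothesis brP : bramble P N.
Hypothesis bX : bigside P K X.
Hypothesis zX : z \notin X.
Hypothesis zK : z \notin K.
Hypothesis bz : 2 < #|nbh z|.
Let V := comp (~: K) z.

Lemma apex_nbrV k a c : K = k |: [set a; c] -> exists2 y, y \in V & k -- y.
Proof.
move=> EK; apply: contrapT => nc.
have zK' : z \in ~: K by rewrite inE.
have dVX : [disjoint V & X] := comp_disj bX zX zK.
have [|X' bX'] := @bigsideP _ N P [set a; c] brP.
  by rewrite cards2; case: eqP; move: N5 => /=; slia.
have [cX' dX' nX' _ PX'] := bX'.
have [_ dX _ [b bP bsX] _] := bX.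
have bX'' : b \subset X'.
  apply: PX' => //; rewrite -[_ (mem _) _]negbK; apply/disjointNP => -[y yb yac].
  by apply: (disjP dX (subsetP bsX _ yb)); rewrite EK inE yac orbT.
have : z \notin X'.
  apply/negP => zX'; have /subsetP s : X' \subset V.
    apply: (conn_closed cX' (comp_refl _ z) zX') => y w _ wX' yV yw.
    apply: contraT => wV; exfalso; have := comp_NB zK' yV wV yw.
    rewrite EK 2!inE => /orP[/eqP E|wac]; last exact: disjP dX' wX' wac.
    by apply: nc; exists y; rewrite // -E sedgeC.
  have [_ tb _] := brP; have [x xb] := touch_neq0 (tb _ _ bP bP).
  by apply: (disjP dVX (s x _)); apply: (subsetP _ _ xb).
move: zK; rewrite EK !inE !negb_or => /and3P[_ za zc] nz.
by have := two_cut_degree N5 minG brP bX' nz za zc; rewrite leqNgt bz.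
Qed.

Lemma apex_nbrX k a c : K = k |: [set a; c] -> exists2 y, y \in X & k -- y.
Proof.
move=> EK; apply: contrapT => nc.
have [cX dX nX [b bP bsX] _] := bX.
have bX' : bigside P [set a; c] X.
  apply: (mk_bigside brP cX _ _ bP bsX).
    rewrite -[_ (mem _) _]negbK; apply/disjointNP => -[y yb yac].
    by apply: (disjP dX yb); rewrite EK inE yac orbT.
  move=> x y xX yX xy; have := nX _ _ xX yX xy; rewrite EK 2!inE => /orP[/eqP E|//].
  by exfalso; apply: nc; exists x; rewrite // -E sedgeC.
move: zK; rewrite EK !inE !negb_or => /and3P[_ za zc].
by have := two_cut_degree N5 minG brP bX' zX za zc; rewrite leqNgt bz.
Qed.

Hypothesis pq : p -- q.
Hypothesis up : u != p.
Hypothesis uq : u != q.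

(** Minimality applies with [u] as the exceptional vertex of the separator, because [p] and [q] are
    adjacent. So a connected set beyond the separator that sees all of [u], [p], [q] is the whole
    side. *)
Lemma apex_min A : A \subset V -> conn A ->
  (exists2 y, y \in A & u -- y) -> (exists2 y, y \in A & p -- y) ->
  (exists2 y, y \in A & q -- y) -> V \subset A /\ (X :|: K) :|: A = [set: G].
Proof.
move=> AV cA [y yA uy] [yp ypA py] [yq yqA qy].
have dVX : [disjoint V & X] := comp_disj bX zX zK.
have zK' : z \in ~: K by rewrite inE.
have VK y' : y' \in V -> y' \notin K by move/(subsetP (comp_sub zK')); rewrite inE.
have E : (X :|: K) :|: A = [set: G].
  apply: (min_all minG brP bX (u := u)).
  - by rewrite !inE eqxx.
  - rewrite -[_ (mem _) _]negbK; apply/disjointNP => -[w /(subsetP AV) wV].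
    by rewrite inE (negbTE (VK _ wV)) orbF => wX; exact: disjP dVX wV wX.
  - exact: conn_U1 cA yA uy.
  - move=> k; rewrite !inE => /or3P[/eqP->|/eqP->|/eqP->]; first by rewrite eqxx.
      by exists yp; rewrite // !inE ypA orbT.
    by exists yq; rewrite // !inE yqA orbT.
  move=> k k'; rewrite !inE => /or3P[]/eqP-> /or3P[]/eqP->; rewrite ?eqxx // => _ _ _.
  by rewrite sedgeC.
split=> //; apply/subsetP => w wV; have := in_setT w; rewrite -E !in_setU.
case/orP => [/orP[wX|]|//]; first by exfalso; exact: disjP dVX wV wX.
by move=> wK; have := VK _ wV; rewrite /K !in_setU wK.
Qed.

Hypothesis zu : u -- z.

(** Take for [W] a minimal path from [p] to [q] beyond the separator. With [p] and [q] it is a hole,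
    which [u] sees at most once. If [u] sees it, it is the whole side by [apex_min], and [z] is not
    one of its ends by [no_double]. If [u] misses it, a minimal path from [u] to [W] completes the
    side, and the third neighbour of [z] again produces a double contact. *)
Lemma apexP : exists W1 W2, let W := W1 ++ z :: W2 in
  [/\ ipath W, W1 != [::], W2 != [::] & [/\ [disjoint [set y in W] & X :|: K],
    (X :|: K) :|: [set y in W] = [set: G],
    {in W, forall y, u -- y -> y = z},
    {in W, forall y, p -- y -> y = head p W} /\ {in W, forall y, q -- y -> y = last q W}
    & p -- head p W /\ q -- last q W]].
Proof.
have [cX dX nX _ _] := bX.
have zK' : z \in ~: K by rewrite inE.
have cV : conn V := conn_comp zK'.
have VK y : y \in V -> y \notin X :|: K.
  move=> yV; rewrite inE negb_or; have := subsetP (comp_sub zK') _ yV; rewrite inE => ->.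
  rewrite andbT; apply/negP; exact: disjP (comp_disj bX zX zK) yV.
have VK3 y : y \in V -> [/\ y \notin X, y != u, y != p & y != q].
  by move/VK; rewrite !inE !negb_or => /and4P[].
have Kp : K = p |: [set u; q] by rewrite /K setUCA.
have Kq : K = q |: [set u; p] by rewrite /K [[set p; q]]setUC setUCA.
have [yp ypV pyp] := apex_nbrV Kp.
have [yq yqV qyq] := apex_nbrV Kq.
have Xu := apex_nbrX erefl.
have Xp := apex_nbrX Kp.
have Xq := apex_nbrX Kq.
have nX' x y : x \in X -> y \notin X -> x -- y -> y \in u |: [set q; p].
  by rewrite [[set q; p]]setUC; exact: nX.
have dX' : [disjoint X & u |: [set q; p]] by rewrite [[set q; p]]setUC.
have qp : q -- p by rewrite sedgeC.
have [W LW] := @link_conn _ V (nbh p) (nbh q) yp yq cV ltac:(by rewrite inE) ltac:(by rewrite inE) ypV yqV.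
have [iW W0 WV _] := LW.
have [ph hW] := link_head p LW; have [ql lW] := link_last p LW; rewrite !inE in ph ql.
have pW y : y \in W -> p -- y -> y = head p W by move=> yW py; apply: (link_X _ LW); rewrite ?inE.
have qW y : y \in W -> q -- y -> y = last p W by move=> yW py; apply: (link_Y _ LW); rewrite ?inE.
have hWd d : head d W = head p W by case: (W) W0.
have lWd d : last d W = last p W by case: (W) W0.
have WK y : y \in W -> y \notin X :|: K by move/WV/VK.
have WK' y : y \in W -> y \notin X :|: (u |: [set q; p]).
  by rewrite [[set q; p]]setUC; exact: WK.
have sW : 1 < size W.
  case: (W) W0 ph ql => //= a [|e s] //= _ pa qa; exfalso.
  exact: (cG.1 p q a).
have hole_O : ihole q (p :: W).
  apply: ihole_intro => //=.
  - have : ipath ([:: p] ++ W).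
      apply: (@ipath_catE _ p) => //.
      move=> a e; rewrite inE => /eqP-> eW; split.
        by have [_ _] := VK3 _ (WV _ eW); rewrite eq_sym.
      by move=> pe; split=> //; exact: pW.
    by [].
  - rewrite inE negb_or eq_sym (sedge_neq pq); apply/negP => /WV/VK3[_ _ _].
    by rewrite eqxx.
  move=> y; rewrite inE => /orP[/eqP->|yW qy]; first by left.
  by right; exact: qW.
have uO : u \notin q :: p :: W.
  rewrite !inE !negb_or up uq /=; apply/negP => /WV/VK3[_].
  by rewrite eqxx.
have holes y1 y2 : y1 \in q :: p :: W -> y2 \in q :: p :: W -> u -- y1 -> u -- y2 -> y1 = y2.
  exact: cG.2 hole_O uO.
have [[w wW uw]|nW] := pselect (exists2 w, w \in W & u -- w).
  have [|||||VW E] := @apex_min [set y in W].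
  - by apply/subsetP => y; rewrite inE => /WV.
  - exact: conn_ipath.
  - by exists w; rewrite ?inE.
  - by exists (head p W); rewrite ?inE.
  - by exists (last p W); rewrite ?inE.
  have zW : z \in W by have := subsetP VW _ (comp_refl _ z); rewrite inE.
  have uWz y : y \in W -> u -- y -> y = z.
    by move=> yW uy; apply: holes => //; rewrite !inE ?yW ?zW ?orbT.
  have [W1 [W2 Ez]] : exists W1 W2, W = W1 ++ z :: W2.
    by case/path.splitPr: zW => a c; exists a, c.
  exists W1, W2; rewrite -Ez /=.
  split=> //; last first.
  - split=> //; last by rewrite (lWd q).
    + rewrite -[_ (mem _) _]negbK; apply/disjointNP => -[y]; rewrite inE => yW.
      by rewrite (negbTE (WK _ yW)).
    + by split=> // y yW /(qW _ yW); rewrite (lWd q).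
  - apply/eqP => E2.
    have lz : last p W = z by rewrite Ez E2 last_cat.
    have hr d : head d (rev W) = z.
      by rewrite -lz; case/lastP: (W) W0 => // s e _; rewrite rev_rcons last_rcons.
    have lr d : last d (rev W) = head p W.
      by case: (W) W0 => // e s _; rewrite rev_cons last_rcons.
    apply: (@no_double X u q p (rev W) cX nX' dX' Xu Xp) => //.
    + exact: ipath_rev.
    + by case: (W) W0 => // a s _; rewrite rev_cons; case: (rev s).
    + by move=> w'; rewrite mem_rev; exact: WK'.
    + by move=> w'; rewrite mem_rev hr; exact: uWz.
    + by rewrite hr.
    + by rewrite hr -lz.
    + by move=> w'; rewrite mem_rev lr; exact: pW.
    by rewrite lr.
  apply/eqP => E1.
  have hz d : head d W = z by rewrite Ez E1.
  apply: (@no_double X u p q W cX nX dX Xu Xq) => //.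
  + by move=> w' w'W /(uWz _ w'W); rewrite hz.
  by rewrite hz.
(* The case in which [u] misses [W]: [Y] will be a minimal path from a neighbour of [u] to the
   boundary of [W]. *)
pose Ws := [set y in W].
have [yu yuV uyu] := apex_nbrV erefl.
have yuW : yu \notin Ws by rewrite inE; apply/negP => h; apply: nW; exists yu.
have [|y0 [y0N y0V con]] := @reach_NB _ V Ws yu (head p W) cV yuV yuW _ (WV _ hW).
  by rewrite inE.
have [||Y LY] := @linkI _ (V :\: Ws) (nbh u) (NB Ws) yu y0 _ y0N _ con.
- by rewrite inE.
- by rewrite inE yuW.
have [iY Y0 YV hY] := LY.
have YV' y : y \in Y -> y \in V /\ y \notin W by move/YV; rewrite !inE => /andP[-> ].
have [uh hYY] := link_head p LY; have [lN lYY] := link_last p LY; rewrite inE in uh.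
have [_ [w0 w0W]] := NBP _ _ lN; rewrite inE in w0W => ysw0; rewrite sedgeC in ysw0.
set ys := last p Y in lN lYY ysw0.
have ysO y : y \in q :: p :: W -> ys -- y -> y = w0.
  have [ysV ysW] := YV' _ lYY.
  move=> yO yy; apply: (cG.2 _ _ ys _ _ hole_O) => //; last by rewrite !inE w0W !orbT.
  have [_ _ h1 h2] := VK3 _ ysV; by rewrite !inE !negb_or h1 h2.
pose A := [set y in Y] :|: Ws.
have [|||||VA _] := @apex_min A.
- by apply/subsetP => y; rewrite in_setU => /orP[]; rewrite in_set; [case/YV' | exact: WV].
- rewrite /A; apply: conn_setU; [exact: conn_ipath | exact: conn_ipath |].
  by apply/touchP; exists ys, w0; rewrite !inE; split=> //; right.
- by exists (head p Y); rewrite // !inE hYY.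
- by exists (head p W); rewrite // !inE hW orbT.
- by exists (last p W); rewrite // !inE lW orbT.
have zY : z \in Y.
  have := subsetP VA _ (comp_refl _ z); rewrite !inE => /orP[//|zW].
  by exfalso; apply: nW; exists z.
have zh : head p Y = z by rewrite [RHS](link_X p LY) // inE.
have [Y' EY] : exists Y' : seq G, Y = z :: Y' by case: (Y) zh Y0 => //= a s -> _; exists s.
(* If [Y] saw both [p] and [q], it would be the whole side by itself, although it is disjoint from
   [W]. *)
have nYpq : (exists2 y, y \in Y & p -- y) -> (exists2 y, y \in Y & q -- y) -> False.
  move=> [a aY pa] [c cY qc].
  have [|||||VY _] := @apex_min [set y in Y].
  - by apply/subsetP => y; rewrite inE => /YV'[].
  - exact: conn_ipath.
  - by exists z; rewrite ?inE.
  - by exists a; rewrite ?inE.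
  - by exists c; rewrite ?inE.
  have := subsetP VY _ (WV _ hW); rewrite inE => /YV'[_]; by rewrite hW.
have nbV y : z -- y -> y \in V \/ y \in K.
  move=> zy; have [|yV] := boolP (y \in V); first by left.
  by right; apply: (comp_NB zK' (comp_refl _ z) yV zy).
(* If [Y] were [z] alone, the neighbours of [z] would be [u] and its only neighbour on the hole. *)
have Y'0 : Y' != [::].
  apply/eqP => E; have ysz : ys = z by rewrite /ys EY E.
  have : nbh z \subset [set u; w0].
    apply/subsetP => y; rewrite !inE => zy; case: (nbV _ zy) => [/(subsetP VA)|].
      rewrite !inE EY E inE => /orP[/eqP Ey|yW]; first by rewrite Ey sedgexx in zy.
      by rewrite (ysO y) ?eqxx ?orbT // ?inE ?yW ?orbT // ysz.
    rewrite !inE => /or3P[->//|/eqP Ey|/eqP Ey]; rewrite (ysO y) ?eqxx ?orbT ?ysz //.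
      by rewrite Ey !inE eqxx orbT.
    by rewrite Ey !inE eqxx.
  by move/card_set2; rewrite leqNgt bz.
have zN : z \notin NB Ws.
  by have [_ ->] := hY [::] z Y' EY.
(* Stated for both orientations of the edge. From [z] along [Y] to its contact with [W'], and along
   [W'] to its end, runs a path from a neighbour of [u] and [p'] to a neighbour of [q'], as
   [no_double] forbids. *)
have claim p' q' W' : W' =i W -> ipath W' -> p' -- q' -> u != p' -> u != q' ->
    u |: [set p'; q'] = K -> {in W, forall y, q' -- y -> y = last p' W'} -> 
    q' -- last p' W' -> {in Y, forall y, ~~ (q' -- y)} -> (exists2 x, x \in X & q' -- x) ->
    p' -- z -> False.
  move=> EW' iW' pq' up' uq' EK q'W' q'l q'Y Xq' pz.
  have : w0 \in W' by rewrite EW'.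
  move=> /path.splitPr w0W'; case EW1 : W' / w0W' => [W1 W2].
  have subW' y : y \in w0 :: W2 -> y \in W.
    by move=> yW; rewrite -EW' EW1 mem_cat yW orbT.
  have hd : head p' (Y ++ w0 :: W2) = z by rewrite EY.
  have ls : last p' (Y ++ w0 :: W2) = last p' W' by rewrite last_cat EW1 last_cat.
  apply: (@no_double X u p' q' (Y ++ w0 :: W2) cX) => //; rewrite ?EK ?hd ?ls //.
  - apply: (@ipath_catE _ p) => //.
      by move: iW'; rewrite EW1 => /ipath_cat[].
    move=> a c aY /subW' cW; have [aV aW] := YV' _ aY.
    split; first by apply: contraNneq aW => ->.
    move=> ac; have aN : a \in NB Ws.
      apply/NBP; split; first by rewrite inE.
      by exists c; rewrite ?inE // sedgeC.
    have Ea : a = ys := link_Y p LY aY aN.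
    by rewrite Ea in ac *; split=> //; apply: ysO ac; rewrite !inE cW !orbT.
  - by case: (Y).
  - move=> y; rewrite mem_cat => /orP[/YV'[/VK//]|/subW'/WK//].
  - move=> y; rewrite mem_cat => /orP[yY uy|/subW' yW uy].
      by rewrite -zh; apply: (link_X _ LY); rewrite ?inE.
    by exfalso; apply: nW; exists y.
  move=> y; rewrite mem_cat => /orP[yY|/subW' yW]; last exact: q'W'.
  by rewrite (negbTE (q'Y _ yY)).
have lr d : last d (rev W) = head p W.
  by case: (W) W0 => // e s _; rewrite rev_cons last_rcons.
(* Apart from [u] and its successor on [Y], the vertex [z] has another neighbour, which can only be
   [p] or [q]. *)
have [zp|zq] : p -- z \/ q -- z.
  have : ~~ (nbh z \subset [set u; head p Y']).
    by apply: contraL bz => /card_set2; rewrite -leqNgt.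
  case/subsetPn => y; rewrite !inE negb_or => zy /andP[yu' yY'].
  case: (nbV _ zy) => [/(subsetP VA)|]; last first.
    by rewrite !inE (negbTE yu') /= => /orP[]/eqP<-; [left|right]; rewrite sedgeC.
  rewrite !inE => /orP[yY|yW].
    rewrite EY in yY iY; have [[]//|[_ h]] := @ipath_nbr _ [::] z Y' y iY yY zy.
    by rewrite h eqxx in yY'.
  case/NBP: zN; split; first by rewrite inE; apply/negP => zW; apply: nW; exists z.
  by exists y; rewrite ?inE // sedgeC.
- exfalso; apply: (claim p q W) => //; move=> y yY; apply/negP => qy.
  by apply: nYpq; [exists z | exists y].
exfalso; apply: (claim q p (rev W)) => //.
- by move=> y; rewrite mem_rev.
- exact: ipath_rev.
- by rewrite /K [[set q; p]]setUC.
- by move=> y yW; rewrite lr; exact: pW.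
- by rewrite lr.
by move=> y yY; apply/negP => py; apply: nYpq; [exists y | exists z].
Qed.
End K3.
End Apex.

(** * Contracting the branch components *)

Section BranchDef.
Variable G : sgraph.

Definition branch (x : G) := 2 < #|nbh x|.
Definition bb : rel G := [rel x y | [&& x -- y, branch x & branch y]].

Lemma bb_sym : symmetric bb.
Proof. by move=> x y; rewrite /bb /= sedge_sym [branch x && _]andbC. Qed.

Lemma bb_connect_sym : connect_sym bb.
Proof. exact/sym_connect_sym/bb_sym. Qed.

Definition rt (x : G) := root bb x.

Lemma rtP x y : reflect (rt x = rt y) (connect bb x y).
Proof. by rewrite -(root_connect bb_connect_sym); apply: eqP. Qed.

Definition quot_rel : rel G :=
  [rel x y | (x != y) && [exists x', exists y', [&& rt x' == x, rt y' == y & x' -- y']]].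

Lemma quot_sym : symmetric quot_rel.
Proof.
move=> x y; rewrite /quot_rel /= eq_sym; congr (_ && _).
by apply/existsP/existsP => -[x' /existsP[y' /and3P[h1 h2 h3]]]; exists y';
  apply/existsP; exists x'; rewrite h1 h2 sedge_sym.
Qed.

Lemma quot_irr : irreflexive quot_rel.
Proof. by move=> x; rewrite /quot_rel /= eqxx. Qed.

(* The branch components contracted; the vertices that are not chosen
   representatives of their component stay behind as isolated vertices. *)
Definition quot := SGraph quot_sym quot_irr.

Definition rtq (x : G) : quot := rt x.

Lemma quotE x y : rtq x -- rtq y =
  (rt x != rt y) && [exists x', exists y', [&& rt x' == rt x, rt y' == rt y & x' -- y']].
Proof. by []. Qed.

Lemma quot_edge x y : x -- y -> rt x = rt y \/ rtq x -- rtq y.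
Proof.
move=> xy; have [|nxy] := eqVneq (rt x) (rt y); [by left | right].
rewrite quotE nxy /=; apply/existsP; exists x; apply/existsP; exists y.
by rewrite !eqxx.
Qed.

End BranchDef.

(** * Ears, leaves and centers of the branch components *)

Section Leaves.
Variables (G : sgraph) (N : nat).
Implicit Types (A B F K U V X Y b : {set G}) (x y z p q u v w d a c : G) (P : {set {set G}}) (s S W : seq G).
Hypothesis cG : clean G.
Hypothesis N5 : 4 < N.
Hypothesis minG : forall U, bramble_in U N -> U = [set: G].

(** The side described by [apexP]: an induced path whose ends attach to the ends of the edge [pq]
    and whose inner vertex [z] alone attaches to [u]. *)
Record ear z u p q W1 W2 : Prop := Ear {
  earW : ipath (W1 ++ z :: W2);
  ear1 : W1 != [::];
  ear2 : W2 != [::];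
  earpq : p -- q;
  earup : u != p;
  earuq : u != q;
  earz : branch z;
  earu : branch u;
  earuz : u -- z;
  eardis : [disjoint [set y in W1 ++ z :: W2] & u |: [set p; q]];
  earNB : forall x y, x \in W1 ++ z :: W2 -> y \notin W1 ++ z :: W2 -> x -- y ->
            y \in u |: [set p; q];
  earuW : {in W1 ++ z :: W2, forall y, u -- y -> y = z};
  earpW : {in W1 ++ z :: W2, forall y, p -- y -> y = head p (W1 ++ z :: W2)};
  earqW : {in W1 ++ z :: W2, forall y, q -- y -> y = last q (W1 ++ z :: W2)};
  earp : p -- head p (W1 ++ z :: W2);
  earq : q -- last q (W1 ++ z :: W2) }.

Definition leaf z u := exists p q W1 W2, ear z u p q W1 W2.

(** If [K'] is empty or a single vertex, [no_cutvertex] or [two_cut_degree] contradicts the position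
    or the degree of [z]; so [K'] is an edge and [apexP] applies. *)
Lemma branch_leaf P u z K' : bramble P N -> clq K' -> u \notin K' -> bb u z ->
  (forall X, bigside P (u |: K') X -> z \notin X) -> z \notin K' -> leaf z u.
Proof.
move=> brP [sK cK] uK /and3P[uz bu bz] nX zK.
have zu : z != u by rewrite eq_sym sedge_neq.
have szK : #|u |: K'| < N.
  by rewrite cardsU1 uK; apply: leq_ltn_trans N5; rewrite add1n; slia.
have [X bX] := bigsideP brP szK; have zX := nX _ bX.
have [E0|] := eqVneq K' set0.
  by move: bX; rewrite E0 setU0 => /(no_cutvertex minG brP)/(_ zu); rewrite (negbTE zX).
case/set0Pn => p pK; have [E1|] := eqVneq (K' :\ p) set0.
  have EK : K' = [set p] by rewrite -(setD1K pK) E1 setU0.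
  rewrite EK in bX zK; have := two_cut_degree N5 minG brP bX zX zu.
  by rewrite in_set1 in zK => /(_ zK); rewrite leqNgt => /negP[].
case/set0Pn => q; rewrite !inE => /andP[qp qK].
have EK : K' = [set p; q].
  apply/esym/eqP; rewrite eqEcard subUset !sub1set pK qK /=.
  by rewrite cards2 eq_sym qp.
have pq : p -- q by apply: cK; rewrite // eq_sym.
rewrite EK in bX zK uK; move: uK; rewrite !inE negb_or => /andP[up uq].
have zK3 : z \notin u |: [set p; q] by rewrite !inE (negbTE zu) /=; move: zK; rewrite !inE.
have [W1 [W2 [iW W10 W20 [dW EW uW [pW qW]]]]] := apexP cG N5 minG brP bX zX zK3 bz pq up uq uz.
case=> ph ql; exists p, q, W1, W2; split=> //.
- rewrite -[_ (mem _) _]negbK; apply/disjointNP => -[y yW yK].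
  by apply: (disjP dW yW); rewrite inE yK orbT.
- move=> x y xW yW xy; have := in_setT y; rewrite -EW !in_setU in_set (negbTE yW) orbF.
  have [_ _ h _ _] := bX; case/orP => [yX|//]; rewrite -!in_setU.
  exfalso; apply: (disjP dW (x := x)); first by rewrite inE.
  rewrite inE; case: (boolP (x \in X)) => //= xX.
  by apply: h yX xX _; rewrite sedgeC.
Qed.

(** A hole avoiding [u] cannot contain both [x] and [v], since [u] sees both. By [star] a clique
    separates them in the graph without [u], and at least one of them is off the big side of this
    clique together with [u]. *)
Lemma two_leaves P u x v : bramble P N -> bb u x -> bb u v -> x != v -> leaf x u \/ leaf v u.
Proof.
move=> brP ux uv xv; have /and3P[ux' _ _] := ux; have /and3P[uv' _ _] := uv.
have nxv : ~~ (x -- v).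
  by apply/negP => h; apply: (cG.1 x v u) => //; rewrite sedgeC.
pose F := ~: [set u].
have xF : x \in F by rewrite !inE eq_sym sedge_neq.
have vF : v \in F by rewrite !inE eq_sym sedge_neq.
apply: contrapT => nl; suff : onhole F x v.
  move=> [z [t [H HF xH vH]]]; case/eqP: xv.
  apply: (cG.2 _ _ u _ _ H) => //; by apply/negP => /HF; rewrite !inE eqxx.
apply: (star cG xF vF xv nxv) => K KF cK xK vK; apply: contraT => nc.
have uK : u \notin K by apply/negP => /(subsetP KF); rewrite !inE eqxx.
have EF : F :\: K = ~: (u |: K).
  by apply/setP => y; rewrite !inE negb_or andbC.
case: nl; have sK : #|u |: K| < N.
  by rewrite cardsU1 uK; apply: leq_ltn_trans N5; case: cK => h _; rewrite add1n; slia.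
have [X bX] := bigsideP brP sK.
have nb y : y \notin X -> forall X', bigside P (u |: K) X' -> y \notin X'.
  move=> yX X' bX'; have [_ tb _] := brP.
  have [cX dX nX [b bP bsX] PX] := bX; have [cX' dX' nX' _ PX'] := bX'.
  have bd : [disjoint b & u |: K].
    rewrite -[_ (mem _) _]negbK; apply/disjointNP => -[y' /(subsetP bsX)].
    exact: disjP dX.
  have [y' yb] := touch_neq0 (tb _ _ bP bP).
  have yX' := subsetP (PX' _ bP bd) _ yb.
  apply: contra yX; apply: (subsetP (conn_closed cX' (subsetP bsX _ yb) yX' _)).
  move=> a c aX' cX2 aX ac; apply: contraT => cX1; exfalso.
  exact: disjP dX' cX2 (nX _ _ aX cX1 ac).
have [xX|xX] := boolP (x \in X); last first.
  by left; apply: branch_leaf brP cK uK ux (nb _ xX) xK.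
right; apply: branch_leaf brP cK uK uv _ vK; apply: nb.
apply: contra nc => vX; have [cX dX _ _ _] := bX.
apply: (subsetP (comp_max _ cX _ xX)) => //.
  by rewrite inE xK.
rewrite EF; apply/subsetP => y yX; rewrite inE; apply/negP; exact: disjP dX yX.
Qed.

(** A contact with [p] or [q] occurs only at an end of the path, where it makes up for the missing
    path neighbour. *)
Lemma ear_nonbranch z u p q W1 W2 y : ear z u p q W1 W2 ->
  y \in W1 ++ z :: W2 -> y != z -> ~~ branch y.
Proof.
move=> E yW yz; rewrite -leqNgt.
have [iW e1 e2 pq up uq bz bu uz dis nb uW pW qW ph ql] := E.
move: (W1 ++ z :: W2) yW iW dis nb uW pW qW ph ql => W yW iW dis nb uW pW qW ph ql.
have [s1 [s2 EW]] : exists s1 s2, W = s1 ++ y :: s2.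
  by case/path.splitPr: yW => s1 s2; exists s1, s2.
apply: (@card_set2 _ (last p s1) (head q s2)); apply/subsetP => w; rewrite inE => yw.
have [wW|wW] := boolP (w \in W).
  rewrite EW in wW iW; have [[_ l]|[_ l]] := ipath_nbr iW wW yw.
    by rewrite !inE l eqxx.
  by rewrite !inE l eqxx orbT.
have ys1 : ~~ (y \in s1) /\ ~~ (y \in s2).
  have := ipath_uniq iW; rewrite EW cat_uniq /= => /and3P[_ h /andP[-> _]].
  by split=> //; move: h; rewrite negb_or => /andP[].
have := nb _ _ yW wW yw; rewrite !inE => /or3P[/eqP Ew|/eqP Ew|/eqP Ew].
- by case/eqP: yz; apply: uW; rewrite // sedgeC -Ew.
- have : y = head p W by apply: pW; rewrite // sedgeC -Ew.
  rewrite EW; case: (s1) ys1 => [_ _|e s] /=; first by rewrite Ew eqxx.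
  by rewrite inE => -[/negP h _ E']; case: h; rewrite E' eqxx.
have : y = last q W by apply: qW; rewrite // sedgeC -Ew.
rewrite EW last_cat /=; case/lastP: (s2) ys1 => [_ _|s e] /=; first by rewrite Ew eqxx orbT.
by rewrite last_rcons mem_rcons inE => -[_ /negP h E']; case: h; rewrite E' eqxx.
Qed.

(** As an inner vertex of the path, [z] misses [p] and [q], and its neighbours on the path are not
    branch vertices. *)
Lemma ear_bb z u p q W1 W2 y : ear z u p q W1 W2 -> bb z y -> y = u.
Proof.
move=> E /and3P[zy _ by']; have zW : z \in W1 ++ z :: W2 by rewrite mem_cat mem_head orbT.
have [yW|yW] := boolP (y \in W1 ++ z :: W2).
  by have := ear_nonbranch E yW; rewrite eq_sym sedge_neq // by' => /(_ isT).
have U := ipath_uniq (earW E).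
have := earNB E zW yW zy; rewrite !inE => /or3P[/eqP//|/eqP Ey|/eqP Ey].
  have := earpW E zW; rewrite sedgeC -Ey => /(_ zy).
  case: (W1) (ear1 E) U => //= e s _ /andP[h _] ez; rewrite -ez mem_cat mem_head orbT in h.
  by [].
have := earqW E zW; rewrite sedgeC -Ey => /(_ zy); rewrite last_cat /=.
move: U; rewrite cat_uniq /= => /and3P[_ _ /andP[h _]] ez.
by case: (W2) (ear2 E) h ez => //= e s _ h ez; rewrite {1}ez mem_last in h.
Qed.

(** Otherwise the big side of the four vertices [z], [u], [p], [q] lies on one side of [z] on the
    path. It is then bounded by [z] and one of [p], [q], and [two_cut_degree] contradicts the degree
    of [u]. The four vertices are the reason for [4 < N]. *)
Lemma ear_bramble z u p q W1 W2 P b : bramble P N -> ear z u p q W1 W2 -> b \in P ->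
  ~~ (b \subset [set y in W1 ++ z :: W2]).
Proof.
move=> brP E bP; apply/negP => bV; have [cb tb hb] := brP.
set V := [set y in W1 ++ z :: W2] in bV.
have zW : z \in W1 ++ z :: W2 by rewrite mem_cat mem_head orbT.
pose K := u |: [set p; q].
have sS : #|z |: K| < N.
  apply: leq_ltn_trans N5; rewrite /K setUA setUC; apply: leq_trans (leq_card_setU _ _) _.
  by rewrite !cards2; do 2!case: eqP.
have [X' bX'] := bigsideP brP sS; have [cX' dX' nX' [b1 b1P b1X'] _] := bX'.
have stay x y : x \in V -> y \notin V -> x -- y -> y \in K.
  by rewrite /V [x \in _]in_set [y \in _]in_set; exact: (earNB E).
have X'K y : y \in X' -> y \notin K /\ y != z.
  move=> yX; have /negP : ~ (y \in z |: K) by move=> h; exact: disjP dX' yX h.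
  by rewrite in_setU1 negb_or => /andP[-> ->].
have [y yV yX'] : exists2 y, y \in V & y \in X'.
  have /touchP[x [y [xb yb1 xy]]] := tb _ _ bP b1P.
  have yX := subsetP b1X' _ yb1; have xV := subsetP bV _ xb.
  exists y => //; case: xy => [<-//|xy]; apply: contraT => yV.
  by have [/negP h _] := X'K _ yX; case: h; exact: stay xV yV xy.
have X'V : X' \subset V.
  apply: (conn_closed cX' yV yX') => a c aX cX aV ac; apply: contraT => cV.
  by have [/negP h _] := X'K _ cX; case: h; exact: stay aV cV ac.
have no12 a c : a \in W1 -> c \in W2 -> ~~ (a -- c).
  move=> aW cW; have := earW E.
  have [s1 [s2 ->]] : exists s1 s2, W1 = s1 ++ a :: s2.
    by case/path.splitPr: aW => s1 s2; exists s1, s2.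
  have [s3 [s4 ->]] : exists s3 s4, W2 = s3 ++ c :: s4.
    by case/path.splitPr: cW => s3 s4; exists s3, s4.
  have -> : (s1 ++ a :: s2) ++ z :: s3 ++ c :: s4 = s1 ++ a :: (s2 ++ z :: s3) ++ c :: s4.
    by rewrite -!(catA, cat_cons).
  by move/ipath_cross=> [_]; apply; case: (s2).
have U := ipath_uniq (earW E).
have spl a : a \in X' -> a \in W1 \/ a \in W2.
  move=> aX; have := subsetP X'V _ aX; have [_ az] := X'K _ aX.
  by rewrite inE mem_cat inE (negbTE az) => /orP; auto.
have outu w : bigside P [set z; w] X' -> u != w -> False.
  move=> bX uw; have uX : u \notin X'.
    by apply/negP => /X'K[]; rewrite !inE eqxx.
  have := two_cut_degree N5 minG brP bX uX _ uw; rewrite sedge_neq ?(earuz E) // => /(_ isT).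
  by rewrite leqNgt => /negP[]; exact: earu E.
have side w : w \in K -> u != w ->
   (forall a c, a \in X' -> c \in z |: K -> a -- c -> c \in [set z; w]) -> False.
  move=> wK uw hW; apply: outu uw; apply: (mk_bigside brP cX' _ _ b1P b1X'); last first.
    by move=> a c aX cX ac; apply: (hW a) => //; exact: nX' aX cX ac.
  rewrite -[_ (mem _) _]negbK; apply/disjointNP => -[a aX].
  rewrite !inE => /orP[/eqP az|/eqP aw]; first by have [_] := X'K _ aX; rewrite az eqxx.
  by have [/negP] := X'K _ aX; rewrite aw.
have in1 a : a \in W1 -> a \in W1 ++ z :: W2 by rewrite mem_cat => ->.
have in2 a : a \in W2 -> a \in W1 ++ z :: W2 by rewrite mem_cat inE => ->; rewrite !orbT.
have zW1 : z \notin W1 /\ z \notin W2.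
  by move: U; rewrite cat_uniq /= negb_or => /and3P[_ /andP[h _] /andP[? _]].
have W12 a : a \in W1 -> a \in W2 -> False.
  move: U; rewrite cat_uniq /= negb_or => /and3P[_ /andP[_ /hasPn h] _] a1 a2.
  by have := h _ a2; rewrite /= a1.
have notu a : a \in X' -> a -- u -> False.
  move=> aX au; have aV := subsetP X'V _ aX; rewrite inE in aV.
  have [_ /eqP] := X'K _ aX; apply; apply: (earuW E aV); by rewrite sedgeC.
have [yW|yW] := spl _ yX'.
  have X'1 a : a \in X' -> a \in W1.
    move=> aX; suff : X' \subset [set a in W1] by move/subsetP/(_ _ aX); rewrite inE.
    apply: (conn_closed cX' _ yX'); first by rewrite inE.
    move=> c d cX dX; rewrite !inE => cW cd; case: (spl _ dX) => // dW.
    by have := no12 _ _ cW dW; rewrite cd.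
  apply: (side p); [by rewrite !inE eqxx !orbT | exact: earup E |].
  move=> a c aX; rewrite !inE => /or4P[-> //|/eqP->|->|/eqP->] ac; rewrite ?orbT //.
    by exfalso; exact: notu aX ac.
  rewrite sedgeC in ac; have := earqW E (in1 _ (X'1 _ aX)) ac; rewrite last_cat /=.
  case: (W2) (ear2 E) W12 => //= e s _ W12 E'; exfalso.
  by apply: (W12 _ (X'1 _ aX)); rewrite E' mem_last.
have X'2 a : a \in X' -> a \in W2.
  move=> aX; suff : X' \subset [set a in W2] by move/subsetP/(_ _ aX); rewrite inE.
  apply: (conn_closed cX' _ yX'); first by rewrite inE.
  move=> c d cX dX; rewrite !inE => cW cd; case: (spl _ dX) => // dW.
  by have := no12 _ _ dW cW; rewrite sedgeC cd.
apply: (side q); [by rewrite !inE eqxx !orbT | exact: earuq E |].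
move=> a c aX; rewrite !inE => /or4P[-> //|/eqP->|/eqP->|->] ac; rewrite ?orbT //.
  by exfalso; exact: notu aX ac.
rewrite sedgeC in ac; have := earpW E (in2 _ (X'2 _ aX)) ac.
case: (W1) (ear1 E) W12 => //= e s _ W12 E'; exfalso.
by apply: (W12 _ _ (X'2 _ aX)); rewrite E' mem_head.
Qed.

(** [red] is applied with the ear itself as the set hanging on [u]: a new member meets the ear only
    if it contains [u], and outside the ear nothing changes. *)
Lemma ear_step z u p q W1 W2 P : bramble P N -> ear z u p q W1 W2 ->
  exists P', bramble P' N /\ {in P', forall b', exists2 b, b \in P &
    (z \in b' -> u \in b') /\
    (forall y, y \notin W1 ++ z :: W2 -> (y \in b') = (y \in b))}.
Proof.
move=> brP E; set V := [set y in W1 ++ z :: W2]; pose K := u |: [set p; q].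
have zV : z \in V by rewrite inE mem_cat mem_head orbT.
have [cb _ _] := brP.
have stay x y : x \in V -> y \notin V -> x -- y -> y \in K.
  by rewrite /V [x \in _]in_set [y \in _]in_set; exact: (earNB E).
pose X := ~: (V :|: K).
have inX y : (y \in X) = (y \notin V) && (y \notin K).
  by rewrite in_setC [y \in V :|: K]in_setU negb_or.
have dVK := eardis E; rewrite -/V -/K in dVK.
have uK : u \in K by rewrite !inE eqxx.
exists [set red X K V u b | b in P]; split.
  apply: red_bramble => //.
  - move=> x y; rewrite !inX negb_and !negbK => /andP[xV xK] /orP[yV|//] xy.
    by case/negP: xK; apply: stay yV xV _; rewrite sedgeC.
  - move=> b bP dbK; apply/subsetP => y yb; rewrite inX.
    apply/andP; split; last by apply/negP; exact: disjP dbK yb.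
    apply/negP => yV; have := ear_bramble brP E bP; rewrite -/V => /negP; apply.
    apply: (conn_closed (cb _ bP) yV yb) => a c _ cb' aV ac; apply: contraT => cV.
    by exfalso; exact: disjP dbK cb' (stay _ _ aV cV ac).
  - rewrite -[_ (mem _) _]negbK; apply/disjointNP => -[y yV].
    rewrite [_ \in X :|: K]in_setU inX yV /= => yK; exact: disjP dVK yV yK.
  - apply: (conn_U1 (y := z)) => //; [exact: conn_ipath (earW E) | exact: earuz E].
  - have [hin lin] : head p (W1 ++ z :: W2) \in V /\ last q (W1 ++ z :: W2) \in V.
      rewrite !inE; split; first by case: (W1) => [|? ?] /=; rewrite mem_head.
      by rewrite last_cat /= mem_cat mem_last orbT.
    move=> k; rewrite !inE => /or3P[/eqP->|/eqP->|/eqP->]; first by rewrite eqxx.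
      by exists (head p (W1 ++ z :: W2)); [rewrite in_setU hin orbT | exact: earp E].
    by exists (last q (W1 ++ z :: W2)); [rewrite in_setU lin orbT | exact: earq E].
  move=> k k'; rewrite !inE => /or3P[]/eqP-> /or3P[]/eqP->; rewrite ?eqxx // => _ _ _.
    exact: earpq E.
  by rewrite sedgeC (earpq E).
move=> _ /imsetP[b bP ->]; exists b => //.
have inr y : (y \in red X K V u b) = (y \in b) && (y \in X :|: K) || (u \in b) && (y \in V).
  by rewrite /red in_setU in_setI; case: (u \in b); rewrite ?in_set0.
have zX : z \notin X :|: K.
  rewrite [_ \in X :|: K]in_setU inX zV /=; apply/negP; exact: disjP dVK zV.
split; first by rewrite !inr (negbTE zX) andbF /= => /andP[ub _]; rewrite ub [_ \in X :|: K]in_setU uK orbT.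
move=> y yW; have yV : y \notin V by rewrite inE.
by rewrite inr (negbTE yV) andbF orbF [_ \in X :|: K]in_setU inX yV /= orNb andbT.
Qed.

(** Excludes components that are a single edge, whose ends could be leaves of each other; a hub is
    never a leaf. *)
Definition hub u := exists x v, [/\ x != v, bb u x & bb u v].

Lemma ear_uniq z u u' : leaf z u -> leaf z u' -> u = u'.
Proof.
move=> [p [q [W1 [W2 E]]]] [p' [q' [W1' [W2' E']]]].
apply/esym/(ear_bb E); apply/and3P; split.
- by rewrite sedgeC (earuz E').
- exact: earz E.
exact: earu E'.
Qed.

(** The ears are treated one by one. Treating [z] changes nothing for another leaf or its hub: both
    are branch vertices other than [z], hence off the ear. The hub differs from [z] because it has
    two branch neighbours and [z] has one. *)
Lemma adapted_bramble P s : bramble P N -> exists2 P', bramble P' N &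
  {in s, forall z u, leaf z u -> hub u -> {in P', forall b, z \in b -> u \in b}}.
Proof.
move=> brP; elim: s => [|z s [P1 brP1 IH]]; first by exists P.
have [[u [[p [q [W1 [W2 E]]]] hu]]|nl] := pselect (exists u, leaf z u /\ hub u); last first.
  exists P1 => // z' z's u' l' h'; apply: IH => //.
  by move: z's; rewrite inE => /orP[/eqP Ez|//]; case: nl; exists u'; rewrite -Ez.
have [P2 [brP2 h2]] := ear_step brP1 E; exists P2 => // z' z's u' l' h' b' b'P z'b'.
have [b bP [zu out]] := h2 _ b'P.
have [Ez|nz] := eqVneq z' z.
  rewrite Ez in z'b' l'; have -> : u' = u; last exact: zu.
  by apply: ear_uniq l' _; exists p, q, W1, W2.
have z's' : z' \in s by move: z's; rewrite inE (negbTE nz).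
have [bz' bu'] : branch z' /\ branch u'.
  by case: l' => p' [q' [V1 [V2 E']]]; split; [exact: earz E' | exact: earu E'].
have z'W : z' \notin W1 ++ z :: W2.
  by apply: contraL bz' => h; exact: ear_nonbranch E h nz.
have u'W : u' \notin W1 ++ z :: W2.
  apply: contraL bu' => h; have [Eu|nu] := eqVneq u' z; last exact: ear_nonbranch E h nu.
  case: h' => x [v [xv ux uv]]; rewrite Eu in ux uv.
  by move: xv; rewrite (ear_bb E ux) (ear_bb E uv) eqxx.
rewrite out // in z'b'; rewrite out //; exact: IH z'b'.
Qed.

(** By [two_leaves] a vertex has at most one branch neighbour that is not a leaf of it. So a
    component with a hub [u] is a star around [u], or a double star with centers [u] and its
    exceptional neighbour; without a hub it has at most two vertices. *)
Lemma centers P r : bramble P N -> exists2 C : {set G}, #|C| <= 2 &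
  forall y, connect (@bb G) r y -> y \in C \/ exists2 u, u \in C & leaf y u /\ hub u.
Proof.
move=> brP.
have walk (D : G -> Prop) x y : connect (@bb G) x y -> D x -> (forall a c, D a -> bb a c -> D c) -> D y.
  move=> /connectP[p]; elim: p x => [|c p IH] x /= => [_ -> //|/andP[xc pp] Ey Dx cl].
  exact: IH pp Ey (cl _ _ Dx xc) cl.
have leaf_bb y u w : leaf y u -> bb y w -> w = u.
  by case=> p [q [W1 [W2 E]]]; exact: ear_bb E.
have leafI a y : leaf a y -> bb y a.
  case=> p [q [W1 [W2 E]]]; apply/and3P; split; [exact: earuz E | exact: earu E | exact: earz E].
have [[u [ru hu]]|nh] := pselect (exists u, connect (@bb G) r u /\ hub u); last first.
  have [[y ry]|nb] := pselect (exists y, bb r y).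
    exists [set r; y]; first by rewrite cards2; case: eqP.
    move=> w rw; left; apply: (walk (fun w => w \in [set r; y]) r w rw) => [|a c].
      by rewrite !inE eqxx.
    rewrite !inE => /orP[/eqP->|/eqP->] cc; apply: contraT; rewrite negb_or => /andP[cr cy].
      by case: nh; exists r; split; [exact: connect0 | exists c, y].
    case: nh; exists y; split; first exact: connect1.
    by exists c, r; split=> //; rewrite bb_sym.
  exists [set r]; first by rewrite cards1.
  move=> w rw; left; apply: (walk (fun w => w \in [set r]) r w rw) => [|a c].
    by rewrite inE.
  by rewrite !inE => /eqP-> rc; case: nb; exists c.
have ur : connect (@bb G) u r by rewrite bb_connect_sym.
have [[v0 [uv0 nl]]|al] := pselect (exists v0, bb u v0 /\ ~ leaf v0 u); last first.
  exists [set u]; first by rewrite cards1.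
  move=> y ry; suff [->|ly] : y = u \/ leaf y u.
  - by left; rewrite inE.
  - by right; exists u; rewrite ?inE.
  apply: (walk (fun y => y = u \/ leaf y u) u y) => [||a c]; [exact: connect_trans ur ry | by left |].
  move=> [->|la] ac; first by right; apply: contrapT => nl; apply: al; exists c.
  by left; exact: leaf_bb la ac.
exists [set u; v0]; first by rewrite cards2; case: eqP.
move=> y ry; suff [h|[l|[l h]]] : y \in [set u; v0] \/ leaf y u \/ (leaf y v0 /\ hub v0).
- by left.
- by right; exists u; rewrite ?inE ?eqxx.
- by right; exists v0; rewrite ?inE ?eqxx ?orbT.
apply: (walk (fun y => y \in [set u; v0] \/ leaf y u \/ (leaf y v0 /\ hub v0)) u y).
- exact: connect_trans ur ry.
- by left; rewrite !inE eqxx.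
move=> a c [aS|[la|[la ha]]] ac.
- move: aS; rewrite in_set2 => /orP[/eqP Ea|/eqP Ea]; rewrite Ea in ac.
    have [->|cv] := eqVneq c v0; first by left; rewrite !inE eqxx orbT.
    by right; left; case: (two_leaves brP ac uv0 cv).
  have [->|cu] := eqVneq c u; first by left; rewrite !inE eqxx.
  right; right; have v0u : bb v0 u by rewrite bb_sym.
  split; last by exists c, u.
  case: (two_leaves brP ac v0u cu) => // lu.
  case: hu => x [v [xv ux uv]]; move: xv.
  by rewrite (leaf_bb _ _ _ lu ux) (leaf_bb _ _ _ lu uv) eqxx.
- by left; rewrite (leaf_bb _ _ _ la ac) !inE eqxx.
by left; rewrite (leaf_bb _ _ _ la ac) !inE eqxx orbT.
Qed.

(** Each element of a hitting set in the contracted graph is lifted to the at most two centers of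
    its component. This doubles the size and still hits: an adapted member that meets a component
    contains one of its centers. *)
Lemma quot_bramble P M : bramble P N -> M.*2 <= N ->
  exists PQ : {set {set quot G}}, bramble PQ M.
Proof.
move=> brP MN; have [P1 brP1 ad] := adapted_bramble (enum G) brP.
have [cb tb hb] := brP1.
exists [set (@rtq G) @: b | b : {set G} in P1]; split.
- move=> _ /imsetP[b bP ->]; apply: connI => B x0 y0 BS xB /imsetP[y yb ->] cl.
  have /imsetP[x xb Ex] := subsetP BS _ xB; rewrite Ex in xB.
  have : b \subset [set w in b | rtq w \in B].
    apply: (conn_closed (cb _ bP) _ xb); first by rewrite inE xb.
    move=> a c ab cb'; rewrite !inE => /andP[_ aB] ac; rewrite cb' /=.
    have [E|ac'] := quot_edge ac; first by rewrite /rtq -E.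
    by apply: (cl _ _ aB) => //; exact: imset_f.
  by move/subsetP/(_ _ yb); rewrite inE => /andP[].
- move=> _ _ /imsetP[b bP ->] /imsetP[b' bP' ->].
  have /touchP[x [y [xb yb xy]]] := tb _ _ bP bP'.
  apply/touchP; exists (rtq x), (rtq y); split; [exact: imset_f | exact: imset_f |].
  by case: xy => [->|/quot_edge[]]; [left | left | right].
move=> Y sY; have /choice[C hC] : forall r : G, exists C : {set G}, #|C| <= 2 /\
  forall y, connect (@bb G) r y -> y \in C \/ exists2 u, u \in C & leaf y u /\ hub u.
  by move=> r; have [C h1 h2] := centers r brP; exists C.
pose S := \bigcup_(r in Y) C r.
have sS : #|S| < N.
  apply: leq_trans MN; apply: leq_ltn_trans (_ : #|Y|.*2 < _); last by rewrite ltn_double.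
  apply: (leq_trans (n := \sum_(r in Y) 2)); last by rewrite sum_nat_const muln2.
  rewrite /S; elim/big_rec2: _ => [|r m A _ le]; first by rewrite cards0.
  by apply: leq_trans (leq_card_setU _ _) _; rewrite leq_add //; case: (hC r).
have [b bP dbS] := hb _ sS; exists ((@rtq G) @: b); first exact: imset_f.
rewrite -[_ (mem _) _]negbK; apply/disjointNP => -[r /imsetP[y yb Er] rY].
have [_ /(_ y)] := hC r; case.
- by apply/rtP; rewrite Er; apply/esym/rtP; exact: connect_root.
- move=> yC; apply: (disjP dbS yb); apply/bigcupP; by exists r.
move=> [u uC [l h]]; apply: (disjP (x := u) dbS); last by apply/bigcupP; exists r.
by apply: (ad y) => //; rewrite mem_enum.
Qed.

End Leaves.

(** * Menger's theorem *)

Section Menger.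
Variable T : finType.
Implicit Types (E : {set T * T}) (A B C S : {set T}) (x y z w v t : T) (s : seq T).

(** Menger's theorem is proved for directed arcs because it is applied below to the oriented paths
    of a linkage with one arc deleted. *)
Definition arc E : rel T := [rel x y | (x, y) \in E].

Definition apath E A B s :=
  if s is x :: p then [&& path (arc E) x p, uniq s, x \in A & last x p \in B] else false.

Definition linkage E A B n (P : 'I_n -> seq T) :=
  (forall i, apath E A B (P i)) /\ (forall i j x, x \in P i -> x \in P j -> i = j).

Definition separates E A B S := forall s, apath E A B s -> exists2 x, x \in s & x \in S.

Lemma apath_sub E A B x p : path (arc E) x p -> x \in A -> last x p \in B ->
  exists2 s, apath E A B s & {subset s <= x :: p}.
Proof.
move=> pp xA; case/shortenP: pp => p' pp' up' sub lB.
exists (x :: p'); first by rewrite /apath pp' up' xA lB.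
by move=> y; rewrite !inE => /orP[->//|/sub->]; rewrite orbT.
Qed.

Lemma apath_mono E E' A B s : apath E A B s ->
  (forall s1 a b s2, s = s1 ++ a :: b :: s2 -> (a, b) \in E -> (a, b) \in E') -> apath E' A B s.
Proof.
case: s => // x p /and4P[pp h1 h2 h3] h; apply/and4P; split=> //.
clear h1 h2 h3; elim: p x pp h => //= y p IH x /andP[xy pp] h.
rewrite /arc /= (h [::] x y p) //=; apply: IH => // s1 a b s2 E0; apply: (h (x :: s1)).
by rewrite E0.
Qed.

Lemma apathP E A B s x0 : apath E A B s ->
  [/\ s != [::], sorted (arc E) s, uniq s, head x0 s \in A & last x0 s \in B].
Proof. by case: s => // x p /and4P[? ? ? ?]. Qed.

Lemma apathI E A B s x0 : s != [::] -> sorted (arc E) s -> uniq s -> head x0 s \in A ->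
  last x0 s \in B -> apath E A B s.
Proof. by case: s => // x p _ h1 h2 h3 h4; apply/and4P. Qed.

Lemma apath_prefix E A B C s1 v s2 : apath E A B (s1 ++ v :: s2) -> v \in C ->
  apath E A C (rcons s1 v).
Proof.
move=> /(@apathP _ _ _ _ v)[_ sr un hA _] vC; apply: (@apathI _ _ _ _ v).
- by case: (s1).
- by move: sr; rewrite sorted_split => /andP[].
- by move: un; rewrite -cat_rcons cat_uniq => /and3P[].
- by case: (s1) hA.
- by rewrite last_rcons.
Qed.

Lemma apath_suffix E A B C s1 v s2 : apath E A B (s1 ++ v :: s2) -> v \in C ->
  apath E C B (v :: s2).
Proof.
move=> /(@apathP _ _ _ _ v)[_ sr un _ lB] vC; apply: (@apathI _ _ _ _ v) => //.
- by move: sr; rewrite sorted_split => /andP[].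
- by move: un; rewrite cat_uniq => /and3P[].
- by move: lB; rewrite last_cat.
Qed.

Lemma linkage_hit E A B S n (P : 'I_n -> seq T) x0 : linkage E A B P ->
  (forall i, last x0 (P i) \in S) -> #|S| <= n -> {in S, forall t, exists i, last x0 (P i) = t}.
Proof.
move=> [ap dj] hS Sn t tS.
have inj : injective (fun i => last x0 (P i)).
  move=> i j E0; apply: (dj _ _ (last x0 (P i))).
    by have [] := apathP x0 (ap i); case: (P i) => //= a p _ _ _ _ _; exact: mem_last.
  by rewrite E0; have [] := apathP x0 (ap j); case: (P j) => //= a p _ _ _ _ _; exact: mem_last.
have sub : (fun i => last x0 (P i)) @: [set: 'I_n] \subset S.
  by apply/subsetP => _ /imsetP[i _ ->].
have /eqP EQ : (fun i => last x0 (P i)) @: [set: 'I_n] == S.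
  by rewrite eqEcard sub card_imset // cardsT card_ord.
by move: tS; rewrite -EQ => /imsetP[i _ ->]; exists i.
Qed.

Lemma linkage_hit_head E A B S n (P : 'I_n -> seq T) x0 : linkage E A B P ->
  (forall i, head x0 (P i) \in S) -> #|S| <= n -> {in S, forall t, exists i, head x0 (P i) = t}.
Proof.
move=> [ap dj] hS Sn t tS.
have inj : injective (fun i => head x0 (P i)).
  move=> i j E0; apply: (dj _ _ (head x0 (P i))).
    by have [] := apathP x0 (ap i); case: (P i) => //= a p _ _ _ _ _; exact: mem_head.
  by rewrite E0; have [] := apathP x0 (ap j); case: (P j) => //= a p _ _ _ _ _; exact: mem_head.
have sub : (fun i => head x0 (P i)) @: [set: 'I_n] \subset S.
  by apply/subsetP => _ /imsetP[i _ ->].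
have /eqP EQ : (fun i => head x0 (P i)) @: [set: 'I_n] == S.
  by rewrite eqEcard sub card_imset // cardsT card_ord.
by move: tS; rewrite -EQ => /imsetP[i _ ->]; exists i.
Qed.

(** Induction on the number of arcs. If without the arc [(x, y)] a set [S] of fewer than [n]
    vertices separates, then [x |: S] and [y |: S] separate in the whole and have exactly [n]
    vertices. By induction [A] is linked to the first and the second to [B] without the arc; the
    linkages are joined in [S] and along the arc. *)
Theorem menger E A B n : (forall S, separates E A B S -> n <= #|S|) ->
  exists P : 'I_n -> seq T, linkage E A B P.
Proof.
have [m] := ubnP #|E|; elim: m E A B => // m IH E A B Em sep.
have [E0|] := eqVneq E set0.
  have le : n <= #|A :&: B|.
    apply: sep => -[|x [|y p]] //=; first by move=> /andP[xA xB]; exists x; rewrite ?inE ?xA ?eqxx.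
    by rewrite /arc /= E0 inE.
  exists (fun i => take 1 (drop i (enum (A :&: B)))).
  have tk (i : 'I_n) : exists2 x, x \in A :&: B & take 1 (drop i (enum (A :&: B))) = [:: x] /\ index x (enum (A :&: B)) = i.
    have lt : i < size (enum (A :&: B)) by rewrite -cardE; apply: leq_trans le.
    have [x0 _] : exists x0 : T, True by case: (enum _) lt => [|x0] //; exists x0.
    exists (nth x0 (enum (A :&: B)) i); first by rewrite -mem_enum mem_nth.
    by rewrite (drop_nth x0 lt) /= take0 index_uniq ?enum_uniq.
  split=> [i|i j x].
    by have [x xAB [-> _]] := tk i; move: xAB; rewrite inE /= => /andP[-> ->].
  have [x1 _ [-> i1]] := tk i; have [x2 _ [-> i2]] := tk j.
  by rewrite !inE => /eqP E1 /eqP E2; apply: ord_inj; rewrite -i1 -i2 -E1 E2.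
case/set0Pn => -[x y] xyE; pose E' := E :\ (x, y).
have E'm : #|E'| < m.
  by move: Em; rewrite (cardsD1 (x, y) E) xyE add1n ltnS.
have E'E a b : (a, b) \in E' -> (a, b) \in E by rewrite in_setD1 => /andP[].
have EE' a b : (a, b) \in E -> (a, b) != (x, y) -> (a, b) \in E' by move=> h1 h2; rewrite in_setD1 h2.
have [sep'|] := pselect (forall S, separates E' A B S -> n <= #|S|).
  have [P [ap dj]] := IH E' A B E'm sep'; exists P; split=> // i.
  by apply: apath_mono (ap i) _ => s1 a b s2 _; exact: E'E.
move/existsNP => [S] /not_implyP[sS /negP]; rewrite -ltnNge => Sn.
have nox s A' B' : apath E A' B' s -> x \notin s -> apath E' A' B' s.
  move=> ap xs; apply: apath_mono ap _ => s1 a b s2 Es /EE'; apply.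
  by apply: contraNneq xs => -[<- _]; rewrite Es mem_cat mem_head orbT.
have noy s A' B' : apath E A' B' s -> y \notin s -> apath E' A' B' s.
  move=> ap xs; apply: apath_mono ap _ => s1 a b s2 Es /EE'; apply.
  by apply: contraNneq xs => -[_ <-]; rewrite Es mem_cat !inE eqxx !orbT.
have sepS1 : separates E A B (x |: S).
  move=> s ap; have [xs|xs] := boolP (x \in s); first by exists x; rewrite ?inE ?eqxx.
  by have [w ws wS] := sS _ (nox _ _ _ ap xs); exists w; rewrite // inE wS orbT.
have sepS2 : separates E A B (y |: S).
  move=> s ap; have [xs|xs] := boolP (y \in s); first by exists y; rewrite ?inE ?eqxx.
  by have [w ws wS] := sS _ (noy _ _ _ ap xs); exists w; rewrite // inE wS orbT.
have [S1 S2] := (sep _ sepS1, sep _ sepS2).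
have xS : x \notin S by apply: contraTN S1 => h; rewrite cardsU1 h add0n -ltnNge.
have yS : y \notin S by apply: contraTN S2 => h; rewrite cardsU1 h add0n -ltnNge.
have cS1 : #|x |: S| <= n by rewrite cardsU1 xS.
have cS2 : #|y |: S| <= n by rewrite cardsU1 yS.
have [P lP] : exists P : 'I_n -> seq T, linkage E' A (x |: S) P.
  apply: IH => // S'' sS''; apply: sep => s ap.
  have [w ws wS1] := sepS1 _ ap.
  have : has (mem (x |: S)) s by apply/hasP; exists w.
  case/first_split => s1 [v [s2 [Es vS ns1]]]; rewrite Es in ap.
  have ap' : apath E' A (x |: S) (rcons s1 v).
    apply: apath_mono (apath_prefix ap vS) _ => t1 a b t2 Et /EE'; apply.
    apply: contra ns1 => /eqP[Ea _]; apply/hasP; exists a; last by rewrite /= Ea !inE eqxx.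
    case/lastP: t2 Et => [|t2 e]; first by rewrite -[[:: a; b]]/(rcons [:: a] b) -rcons_cat => /rcons_inj[-> _]; rewrite mem_cat mem_head orbT.
    by rewrite -!rcons_cons -rcons_cat => /rcons_inj[-> _]; rewrite mem_cat mem_head orbT.
  have [c cs cS] := sS'' _ ap'; exists c => //; move: cs; rewrite Es mem_rcons mem_cat !inE.
  by case/orP => ->; rewrite ?orbT.
have [Q lQ] : exists Q : 'I_n -> seq T, linkage E' (y |: S) B Q.
  apply: IH => // S'' sS''; apply: sep => s ap.
  have [w ws wS1] := sepS2 _ ap.
  have : has (mem (y |: S)) s by apply/hasP; exists w.
  case/last_split => s1 [v [s2 [Es vS ns2]]]; rewrite Es in ap.
  have ap' : apath E' (y |: S) B (v :: s2).
    apply: apath_mono (apath_suffix ap vS) _ => t1 a b t2 Et /EE'; apply.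
    apply: contra ns2 => /eqP[_ Eb]; apply/hasP; exists b; last by rewrite /= Eb !inE eqxx.
    case: t1 Et => [[_ ->]|c t1 [_ ->]]; first exact: mem_head.
    by rewrite mem_cat !inE eqxx !orbT.
  have [c cs cS] := sS'' _ ap'; exists c => //; by rewrite Es mem_cat cs orbT.
have [apP djP] := lP; have [apQ djQ] := lQ.
have lstP i : last x (P i) \in x |: S by have [] := apathP x (apP i).
have headQ i : head x (Q i) \in y |: S by have [] := apathP x (apQ i).
have hitP := linkage_hit lP lstP cS1; have hitQ := linkage_hit_head lQ headQ cS2.
have lin i : last x (P i) \in P i.
  by have [] := apathP x (apP i); case: (P i) => //= a p _ _ _ _ _; exact: mem_last.
have hin i : head x (Q i) \in Q i.
  by have [] := apathP x (apQ i); case: (Q i) => //= a p _ _ _ _ _; exact: mem_head.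
(* A path ending in [t] is continued from [tau t]: from [t] itself in [S], and across the deleted
   arc from [x]. *)
pose tau t := if t == x then y else t.
have tauS t : t \in x |: S -> tau t \in y |: S.
  by rewrite /tau !inE; case: eqP => //= _; rewrite ?eqxx // => ->; rewrite orbT.
have /choice[sg hsg] : forall i, exists j, head x (Q j) = tau (last x (P i)).
  by move=> i; apply: hitQ; apply: tauS.
(* At a common vertex one can change from a first path to a second one. The result avoids the arc,
   so it meets [S], and it can do so only where both paths have their ends. *)
have cross i j z : z \in P i -> z \in Q j -> [/\ z \in S, z = last x (P i) & z = head x (Q j)].
  move=> zP zQ.
  have [a1 [a2 Ea]] : exists a1 a2, P i = a1 ++ z :: a2 by case/path.splitPr: zP => a b; exists a, b.
  have [b1 [b2 Eb]] : exists a1 a2, Q j = a1 ++ z :: a2 by case/path.splitPr: zQ => a b; exists a, b.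
  have [_ srP uP hP _] := apathP x (apP i); have [_ srQ uQ _ lQ'] := apathP x (apQ j).
  rewrite Ea in srP uP hP; rewrite Eb in srQ uQ lQ'.
  have [s aps sub] : exists2 s, apath E' A B s & {subset s <= a1 ++ z :: b2}.
    have pth : sorted (arc E') (a1 ++ z :: b2).
      by move: srP srQ; rewrite !sorted_split => /andP[-> _] /andP[_ ->].
    have hA : head x (a1 ++ z :: b2) \in A by case: (a1) hP.
    have lB : last x (a1 ++ z :: b2) \in B by move: lQ'; rewrite !last_cat.
    have ne : a1 ++ z :: b2 != [::] by case: (a1).
    by case: (a1 ++ z :: b2) ne pth hA lB => // c r _; exact: apath_sub.
  have [w ws wS] := sS _ aps; have := sub _ ws.
  have zl : z \in S -> z = last x (P i).
    move=> zS; have [|k Ek] := hitP z; first by rewrite inE zS orbT.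
    by rewrite -[in LHS]Ek; congr (last x (P _)); apply: (djP _ _ z) => //; rewrite -Ek.
  have zh : z \in S -> z = head x (Q j).
    move=> zS; have [|k Ek] := hitQ z; first by rewrite inE zS orbT.
    by rewrite -[in LHS]Ek; congr (head x (Q _)); apply: (djQ _ _ z) => //; rewrite -Ek.
  suff : w = z -> [/\ z \in S, z = last x (P i) & z = head x (Q j)].
    move=> h; rewrite mem_cat inE => /or3P[wa|/eqP//|wb]; apply: h.
      have [|k Ek] := hitP w; first by rewrite inE wS orbT.
      have ki : k = i by apply: (djP _ _ w); [rewrite -Ek | rewrite Ea mem_cat wa].
      rewrite ki Ea last_cat /= in Ek; move: uP; rewrite cat_uniq => /and3P[_ /hasPn h _].
      by have := h w; rewrite -{1}Ek mem_last /= wa => /(_ isT).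
    have [|k Ek] := hitQ w; first by rewrite inE wS orbT.
    have kj : k = j by apply: (djQ _ _ w); [rewrite -Ek | rewrite Eb mem_cat inE wb !orbT].
    rewrite kj Eb in Ek; move: uQ; rewrite cat_uniq /= => /and3P[_ /norP[zb1 /hasPn h] /andP[zb2 _]].
    case: (b1) Ek h => [/=->//|c r /= Ek h].
    by have := h w wb; rewrite Ek mem_head.
  by move=> wz; rewrite wz in wS; rewrite wS -zl -?zh.
have tau_inj t1 t2 : t1 \in x |: S -> t2 \in x |: S -> tau t1 = tau t2 -> t1 = t2.
  rewrite /tau !in_setU1; case: eqP => [->|n1]; case: eqP => [->|n2] //= h1 h2 E0.
    by rewrite -E0 (negbTE yS) in h2.
  by rewrite E0 (negbTE yS) in h1.
have sg_inj i k : sg i = sg k -> i = k.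
  move=> Esg; have := hsg i; rewrite Esg hsg => Et.
  apply: (djP _ _ (last x (P i))) => //.
  by rewrite (tau_inj _ _ (lstP i) (lstP k)).
pose R i := if last x (P i) == x then P i ++ Q (sg i) else P i ++ behead (Q (sg i)).
have Rsub i z : z \in R i -> z \in P i \/ z \in Q (sg i).
  rewrite /R; case: ifP => _; rewrite mem_cat => /orP[]; auto.
  by move=> /mem_behead; auto.
exists R; split=> [i|i k z /Rsub zi /Rsub zk]; last first.
  have mix a c : z \in P a -> z \in Q (sg c) -> a = c.
    move=> za zc; have [zS zl zh] := cross _ _ _ za zc; apply: sg_inj.
    apply: (djQ _ _ z) => //; have <- : head x (Q (sg a)) = z; last exact: hin.
    rewrite hsg -zl /tau; case: eqP => // Ez; by rewrite Ez (negbTE xS) in zS.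
  case: zi zk => [zi|zi] [zk|zk]; [exact: djP zi zk | exact: mix | by apply/esym; exact: mix |].
  by apply: sg_inj; exact: djQ zi zk.
have [P0 srP uP hP _] := apathP x (apP i); have [Q0 srQ uQ _ lQ'] := apathP x (apQ (sg i)).
have mono (s : seq T) : sorted (arc E') s -> sorted (arc E) s.
  by apply: sub_sorted => a b; exact: E'E.
rewrite /R; case: eqP => Ex.
  apply: (@apathI _ _ _ _ x).
  - by case: (P i) P0.
  - have := hsg i; rewrite /tau Ex eqxx => Ey.
    case EQ : (Q (sg i)) Q0 Ey srQ => [|c q] // _ /= Ec pq.
    rewrite sorted_split; apply/andP; split; last exact: (mono (c :: q)).
    case/lastP: (P i) P0 Ex srP => // p a _; rewrite last_rcons => -> srP.
    by rewrite -cats1 cat_rcons sorted_split mono //= andbT Ec.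
  - rewrite cat_uniq uP uQ /= andbT; apply/hasPn => z zQ; apply/negP => zP.
    by have [zS zl _] := cross _ _ _ zP zQ; rewrite -Ex -zl zS in xS.
  - by case: (P i) P0 hP.
  - by rewrite last_cat; case: (Q (sg i)) Q0 lQ'.
have := hsg i; rewrite /tau; case: eqP => // _ Eh.
case EQ : (Q (sg i)) Q0 Eh srQ uQ lQ' => [|c q] //= _ Ec pq /andP[cq uq] lB.
apply: (@apathI _ _ _ _ x).
- by case: (P i) P0.
- case/lastP: (P i) P0 Ec srP => // p a _; rewrite last_rcons => <- srP.
  rewrite cat_rcons sorted_split mono //=; exact: (mono (c :: q)).
- rewrite cat_uniq uP uq /= andbT; apply/hasPn => z zQ; apply/negP => zP.
  have [|_ _ /= zc] := cross i (sg i) z zP; first by rewrite EQ inE zQ orbT.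
  rewrite EQ /= in zc.
  by rewrite -zc zQ in cq.
- by case: (P i) P0 hP.
- by rewrite last_cat -Ec.
Qed.

End Menger.

(** * Meshes *)

Section Arcs.
Variable G : sgraph.
Implicit Types (A B C D K R S X : {set G}) (x y z : G) (p s : seq G).

Definition arcs R : {set G * G} := [set e | [&& e.1 -- e.2, e.1 \in R & e.2 \in R]].

Lemma arcsE R x y : arc (arcs R) x y = rin R x y.
Proof. by rewrite /arc /= inE. Qed.

Lemma path_arcs R S x p : R \subset S -> path (rin R) x p -> path (arc (arcs S)) x p.
Proof.
move=> RS; apply: sub_path => a b; rewrite arcsE => /and3P[ab aR bR].
by rewrite /rin /= ab !(subsetP RS).
Qed.

Lemma path_rin_sub R x p : path (rin R) x p -> x \in R -> {subset x :: p <= R}.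
Proof.
elim: p x => [|y p IH] x /= => [_ xR z|/andP[/and3P[_ _ yR] pp] xR z].
  by rewrite inE => /eqP->.
by rewrite inE => /orP[/eqP->//|]; apply: IH.
Qed.

Lemma connect_apath R S A B x y : connect (rin R) x y -> x \in R -> R \subset S ->
  x \in A -> y \in B -> exists2 s, apath (arcs S) A B s & {subset s <= R}.
Proof.
move=> /connectP[p pp ->] xR RS xA yB.
have [s aps sub] := apath_sub (path_arcs RS pp) xA yB.
by exists s => // z /sub; apply: path_rin_sub.
Qed.

Lemma apath_conn R A B s : apath (arcs R) A B s -> conn [set x in s].
Proof.
case: s => // x p /and4P[pp _ _ _]; apply: conn_sorted => /=.
by apply: sub_path pp => a b; rewrite arcsE => /and3P[].
Qed.

Lemma apath_in R A B s : apath (arcs R) A B s -> A \subset R -> {subset s <= R}.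
Proof.
case: s => // x p /and4P[pp _ xA _] AR; apply: path_rin_sub; last exact: (subsetP AR).
by apply: sub_path pp => a b; rewrite arcsE.
Qed.

End Arcs.

Section Mesh.
Variables (G : sgraph) (P : {set {set G}}) (N : nat) (I : finType).
Implicit Types (A B C D K L R S X : {set G}) (x y z : G) (s : seq G) (T : I -> {set G}) (c : I -> nat).
Hypothesis brP : bramble P N.

Definition big K := conn K /\ exists2 b, b \in P & b \subset K.

(** The disjoint connected sets [T g] share out the boundary of [K] in the proportions [c].
    Tightness makes this boundary well linked through [K]. *)
Record mesh K T c : Prop := Mesh {
  mesh_big : big K;
  mesh_conn : forall g, conn (T g);
  mesh_dis : forall g h x, x \in T g -> x \in T h -> g = h;
  mesh_K : forall g x, x \in T g -> x \in K -> False;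
  mesh_cov : forall x, x \in NB K -> exists g, x \in T g;
  mesh_c : forall g, #|NB K :&: T g| = c g;
  mesh_w : #|NB K| = \sum_g c g;
  mesh_tight : forall K', K' \subset K -> big K' -> #|NB K| <= #|NB K'| }.

Lemma big_bigside K b : big K -> #|NB K| < N ->
  b \in P -> [disjoint b & NB K] -> b \subset K.
Proof.
move=> [cK [b0 b0P b0K]] sK bP dis.
have [_ tb _] := brP; have [cb _ _] := brP.
have /touchP[x [y [xb yb0 xy]]] := tb _ _ bP b0P.
have stay u v : u \in K -> v \in b -> u -- v -> v \in K.
  move=> uK vb uv; apply: contraT => vK; exfalso; apply: (disjP dis vb).
  by apply/NBP; split=> //; exists u.
have yK := subsetP b0K _ yb0.
have xK : x \in K.
  by case: xy => [->//|xy]; apply: stay yK xb _; rewrite sedgeC.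
by apply: (conn_closed (cb _ bP) xK xb) => u v _ vb uX; exact: stay.
Qed.

Lemma big_sub K X : big K -> #|X| < N -> NB K \subset X ->
  exists K', [/\ K' \subset K, big K', [disjoint K' & X] & NB K' \subset X].
Proof.
move=> bK sX sub; have [K' [cK' dK' nK' [b bP bK'] _]] := bigsideP brP sX.
have [_ tb _] := brP; have [x xb] := touch_neq0 (tb _ _ bP bP).
have sbK : b \subset K.
  apply: (big_bigside bK) => //; first exact: leq_ltn_trans (subset_leq_card sub) sX.
  rewrite -[_ (mem _) _]negbK; apply/disjointNP => -[y /(subsetP bK') yb /(subsetP sub)].
  exact: disjP dK' yb.
exists K'; split=> //.
- apply: (conn_closed cK' (subsetP sbK _ xb) (subsetP bK' _ xb)) => a e aK eK aK' ae.
  apply: contraT => eK'; exfalso; apply: (disjP dK' eK); apply: (subsetP sub).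
  by apply/NBP; split=> //; exists a.
- by split=> //; exists b.
apply/subsetP => y /NBP[yK [z zK zy]]; exact: nK' zK yK zy.
Qed.

(* By tightness the boundary of a mesh is linked to the boundary of any smaller side
   of the same order. *)
Lemma tight_link K K' n : big K -> #|NB K| = n -> n < N ->
  (forall L, L \subset K -> big L -> n <= #|NB L|) -> K' \subset K -> big K' ->
  exists Q : 'I_n -> seq G, linkage (arcs ((K :|: NB K) :\: K')) (NB K) (NB K') Q.
Proof.
move=> bK wK nN tight K'K bK'; apply: menger => S sepS; rewrite leqNgt; apply/negP => Sn.
have [cK' [b1 b1P b1K']] := bK'.
have [_ tb _] := brP; have [k1 k1b] := touch_neq0 (tb _ _ b1P b1P).
have k1K' := subsetP b1K' _ k1b; have k1K := subsetP K'K _ k1K'.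
(* The part of [K] around [K'] that [S] leaves over would be a big set with a boundary smaller than
   tightness allows. *)
pose S' := S :\: K'; pose L := comp (K :\: S') k1.
have k1S : k1 \in K :\: S' by rewrite !inE k1K' k1K.
have cL : conn L := conn_comp k1S.
have LS a : a \in L -> a \in K /\ a \notin S'.
  by move/(subsetP (comp_sub k1S)); rewrite inE => /andP[].
have K'L : K' \subset L.
  apply: comp_max => //; apply/subsetP => a aK'.
  by rewrite in_setD (subsetP K'K) // andbT /S' in_setD aK'.
have bL : big L by split=> //; exists b1 => //; apply: subset_trans K'L.
have LK : L \subset K by apply/subsetP => a /LS[].
have NL : NB L \subset S'.
  apply/subsetP => x xNL; have /NBP[xL [k kL kx]] := xNL; apply: contraT => xS'.
  have xK : x \notin K.
    by apply: contra xL => xK; apply: comp_closed kx => //; rewrite in_setD xS' xK.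
  have xN : x \in NB K by apply/NBP; split=> //; exists k => //; exact: (subsetP LK).
  have xK' : x \notin K' by apply: contra xK; exact: (subsetP K'K).
  have xS : x \notin S by move: xS'; rewrite in_setD xK'.
  have cA : conn (x |: L) by apply: (conn_U1 cL kL); rewrite sedgeC.
  have [||y [yN yA con]] := @reach_NB _ (x |: L) K' x k1 cA _ xK' k1K'.
  - by rewrite !inE eqxx.
  - by rewrite in_setU (comp_refl _ k1) orbT.
  have sub : (x |: L) :\: K' \subset (K :|: NB K) :\: K'.
    apply: setSD; apply/subsetP => a; rewrite in_setU in_set1 => /orP[/eqP->|/(subsetP LK) aK].
      by rewrite in_setU xN orbT.
    by rewrite in_setU aK.
  have [|s aps sS] := connect_apath con _ sub xN yN.
    by rewrite in_setD xK' in_setU1 eqxx.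
  have [a /sS] := sepS _ aps; rewrite in_setD in_setU1 => /andP[aK' /orP[/eqP->|aL]].
    by rewrite (negbTE xS).
  by have [_] := LS _ aL; rewrite in_setD aK' /= => /negbTE->.
have := tight _ LK bL; rewrite leqNgt => /negP; apply.
by apply: leq_ltn_trans Sn; apply: leq_trans (subset_leq_card NL) (subset_leq_card (subsetDl _ _)).
Qed.

(** The sets are prolonged along the paths of [tight_link] from the old boundary to the new one. The
    paths match the two boundaries, so the shares are preserved. *)
Lemma mesh_push K T c K' : mesh K T c -> \sum_g c g < N -> K' \subset K -> big K' ->
  #|NB K'| <= \sum_g c g -> exists T', mesh K' T' c.
Proof.
set n := \sum_g c g => M nN K'K bK' K'n; have [bK cT dT TK cov cc w tight] := M.
have tn L : L \subset K -> big L -> n <= #|NB L|.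
  by move=> h1 h2; rewrite /n -w; exact: tight.
have K'w : #|NB K'| = n by apply/eqP; rewrite eqn_leq K'n tn.
have [Q lQ] := tight_link bK w nN tn K'K bK'; have [ap dj] := lQ.
have [x0 _|n0] := pickP (mem K'); last first.
  have [_ [b bP bK'b]] := bK'; have [_ tb _] := brP; have [x xb] := touch_neq0 (tb _ _ bP bP).
  by have := n0 x; rewrite /= (subsetP bK'b).
have hQ i : head x0 (Q i) \in NB K /\ head x0 (Q i) \in Q i.
  by have [] := apathP x0 (ap i); case: (Q i) => //= a p _ _ _ ? _; rewrite mem_head.
have lQ' i : last x0 (Q i) \in NB K' /\ last x0 (Q i) \in Q i.
  by have [] := apathP x0 (ap i); case: (Q i) => //= a p _ _ _ _ ?; rewrite mem_last.
have hit x : x \in NB K -> exists i, head x0 (Q i) = x.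
  by apply: (linkage_hit_head lQ) => [i|]; [case: (hQ i) | rewrite w].
have hit' x : x \in NB K' -> exists i, last x0 (Q i) = x.
  by apply: (linkage_hit lQ) => [i|]; [case: (lQ' i) | rewrite K'w].
have NKK' : NB K \subset (K :|: NB K) :\: K'.
  apply/subsetP => x xN; rewrite in_setD in_setU xN orbT andbT; apply/negP => /(subsetP K'K).
  by case/NBP: xN => /negP.
have inQ i x : x \in Q i -> x \notin K' /\ (x \in K \/ x \in NB K).
  by move/(apath_in (ap i) NKK'); rewrite in_setD in_setU => /andP[-> /orP].
have QN i x : x \in Q i -> x \in NB K -> x = head x0 (Q i).
  move=> xQ /hit[j Ej]; have ij : i = j by apply: (dj _ _ x) => //; rewrite -Ej; case: (hQ j).
  by rewrite ij.
pose T' g := T g :|: \bigcup_(i | head x0 (Q i) \in T g) [set x in Q i].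
have inT' g x : x \in T' g -> x \in T g \/ exists2 i, head x0 (Q i) \in T g & x \in Q i.
  rewrite in_setU => /orP[|/bigcupP[i hi]]; first by left.
  by rewrite inE => xi; right; exists i.
have inT'1 g x : x \in T g -> x \in T' g by rewrite in_setU => ->.
have inT'2 g i x : head x0 (Q i) \in T g -> x \in Q i -> x \in T' g.
  by move=> h xi; rewrite in_setU; apply/orP; right; apply/bigcupP; exists i; rewrite ?inE.
have mix g h i x : x \in T g -> x \in Q i -> head x0 (Q i) \in T h -> g = h.
  move=> xg xi hi; have [_ [xK|xN]] := inQ _ _ xi; first by case: (TK _ _ xg xK).
  by rewrite -(QN _ _ xi xN) in hi; exact: dT xg hi.
exists T'; split=> //.
- move=> g; apply: conn_bigcup => // i hi; split; first exact: apath_conn (ap i).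
  apply/touchP; exists (head x0 (Q i)), (head x0 (Q i)); rewrite inE; case: (hQ i) => _ h.
  by split=> //; left.
- move=> g h x /inT'[xg|[i ig xi]] /inT'[xh|[j jh xj]].
  + exact: dT xg xh.
  + exact: mix xg xj jh.
  + by apply/esym; exact: mix xh xi ig.
  by rewrite (dj _ _ _ xi xj) in ig; exact: dT ig jh.
- move=> g x /inT'[xg xK'|[i _ xi] xK']; first by apply: (TK _ _ xg); exact: (subsetP K'K).
  by have [/negP] := inQ _ _ xi.
- move=> x /hit'[i <-]; have [hN hi] := hQ i; have [g hg] := cov _ hN; exists g.
  by apply: inT'2 hg _; case: (lQ' i).
- move=> g; rewrite -(cc g).
  have inj1 : injective (fun i => head x0 (Q i)).
    by move=> i j E0; apply: (dj _ _ (head x0 (Q i))); [case: (hQ i) | rewrite E0; case: (hQ j)].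
  have inj2 : injective (fun i => last x0 (Q i)).
    by move=> i j E0; apply: (dj _ _ (last x0 (Q i))); [case: (lQ' i) | rewrite E0; case: (lQ' j)].
  have -> : NB K :&: T g = (fun i => head x0 (Q i)) @: [set i | head x0 (Q i) \in T g].
    apply/setP => x; apply/idP/imsetP => [|[i]]; last first.
      by rewrite inE => hi ->; rewrite inE hi andbT; case: (hQ i).
    by case/setIP => /hit[i <-] hi; exists i; rewrite // inE.
  have -> : NB K' :&: T' g = (fun i => last x0 (Q i)) @: [set i | head x0 (Q i) \in T g].
    apply/setP => x; apply/idP/imsetP => [|[i]]; last first.
      rewrite inE => hi ->; rewrite in_setI; case: (lQ' i) => -> li /=.
      exact: inT'2 hi li.
    case/setIP => xN' xT'; have [i Ei] := hit' _ xN'; exists i; last by rewrite Ei.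
    have xi : x \in Q i by rewrite -Ei; case: (lQ' i).
    rewrite inE; case: (inT' _ _ xT') => [xg|[j hj xj]]; last by rewrite (dj _ _ _ xi xj).
    have [_ [xK|xN]] := inQ _ _ xi; first by case: (TK _ _ xg xK).
    by rewrite -(QN _ _ xi xN).
  by rewrite !card_imset.
by move=> L LK' bL; rewrite K'w; apply: tn => //; exact: subset_trans K'K.
Qed.

(** The shares are raised one at a time. Among the meshes for the reduced demand [c'] take one with
    [K] as small as possible and move a vertex [v] of [K] into the boundary. A big set in the rest
    with too small a boundary would, by [mesh_push], carry a mesh for [c'] with a smaller [K]. *)
Lemma mesh_exists c : \sum_g c g < N -> exists K T, mesh K T c.
Proof.
have [n] := ubnP (\sum_g c g); elim: n c => // n IH c cn cN.
have [c0|] := boolP [forall g, c g == 0].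
  have [K [cK dK nK bK PK]] := @bigsideP _ N P set0 brP (leq_ltn_trans (leq_trans (eq_leq (cards0 _)) (leq0n _)) cN).
  have NK : NB K = set0.
    by apply/setP => x; rewrite in_set0; apply/negP => /NBP[xK [y yK yx]]; have := nK _ _ yK xK yx; rewrite inE.
  exists K, (fun _ => set0); split=> //; rewrite ?NK ?cards0.
  - by move=> _; exact: conn0.
  - by move=> g h x; rewrite inE.
  - by move=> g x; rewrite inE.
  - by move=> x; rewrite inE.
  - by move=> g; rewrite set0I cards0; apply/esym/eqP/(forallP c0).
  - by rewrite big1 // => g _; apply/eqP/(forallP c0).
  by [].
rewrite negb_forall => /existsP[g cg].
pose c' h := if h == g then (c g).-1 else c h.
have sc : \sum_h c h = (\sum_h c' h).+1.
  have cgE : c' g = (c g).-1 by rewrite /c' eqxx.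
  rewrite (bigD1 g) //= [in RHS](bigD1 g) //= cgE -addSn prednK ?lt0n //.
  by congr (_ + _); apply: eq_bigr => h /negbTE hg; rewrite /c' hg.
have ex : exists m, `[< exists K T, mesh K T c' /\ #|K| = m >].
  by have [||K [T M]] := IH c'; [slia | slia | exists #|K|; apply/asboolP; exists K, T].
have [m /asboolP[K [T [M Km]]] minm] := ex_minnP ex.
have c'N : \sum_h c' h < N by slia.
have [bK cT dT TK cov cc w tight] := M.
(* If the share of [g] is still 0, [T g] has no boundary vertex to which [v] could be attached, and
   the set starts afresh. *)
pose T0 := if c' g == 0 then set0 else T g.
have [v [vK cv]] : exists v, v \in K /\ conn (v |: T0).
  have [cK [b bP bsK]] := bK; have [_ tb _] := brP; have [x xb] := touch_neq0 (tb _ _ bP bP).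
  rewrite /T0; case: eqP => [_|/eqP]; first by exists x; rewrite (subsetP bsK) // setU0; split=> //; exact: conn1.
  rewrite -cc cards_eq0 => /set0Pn[y /setIP[/NBP[yK [v vK vy]] yT]].
  by exists v; split=> //; apply: (conn_U1 (cT g) yT).
pose X := v |: NB K.
have vN : v \notin NB K by apply/negP => /NBP[]; rewrite vK.
have sX : #|X| = \sum_h c h by rewrite cardsU1 vN w sc add1n.
have [|K1 [K1K bK1 dK1 NK1]] := @big_sub K X bK _ (subsetUr _ _); first by rewrite sX.
have vK1 : v \notin K1 by apply/negP => h; apply: (disjP dK1 h); rewrite in_setU1 eqxx.
have key L : L \subset K1 -> big L -> \sum_h c h <= #|NB L|.
  move=> LK1 bL; rewrite leqNgt sc ltnS; apply/negP => Lc.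
  have LK := subset_trans LK1 K1K.
  have [T' M'] := mesh_push M c'N LK bL Lc.
  have : m <= #|L| by apply: minm; apply/asboolP; exists L, T'.
  rewrite leqNgt -Km => /negP; apply; apply: proper_card; rewrite properE LK.
  by apply/subsetPn; exists v => //; apply: contra vK1; exact: (subsetP LK1).
have EX : NB K1 = X.
  by apply/eqP; rewrite eqEcard NK1 sX key.
have T0T x : x \in T0 -> x \in T g by rewrite /T0; case: eqP; rewrite ?inE.
have T0N : NB K :&: T g = NB K :&: T0.
  by rewrite /T0; case: eqP => [/eqP|//]; rewrite -cc cards_eq0 setI0 => /eqP.
pose T1 h := if h == g then v |: T0 else T h.
have inT1 h x : x \in T1 h -> x \in T h \/ (h = g /\ x = v).
  rewrite /T1; case: eqP => [->|_]; last by left.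
  by rewrite in_setU1 => /orP[/eqP->|/T0T]; [right | left].
have vT h : v \notin T h by apply/negP => /TK; apply.
exists K1, T1; split=> //; rewrite ?EX.
- by move=> h; rewrite /T1; case: eqP.
- move=> h h' x /inT1[xh|[-> ->]] /inT1[xh'|[-> Ex]] //; first exact: dT xh xh'.
    by rewrite Ex (negbTE (vT _)) in xh.
  by rewrite (negbTE (vT _)) in xh'.
- move=> h x /inT1[xh xK1|[_ ->]]; last by rewrite (negbTE vK1).
  by apply: (TK _ _ xh); exact: (subsetP K1K).
- move=> x; rewrite in_setU1 => /orP[/eqP->|xN]; first by exists g; rewrite /T1 eqxx in_setU1 eqxx.
  have [h xh] := cov _ xN; exists h; rewrite /T1; case: eqP => [E|//].
  rewrite E in xh; have : x \in NB K :&: T g by rewrite in_setI xN.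
  by rewrite T0N => /setIP[_ xT0]; rewrite in_setU1 xT0 orbT.
- move=> h; rewrite /T1; case: eqP => [->|/eqP hg].
    rewrite /X -setUIr cardsU1 inE (negbTE vN) /= -T0N cc /c' eqxx add1n prednK // lt0n //.
  have -> : X :&: T h = NB K :&: T h.
    by apply/setP => x; rewrite !in_setI in_setU1; case: eqP => [->|//]; rewrite (negbTE (vT h)) !andbF.
  by rewrite cc /c' (negbTE hg).
- by rewrite sX.
by move=> L LK1 bL; rewrite sX; exact: key.
Qed.

(** A separator [S] of fewer than [k] vertices leaves a big set in [K] whose boundary, outside [S],
    misses [A] or misses [B]. This boundary loses at least [k] vertices and gains fewer, against
    tightness. *)
Lemma mesh_linked K T c A B k : mesh K T c -> A \subset NB K -> B \subset NB K ->
  [disjoint A & B] -> k <= #|A| -> k <= #|B| -> #|NB K| + k <= N ->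
  exists Q : 'I_k -> seq G, linkage (arcs (K :|: (A :|: B))) A B Q.
Proof.
move=> M AN BN dAB kA kB kN; have [bK cT dT TK cov cc w tight] := M.
apply: menger => S sepS; rewrite leqNgt; apply/negP => Sk.
have [|K0 [K0K bK0 dK0 NK0]] := @big_sub K (NB K :|: S) bK _ (subsetUl _ _).
  by apply: leq_trans kN; apply: leq_ltn_trans (leq_card_setU _ _) _; rewrite ltn_add2l.
have nb a b : a \in A -> b \in B -> a \in NB K0 -> b \in NB K0 -> a \notin S -> b \notin S -> False.
  move=> aA bB aN bN aS bS.
  have /NBP[aK0 [a' a'K aa']] := aN; have /NBP[bK0' [b' b'K bb']] := bN.
  have cR : conn (a |: (b |: K0)).
    apply: (conn_U1 (y := a')); [|by rewrite in_setU1 a'K orbT | by rewrite sedgeC].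
    by apply: (conn_U1 (y := b')) => //; [case: bK0 | rewrite sedgeC].
  have con : connect (rin (a |: (b |: K0))) a b.
    by apply: (connP _ cR); rewrite !in_setU1 eqxx ?orbT.
  have sub : a |: (b |: K0) \subset K :|: (A :|: B).
    apply/subsetP => x; rewrite !in_setU1 !in_setU => /or3P[/eqP->|/eqP->|/(subsetP K0K)->//].
      by rewrite aA orbT.
    by rewrite bB !orbT.
  have [|s aps sS] := connect_apath con _ sub aA bB; first by rewrite in_setU1 eqxx.
  have [e /sS] := sepS _ aps; rewrite !in_setU1 => /or3P[/eqP->|/eqP->|eK] eS.
  - by rewrite eS in aS.
  - by rewrite eS in bS.
  by apply: (disjP dK0 eK); rewrite in_setU eS orbT.
have fin C : C \subset NB K -> k <= #|C| -> (forall x, x \in C -> x \in NB K0 -> x \in S) -> False.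
  move=> CN kC h; have := tight _ K0K bK0; rewrite leqNgt => /negP; apply.
  have sub : NB K0 \subset (NB K :\: C) :|: S.
    apply/subsetP => x xN; rewrite in_setU in_setD; case: (boolP (x \in S)); rewrite ?orbT // orbF => xS.
    have := subsetP NK0 _ xN; rewrite in_setU (negbTE xS) orbF => ->; rewrite andbT.
    by apply: contra xS => xC; exact: h.
  have cC : #|NB K :\: C| + #|C| = #|NB K|.
    by rewrite -[RHS](cardsID C) (setIidPr CN) addnC.
  have := subset_leq_card sub; have := (leq_card_setU (NB K :\: C) S).1; move: cC kC Sk.
  slia.
have [hA|/existsNP[a]] := pselect (forall a, a \in A -> a \in NB K0 -> a \in S).
  exact: fin AN kA hA.
move=> /not_implyP[aA] /not_implyP[aN /negP aS].
apply: (fin B BN kB) => b bB bN; apply: contraT => bS; exfalso.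
exact: nb aA bB aN bN aS bS.
Qed.

End Mesh.

(** * Ordered crossings *)

(** A column is only a connected set and may meet a row many times; what counts is that the columns
    occupy successive stretches of every row, in the same order. *)
Definition crossing (G : sgraph) n d (rows : 'I_n -> seq G) (cols : 'I_d -> {set G}) :=
  [/\ forall r, uniq (rows r) /\ sorted (@sedge G) (rows r),
      forall (r r' : 'I_n) x, x \in rows r -> x \in rows r' -> r = r',
      forall c, conn (cols c),
      forall (c c' : 'I_d) x, x \in cols c -> x \in cols c' -> c = c' &
      (forall (c : 'I_d) (r : 'I_n), exists2 y, y \in cols c & y \in rows r) /\
      (forall (c c' : 'I_d) (r : 'I_n) y y', c < c' -> y \in cols c -> y' \in cols c' ->
         y \in rows r -> y' \in rows r -> index y (rows r) < index y' (rows r))].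

Lemma pigeon (T U : finType) (I : {set T}) (f : T -> U) K : #|U| * K.-1 < #|I| ->
  exists u, K <= #|[set i in I | f i == u]|.
Proof.
move=> h; apply: contrapT => nx.
have sm : #|I| = \sum_u #|[set i in I | f i == u]|.
  rewrite -sum1_card (partition_big f predT) //=; apply: eq_bigr => u _.
  by rewrite -sum1_card; apply: eq_bigl => i; rewrite inE.
move: h; rewrite ltnNge => /negP; apply; rewrite sm -sum_nat_const; apply: leq_sum => u _.
rewrite leqNgt; apply/negP => lt; apply: nx; exists u; move: lt; case: (K) => //.
Qed.

Lemma rank_split (T : finType) (p : T -> nat) (I : {set T}) L : L <= #|I| ->
  exists I1 : {set T}, [/\ I1 \subset I, #|I1| = L & forall a b, a \in I1 -> b \in I -> b \notin I1 -> p a <= p b].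
Proof.
move=> LI; pose r := relpre p leq; pose l := sort r (enum I).
have tr : transitive r by move=> a b c; exact: leq_trans.
have srt : pairwise r l.
  by rewrite -(sorted_pairwise tr); apply: sort_sorted => a b; exact: leq_total.
have ml i : (i \in l) = (i \in I) by rewrite mem_sort mem_enum.
have ul : uniq l by rewrite sort_uniq enum_uniq.
exists [set i in take L l]; split.
- by apply/subsetP => i; rewrite inE => /mem_take; rewrite ml.
- rewrite cardsE (card_uniqP _); last exact: take_uniq.
  by rewrite size_take size_sort -cardE; case: ltnP => //; slia.
move=> a b; rewrite !inE => aT bI bT.
have bD : b \in drop L l.
  by move: bI; rewrite -ml -{1}[l](cat_take_drop L) mem_cat (negbTE bT).
by move: srt; rewrite -[l](cat_take_drop L) pairwise_cat => /and3P[/allrelP h _ _]; exact: h.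
Qed.

Lemma avoid (T : sgraph) (I : finType) (Q : I -> {set T}) (J : {set I}) (S : {set T}) :
  (forall i j x, x \in Q i -> x \in Q j -> i = j) -> #|S| < #|J| ->
  exists2 i, i \in J & [disjoint Q i & S].
Proof.
move=> dis SJ; apply: contrapT => nx.
have /choice[v hv] : forall i, exists v, i \in J -> v \in Q i /\ v \in S.
  move=> i; case: (boolP (i \in J)) => iJ.
    have /disjointNP[v v1 v2] : ~~ [disjoint Q i & S] by apply/negP => d; apply: nx; exists i.
    by exists v.
  have [x _] : exists x, x \in S \/ True.
    case: (set_0Vmem S) => [S0|[x]]; last by exists x; right.
    move: SJ; rewrite S0 cards0 card_gt0 => /set0Pn[j jJ]; exfalso; apply: nx; exists j => //.
    by rewrite S0 -setI_eq0 setI0.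
  by exists x.
have inj : {in J &, injective v}.
  move=> i j iJ jJ E; apply: (dis _ _ (v i)); first by case: (hv _ iJ).
  by rewrite E; case: (hv _ jJ).
have : v @: J \subset S by apply/subsetP => _ /imsetP[i iJ ->]; case: (hv _ iJ).
by move/subset_leq_card; rewrite card_in_imset // leqNgt SJ.
Qed.

Section Cross.
Variables (G : sgraph) (R A B : {set G}) (n m : nat) (Q : 'I_m -> {set G}) (P : 'I_n -> seq G).
Hypothesis QR : forall i, Q i \subset R.
Hypothesis Qconn : forall i, conn (Q i).
Hypothesis Qdis : forall i j x, x \in Q i -> x \in Q j -> i = j.

Definition qarc : {set G * G} := [set e | (e.1 -- e.2) && [exists i, (e.1 \in Q i) && (e.2 \in Q i)]].
Definition parcs (P : 'I_n -> seq G) : {set G * G} := [set e | [exists j, infix [:: e.1; e.2] (P j)]].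

(* When it is minimal, no arc off the sets Q i can be deleted without losing the linkage. *)
Definition cost P := #|parcs P :\: qarc|.

Hypothesis lP : linkage (arcs R) A B P.
Hypothesis minP : forall P', linkage (arcs R) A B P' -> cost P <= cost P'.

Lemma infix2P (a b : G) s : reflect (exists s1 s2, s = s1 ++ a :: b :: s2) (infix [:: a; b] s).
Proof. by apply: (iffP (@seq.infixP G _ _)) => -[s1 [s2 ->]]; exists s1, s2. Qed.

Lemma parcsP P' a b : reflect (exists j s1 s2, P' j = s1 ++ a :: b :: s2) ((a, b) \in parcs P').
Proof.
rewrite inE; apply: (iffP existsP) => [[j /infix2P[s1 [s2 E]]]|[j [s1 [s2 E]]]]; exists j.
  by exists s1, s2.
by apply/infix2P; exists s1, s2.
Qed.

Lemma qarcP a b : reflect (a -- b /\ exists2 i, a \in Q i & b \in Q i) ((a, b) \in qarc).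
Proof.
rewrite inE /=; apply: (iffP andP) => -[ab].
  by move/existsP=> [i /andP[h1 h2]]; split=> //; exists i.
by case=> i h1 h2; split=> //; apply/existsP; exists i; rewrite h1.
Qed.

Lemma apath_arc (E : {set G * G}) (A' B' : {set G}) s s1 a b s2 : apath E A' B' s -> s = s1 ++ a :: b :: s2 -> (a, b) \in E.
Proof.
move=> ap E0; rewrite E0 in ap; have [_ srt _ _ _] := apathP a ap.
by move: srt; rewrite sorted_split => /andP[_ /= /andP[]].
Qed.

Let Puniq j : uniq (P j).
Proof. by have [ap _] := lP; have := ap j; case: (P j) => // x p /and4P[]. Qed.

Let Pdis i j x : x \in P i -> x \in P j -> i = j.
Proof. by have [_] := lP; apply. Qed.

Section Cut.
Variables (j0 : 'I_n) (s1 s2 : seq G) (a b : G).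
Hypothesis Ej0 : P j0 = s1 ++ a :: b :: s2.
Hypothesis abq : (a, b) \notin qarc.

Let E' := (parcs P :|: qarc) :\ (a, b).

Let inE' x y : (x, y) \in E' = ((x, y) != (a, b)) && (((x, y) \in parcs P) || ((x, y) \in qarc)).
Proof. by rewrite in_setD1 in_setU. Qed.

(** A linkage within these arcs would cost strictly less, having lost the arc [(a, b)]; so Menger's
    theorem yields a separator. *)
Lemma cut_sep : exists2 S : {set G}, separates E' A B S & #|S| < n.
Proof.
apply: contrapT => nS; have [P' [ap' dj']] : exists P' : 'I_n -> seq G, linkage E' A B P'.
  by apply: menger => S sS; rewrite leqNgt; apply/negP => h; apply: nS; exists S.
have E'R x y : (x, y) \in E' -> (x, y) \in arcs R.
  rewrite inE' => /andP[_ /orP[/parcsP[j [t1 [t2 Et]]]|/qarcP[xy [i xi yi]]]].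
    by have [ap _] := lP; exact: apath_arc (ap j) Et.
  by rewrite inE /= xy !(subsetP (QR i)).
have lP' : linkage (arcs R) A B P'.
  split=> // j; apply: apath_mono (ap' j) _ => t1 x y t2 _; exact: E'R.
have := minP lP'; rewrite leqNgt => /negP; apply; apply: proper_card.
rewrite properE; apply/andP; split.
  apply/subsetP => -[x y]; rewrite !in_setD => /andP[xyq /parcsP[j [t1 [t2 Et]]]].
  have := apath_arc (ap' j) Et; rewrite inE' (negbTE xyq) orbF => /andP[_ ->].
  by rewrite andbT; move: xyq.
apply/subsetPn; exists (a, b).
  by rewrite in_setD abq /=; apply/parcsP; exists j0, s1, s2.
rewrite in_setD abq /=; apply/parcsP => -[j [t1 [t2 Et]]].
by have := apath_arc (ap' j) Et; rewrite inE' eqxx.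
Qed.

Lemma P_apath j : j != j0 -> apath E' A B (P j).
Proof.
move=> jj0; have [ap _] := lP; apply: apath_mono (ap j) _ => t1 x y t2 Et _.
rewrite inE'; apply/andP; split; last by apply/orP; left; apply/parcsP; exists j, t1, t2.
apply: contraNneq jj0 => -[xa yb]; apply/eqP; apply: (@Pdis _ _ a).
  by rewrite Et -xa mem_cat mem_head orbT.
by rewrite Ej0 mem_cat mem_head orbT.
Qed.

(** [S] has exactly one vertex on every path other than [P j0] and none on [P j0], so it cuts each
    of them at one place. A set [Q i] missing [S] is connected by permitted arcs and stays on one
    side of the cut; the arc [(a, b)] shows on [P j0] which side it is. *)
Lemma cutP : exists (S : {set G}) (th : 'I_n -> nat), #|S| < n /\
  forall i x, [disjoint Q i & S] -> x \in Q i -> x \in P j0 ->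
    (size s1 < index x (P j0) -> forall j y, y \in Q i -> y \in P j -> th j <= index y (P j)) /\
    (index x (P j0) <= size s1 -> forall j y, y \in Q i -> y \in P j -> index y (P j) < th j).
Proof.
have [S sep Sn] := cut_sep.
have /choice[v hv] : forall j, exists v, j != j0 -> v \in P j /\ v \in S.
  move=> j; case: (boolP (j != j0)) => [/P_apath/sep[v v1 v2]|_]; first by exists v.
  by exists a.
have vinj : {in [set~ j0] &, injective v}.
  move=> j k; rewrite !inE => jj0 kj0 E0; apply: (@Pdis _ _ (v j)); first by case: (hv _ jj0).
  by rewrite E0; case: (hv _ kj0).
have ES : v @: [set~ j0] = S.
  apply/eqP; rewrite eqEcard; apply/andP; split.
    by apply/subsetP => _ /imsetP[j + ->]; rewrite !inE => /hv[].
  by rewrite card_in_imset // cardsC1 card_ord -ltnS prednK // (leq_ltn_trans _ Sn).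
have Pj0S x : x \in P j0 -> x \notin S.
  move=> xj; rewrite -ES; apply/negP => /imsetP[j + Ex]; rewrite !inE => jj0.
  by have [] := hv _ jj0; rewrite -Ex => /Pdis/(_ xj)/eqP; rewrite (negbTE jj0).
have PjS j x : j != j0 -> x \in P j -> x \in S -> x = v j.
  move=> jj0 xj; rewrite -ES => /imsetP[k + Ex]; rewrite !inE => kj0.
  have [] := hv _ kj0; rewrite -Ex => xk _; by rewrite (Pdis xj xk).
pose rS : rel G := [rel x y | [&& (x, y) \in E', x \notin S & y \notin S]].
have noAB x y z : x \in A -> z \in B -> x \notin S -> connect rS x y -> connect rS y z -> False.
  move=> xA zB xS xy yz; have /connectP[p pp Ez] := connect_trans xy yz.
  have zB' : last x p \in B by rewrite -Ez.
  have pE : path (arc E') x p by apply: sub_path pp => c d /and3P[].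
  have [s aps sub] := apath_sub pE xA zB'.
  have [w /sub ws wS] := sep _ aps; move: ws wS; rewrite inE => /orP[/eqP->|].
    by rewrite (negbTE xS).
  elim: (p) (x) pp => //= c q IH d /andP[/and3P[_ _ cS] pq]; rewrite inE => /orP[/eqP->|wq].
    by rewrite (negbTE cS).
  exact: IH pq wq.
have Qcon i x y : [disjoint Q i & S] -> x \in Q i -> y \in Q i -> connect rS x y.
  move=> dQ xi yi; have := connP _ (Qconn i) _ _ xi yi; apply: connect_sub => c d /and3P[cd ci di].
  apply: connect1; rewrite /rS /= inE'.
  have -> : (c, d) \in qarc by apply/qarcP; split=> //; exists i.
  rewrite orbT andbT; apply/and3P; split.
  - by apply: contraNneq abq => <-; apply/qarcP; split=> //; exists i.
  - by apply/negP; exact: disjP dQ ci.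
  by apply/negP; exact: disjP dQ di.
have walk t1 c t2 : (forall r1 x y r2, c :: t2 = r1 ++ x :: y :: r2 -> (x, y) \in E') ->
    t1 = c :: t2 -> {in t1, forall x, x \notin S} -> {in t1, forall y, connect rS c y /\ connect rS y (last c t2)}.
  move=> + ->; elim: t2 c => [|d t2 IH] c h hS y.
    by rewrite inE => /eqP->; split; exact: connect0.
  have cd : connect rS c d.
    apply: connect1; rewrite /rS /= (h [::] c d t2) // !hS ?inE ?eqxx ?orbT //.
  have hd : connect rS d (last d t2).
    by have [] := IH d (fun r1 x y r2 Er => h (c :: r1) x y r2 (congr1 (cons c) Er)) (fun z zt => hS z (mem_behead (zt : z \in behead (c :: d :: t2)))) d (mem_head _ _).
  rewrite inE => /orP[/eqP->|yd]; first by split; [exact: connect0 | exact: connect_trans cd hd].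
  have [h1 h2] := IH d (fun r1 x y r2 Er => h (c :: r1) x y r2 (congr1 (cons c) Er)) (fun z zt => hS z (mem_behead (zt : z \in behead (c :: d :: t2)))) y yd.
  by split=> //; exact: connect_trans cd h1.
(* The side of [A] and, next, the side of [B]. No vertex is on both, and a set [Q i] missing [S]
   lies on one side as soon as one of its vertices does. *)
pose RA y := exists x, [/\ x \in A, x \notin S & connect rS x y].
pose RB y := exists2 z, z \in B & connect rS y z.
have noRAB y : RA y -> RB y -> False.
  by move=> [x [xA xS xy]] [z zB yz]; exact: noAB xA zB xS xy yz.
have QRA i x y : [disjoint Q i & S] -> x \in Q i -> y \in Q i -> RA x -> RA y.
  by move=> dQ xi yi [w [h1 h2 h3]]; exists w; split=> //; apply: connect_trans h3 (Qcon _ _ _ dQ xi yi).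
have QRB i x y : [disjoint Q i & S] -> x \in Q i -> y \in Q i -> RB x -> RB y.
  by move=> dQ xi yi [w h1 h2]; exists w => //; apply: connect_trans (Qcon _ _ _ dQ yi xi) h2.
have preRA j t1 t2 : P j = t1 ++ t2 -> {in t1, forall x, x \notin S} ->
    (forall r1 x y r2, t1 = r1 ++ x :: y :: r2 -> (x, y) \in E') -> {in t1, forall y, RA y}.
  move=> Ej hS hE y yt; case: t1 Ej hS hE yt => // c t1 Ej hS hE yt.
  have [h _] := walk _ c t1 hE erefl hS y yt; exists c; split=> //; last exact: hS (mem_head _ _).
  by have [ap _] := lP; have := ap j; rewrite Ej => /= /and4P[].
have sufRB j t1 t2 : P j = t1 ++ t2 -> {in t2, forall x, x \notin S} ->
    (forall r1 x y r2, t2 = r1 ++ x :: y :: r2 -> (x, y) \in E') -> {in t2, forall y, RB y}.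
  move=> Ej hS hE y yt; case: t2 Ej hS hE yt => // c t2 Ej hS hE yt.
  have [_ h] := walk _ c t2 hE erefl hS y yt; exists (last c t2) => //.
  by have [ap _] := lP; have [_ _ _ _] := apathP c (ap j); rewrite Ej last_cat.
have uj0 := Puniq j0; rewrite Ej0 in uj0.
have ia : index a (P j0) = size s1.
  rewrite Ej0 index_cat /= eqxx addn0; move: uj0; rewrite cat_uniq /= => /and3P[_ /norP[/negbTE-> _] _] //.
have j0A : {in rcons s1 a, forall y, RA y}.
  apply: (preRA j0 _ (b :: s2)); first by rewrite cat_rcons.
    by move=> x xs; apply: Pj0S; rewrite Ej0 -cat_rcons mem_cat xs.
  move=> r1 x y r2 Er; rewrite inE'; apply/andP; split; last first.
    by apply/orP; left; apply/parcsP; exists j0, r1, (r2 ++ b :: s2); rewrite Ej0 -cat_rcons Er -catA.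
  apply: contraTneq uj0 => -[_ yb]; rewrite -cat_rcons cat_uniq negb_and; apply/orP; right.
  rewrite negb_and negbK; apply/orP; left; apply/hasP; exists b; first exact: mem_head.
  by rewrite /= Er -yb mem_cat !inE eqxx !orbT.
have j0B : {in b :: s2, forall y, RB y}.
  apply: (sufRB j0 (rcons s1 a) _); first by rewrite cat_rcons.
    by move=> x xs; apply: Pj0S; rewrite Ej0 -cat_rcons mem_cat xs orbT.
  move=> r1 x y r2 Er; rewrite inE'; apply/andP; split; last first.
    apply/orP; left; apply/parcsP; exists j0, (rcons s1 a ++ r1), r2.
    by rewrite Ej0 -cat_rcons Er catA.
  apply: contraTneq uj0 => -[xa _]; rewrite -cat_rcons cat_uniq negb_and; apply/orP; right.
  rewrite negb_and negbK; apply/orP; left; apply/hasP; exists a; last by rewrite /= mem_rcons mem_head.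
  by rewrite Er -xa mem_cat mem_head orbT.
have j0split x : x \in P j0 -> if index x (P j0) <= size s1 then x \in rcons s1 a else x \in b :: s2.
  rewrite Ej0 -cat_rcons mem_cat => xj; rewrite index_cat.
  case: (boolP (x \in rcons s1 a)) xj => [xs _|_ /= xj].
    by move: xs; rewrite -index_mem size_rcons ltnS => ->.
  by rewrite size_rcons addSn ltnNge leq_addr.
have jparts j : j != j0 -> exists t1 t2, [/\ P j = t1 ++ v j :: t2, {in t1, forall y, RA y},
     {in t2, forall y, RB y} & index (v j) (P j) = size t1].
  move=> jj0; have [vj vS] := hv _ jj0.
  have [t1 [t2 Et]] : exists t1 t2, P j = t1 ++ v j :: t2 by case/path.splitPr: vj => t1 t2; exists t1, t2.
  have := Puniq j; rewrite Et cat_uniq => /and3P[_ /= /norP[v1 /hasPn h12] /andP[v2 _]].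
  have arcj r1 x y r2 : P j = r1 ++ x :: y :: r2 -> (x, y) \in E' by exact: apath_arc (P_apath jj0).
  exists t1, t2; split=> //; last by rewrite index_cat (negbTE v1) /= eqxx addn0.
  - apply: (preRA j _ (v j :: t2)) => //.
      move=> x xt; apply/negP => xS; have : x = v j by apply: PjS => //; rewrite Et mem_cat xt.
      by move=> E0; rewrite E0 (negbTE v1) in xt.
    by move=> r1 x y r2 Er; apply: (arcj r1 _ _ (r2 ++ v j :: t2)); rewrite Et Er -catA.
  apply: (sufRB j (rcons t1 (v j)) _); first by rewrite cat_rcons.
    move=> x xt; apply/negP => xS; have : x = v j by apply: PjS => //; rewrite Et mem_cat inE xt !orbT.
    by move=> E0; rewrite E0 (negbTE v2) in xt.
  by move=> r1 x y r2 Er; apply: (arcj (rcons t1 (v j) ++ r1) _ _ r2); rewrite Et -cat_rcons Er catA.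
(* On [P j0] the cut runs between [a], at index [size s1], and [b]. *)
pose th j := if j == j0 then (size s1).+1 else index (v j) (P j).
exists S, th; split=> // i x dQ xi xj; split=> hx j y yi yj.
  have Bx : RB x by apply: j0B; have := j0split _ xj; rewrite leqNgt hx.
  have By := QRB _ _ _ dQ xi yi Bx; rewrite /th; case: eqP => [Ej|/eqP jj0].
    rewrite Ej in yj *; rewrite ltnNge; apply/negP => le.
    by have := j0split _ yj; rewrite le => /j0A Ay; exact: noRAB Ay By.
  have [t1 [t2 [Et h1 h2 hi]]] := jparts _ jj0; rewrite hi leqNgt; apply/negP => lt.
  have yt : y \in t1.
    by move: lt; rewrite Et index_cat; case: ifP => // _; rewrite ltnNge leq_addr.
  exact: noRAB (h1 _ yt) By.
have Ax : RA x by apply: j0A; have := j0split _ xj; rewrite hx.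
have Ay := QRA _ _ _ dQ xi yi Ax; rewrite /th; case: eqP => [Ej|/eqP jj0].
  rewrite Ej in yj *; rewrite ltnS leqNgt; apply/negP => lt.
  by have := j0split _ yj; rewrite leqNgt lt => /j0B By; exact: noRAB Ay By.
have [t1 [t2 [Et h1 h2 hi]]] := jparts _ jj0; rewrite hi.
have := yj; rewrite Et mem_cat inE => /or3P[yt|/eqP yv|/h2 By].
- by rewrite index_cat yt index_mem.
- by exfalso; apply: (disjP dQ yi); rewrite yv; case: (hv _ jj0).
by exfalso; exact: noRAB Ay By.
Qed.

End Cut.

Let Psort j : sorted (@sedge G) (P j).
Proof.
have [ap _] := lP; have := ap j; case: (P j) => // x p /and4P[+ _ _ _].
by apply: sub_path => a b; rewrite arcsE => /and3P[].
Qed.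

(** If every arc of the row in between lay in some [Q i], the row could not leave [Q i1], because
    these sets are disjoint. *)
Lemma arc_between j0 i1 i2 x1 x2 : i1 != i2 -> x1 \in Q i1 -> x1 \in P j0 -> x2 \in Q i2 -> x2 \in P j0 ->
  index x1 (P j0) <= index x2 (P j0) ->
  exists s1 a b s2, [/\ P j0 = s1 ++ a :: b :: s2, (a, b) \notin qarc,
    index x1 (P j0) <= size s1 & size s1 < index x2 (P j0)].
Proof.
move=> i12 x1Q x1P x2Q x2P le.
have srt := Psort j0.
apply: contrapT => nx.
have h t : index x1 (P j0) + t <= index x2 (P j0) -> nth x1 (P j0) (index x1 (P j0) + t) \in Q i1.
  elim: t => [|t IH] lt; first by rewrite addn0 nth_index.
  have {}IH := IH (leq_trans (leq_add (leqnn _) (leqnSn t)) lt).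
  set u := index x1 (P j0) + t in IH *; rewrite addnS -/u in lt *.
  have us : u.+1 < size (P j0) by apply: leq_ltn_trans lt _; rewrite index_mem.
  apply: contrapT => /negP nQ; apply: nx.
  exists (take u (P j0)), (nth x1 (P j0) u), (nth x1 (P j0) u.+1), (drop u.+2 (P j0)).
  have su : size (take u (P j0)) = u by rewrite size_take; case: ltnP => //; slia.
  split; rewrite ?su ?leq_addr //.
    rewrite -[LHS](cat_take_drop u) (drop_nth x1) ?(drop_nth x1 us) //; slia.
  apply: contra nQ => /qarcP[_ [i ui vi]]; by rewrite (Qdis IH ui).
have := h (index x2 (P j0) - index x1 (P j0)); rewrite subnKC // nth_index // => /(_ (leqnn _)).
by move/(Qdis x2Q) => E; rewrite E eqxx in i12.
Qed.

(** Greedy choice. The [n.*2] sets that come first on [P j0] are divided from the others by an arc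
    as in [arc_between]. Its separator and the previous one have together fewer than [n.*2]
    vertices, so one of the first sets avoids both. On every row it lies between the previous cut
    and the new one, and the choice goes on among the other sets beyond the new cut. *)
Lemma select d (I : {set 'I_m}) (J : {set 'I_n}) j0 (S0 : {set G}) (lo : 'I_n -> nat) :
  j0 \in J -> (forall i j, i \in I -> j \in J -> exists2 x, x \in Q i & x \in P j) ->
  #|S0| < n ->
  (forall i, i \in I -> [disjoint Q i & S0] -> forall j y, j \in J -> y \in Q i -> y \in P j -> lo j <= index y (P j)) ->
  d * n.*2 < #|I| ->
  exists l, [/\ size l = d, {subset l <= I},
    forall i j y, i \in l -> j \in J -> y \in Q i -> y \in P j -> lo j <= index y (P j) &
    pairwise (fun i i' => `[< forall j y y', j \in J -> y \in Q i -> y' \in Q i' -> y \in P j -> y' \in P j ->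
       index y (P j) < index y' (P j) >]) l].
Proof.
move=> j0J; elim: d I S0 lo => [|d IH] I S0 lo meets S0n hlo cI; first by exists [::].
have [x0 _] : exists x0 : G, True.
  have /card_gt0P[i iI] : 0 < #|I| by slia.
  by have [x] := meets _ _ iI j0J; exists x.
have /choice[x hx] : forall i, exists x, i \in I -> x \in Q i /\ x \in P j0.
  move=> i; case: (boolP (i \in I)) => iI; last by exists x0.
  by have [x] := meets _ _ iI j0J; exists x.
pose p i := index (x i) (P j0).
have [|I1 [I1I cI1 h1]] := @rank_split _ p I n.*2; first by slia.
pose I2 := I :\: I1.
have cI2 : d * n.*2 < #|I2|.
  by move: cI; rewrite -(cardsID I1 I) (setIidPr I1I) cI1 /I2 mulSn ltn_add2l.
have n0 : 0 < n by slia.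
have /card_gt0P[a aI1] : 0 < #|I1| by rewrite cI1 double_gt0.
have /card_gt0P[b bI2] : 0 < #|I2| by slia.
have [i1 i1I m1] := @arg_maxnP _ a (mem I1) p aI1.
have [i2 i2I m2] := @arg_minnP _ b (mem I2) p bI2.
rewrite !inE in i1I i2I; have /andP[i2I1 i2I'] := i2I.
have i1I' := subsetP I1I _ i1I.
have [Q1 P1] := hx _ i1I'; have [Q2 P2] := hx _ i2I'.
have i12 : i1 != i2 by apply: contraNneq i2I1 => <-.
have [s1 [u [v [s2 [E uv le1 lt2]]]]] := arc_between i12 Q1 P1 Q2 P2 (h1 _ _ i1I i2I' i2I1).
have [S1 [th [S1n hth]]] := cutP E uv.
have [|i iI1 dis] := @avoid _ _ Q I1 (S0 :|: S1) Qdis.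
  by rewrite cI1; have := (leq_card_setU S0 S1).1; slia.
have iI := subsetP I1I _ iI1.
have dS0 : [disjoint Q i & S0] by apply: disjointWr dis; exact: subsetUl.
have dS1 : [disjoint Q i & S1] by apply: disjointWr dis; exact: subsetUr.
have [||l [sl lI lol pl]] := IH I2 S1 th _ S1n _ cI2.
- by move=> i' j i'I; apply: meets; move: i'I; rewrite in_setD => /andP[].
- move=> i' i'I dis' j y _ yi yj.
  have := i'I; rewrite in_setD => /andP[i'1 i'I']; have [q1 q2] := hx _ i'I'.
  have [+ _] := hth _ _ dis' q1 q2; apply=> //.
  by apply: leq_trans lt2 _; exact: m2.
have below j y : y \in Q i -> y \in P j -> index y (P j) < th j.
  have [q1 q2] := hx _ iI.
  have [_ +] := hth _ _ dS1 q1 q2; apply=> //.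
  by apply: leq_trans le1; exact: m1.
exists (i :: l); split=> /=.
- by rewrite sl.
- by move=> z; rewrite inE => /orP[/eqP->//|/lI]; rewrite in_setD => /andP[].
- move=> z j y; rewrite inE => /orP[/eqP->|zl] jJ yz yj; first exact: (hlo i iI dS0 j y jJ yz yj).
  have [w wi wj] := meets _ _ iI jJ; apply: leq_trans (hlo _ iI dS0 j w jJ wi wj) _.
  exact: leq_trans (ltnW (below _ _ wi wj)) (lol _ _ _ zl jJ yz yj).
rewrite pl andbT; apply/allP => z zl; apply/asboolP => j y y' jJ yi y'z yj y'j.
exact: leq_trans (below _ _ yi yj) (lol _ _ _ zl jJ y'z y'j).
Qed.

Lemma select_crossing d (I : {set 'I_m}) n1 (g : 'I_n1 -> 'I_n) : 0 < n1 -> injective g ->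
  (forall i j, i \in I -> exists2 x, x \in Q i & x \in P (g j)) -> d * n.*2 < #|I| ->
  exists q : 'I_d -> 'I_m, crossing (P \o g) (Q \o q).
Proof.
move=> n1p gi meets cI.
pose J := g @: [set: 'I_n1]; pose j0 := Ordinal n1p.
have n0 : 0 < n by case: (n) (g j0) => // -[].
have [|i _ iI /imsetP[r _ ->]||_ _ _ //|l [sl lI _ pl]] :=
  @select d I J (g j0) set0 (fun _ => 0) _ _ _ _ cI.
- by apply: imset_f.
- exact: meets.
- by rewrite cards0.
have [i0 _] : exists i0 : 'I_m, True.
  have /card_gt0P[i iI] : 0 < #|I| by slia.
  by exists i.
exists (fun c => nth i0 l c).
have lt (c : 'I_d) : c < size l by rewrite sl.
have ord (c c' : 'I_d) r y y' : c < c' -> y \in Q (nth i0 l c) -> y' \in Q (nth i0 l c') ->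
    y \in P (g r) -> y' \in P (g r) -> index y (P (g r)) < index y' (P (g r)).
  move=> cc'; have /pairwiseP hp := pl; have /asboolP h := hp i0 c c' (lt c) (lt c') cc'.
  by apply: h; apply: imset_f.
split.
- move=> r; split; first exact: Puniq.
  exact: Psort.
- by move=> r r' x xr xr'; apply: gi; exact: Pdis xr xr'.
- by move=> c; exact: Qconn.
- move=> c c' x xc xc'; have E := Qdis xc xc'; apply/ord_inj.
  have [r] : exists r : 'I_n1, True by exists j0.
  have [y yc yr] := meets _ r (lI _ (mem_nth i0 (lt c))).
  have yc' : y \in Q (nth i0 l c') by rewrite -E.
  case: (ltngtP c c') => // cc' _.
    by have := ord _ _ r y y cc' yc yc' yr yr; rewrite ltnn.
  by have := ord _ _ r y y cc' yc' yc yr yr; rewrite ltnn.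
by split=> // c r; apply: meets; apply: lI; exact: mem_nth.
Qed.

(** The [n] rows fall into [e] groups of [n1]. A set missing fewer than [e] rows meets all rows of
    some group, and one group serves many sets. *)
Lemma dense_crossing d e n1 (I : {set 'I_m}) : 0 < n1 -> n = e * n1 ->
  (forall i, i \in I -> #|[set j | [disjoint Q i & [set x in P j]]]| < e) ->
  e * (d * n.*2) < #|I| -> exists (rows : 'I_n1 -> seq G) (cols : 'I_d -> {set G}), crossing rows cols.
Proof.
move=> n1p En miss cI.
have ltg (g : 'I_e) (r : 'I_n1) : g * n1 + r < n.
  rewrite En; apply: (@leq_trans (g.+1 * n1)); first by rewrite mulSn addnC ltn_add2r.
  by rewrite leq_mul2r (ltn_ord g) orbT.
pose gg g r := Ordinal (ltg g r).
have /choice[f hf] : forall i, exists g, i \in I -> forall r, exists2 x, x \in Q i & x \in P (gg g r).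
  move=> i; case: (boolP (i \in I)) => iI; last first.
    have /card_gt0P[i' /miss lt] : 0 < #|I| by slia.
    have e0 : 0 < e by slia.
    by exists (Ordinal e0).
  apply: contrapT => nx.
  have /choice[r hr] : forall g : 'I_e, exists r, [disjoint Q i & [set x in P (gg g r)]].
    move=> g; apply: contrapT => nr; apply: nx; exists g => _ r.
    have /disjointNP[x xi] : ~~ [disjoint Q i & [set x in P (gg g r)]].
      by apply/negP => d0; apply: nr; exists r.
        by rewrite inE => xr; exists x.
  have := miss _ iI; rewrite ltnNge => /negP; apply.
  have inj : injective (fun g => gg g (r g)).
    move=> g g' /(congr1 val) /= E; apply: ord_inj.
    have := congr1 (divn^~ n1) E; rewrite !divnMDl // !divn_small ?addn0 //.
  rewrite -[X in X <= _](card_ord e) -cardsT -(card_imset _ inj); apply: subset_leq_card.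
  by apply/subsetP => _ /imsetP[g _ ->]; rewrite inE.
have [|g cg] := @pigeon _ _ I f (d * n.*2).+1; first by rewrite card_ord.
have [||q cr] := @select_crossing d [set i in I | f i == g] n1 (gg g) n1p _ _ cg.
- by move=> r r' /(congr1 val) /= /eqP; rewrite eqn_add2l => /eqP/ord_inj.
- by move=> i r; rewrite inE => /andP[iI /eqP<-]; exact: hf.
by exists (P \o gg g), (Q \o q).
Qed.

End Cross.

(** * Grids from crossings *)

(** A minor model of [W] in [G]. *)
Definition model (W G : sgraph) (psi : W -> {set G}) :=
  [/\ forall w, conn (psi w), forall w, psi w != set0,
      forall w w' x, x \in psi w -> x \in psi w' -> w = w' &
      forall w w', w -- w' -> exists x y, [/\ x \in psi w, y \in psi w' & x -- y]].

(** If all degrees are at most [k], the ball of radius [k] around [x0] has at most [k.+2 ^ k]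
    elements, so some element is farther away. *)
Lemma path_or_star (T : finType) (e : rel T) k : (forall x y, connect e x y) -> k.+2 ^ k < #|T| ->
  exists m : 'I_k -> T, injective m /\
   ((forall i j : 'I_k, j = i.+1 :> nat -> e (m i) (m j)) \/
    exists z, forall i, z != m i /\ e z (m i)).
Proof.
move=> con cT.
have [[z hz]|nz] := pselect (exists z, k < #|[set y | e z y]|).
  have cz : k <= #|[set y | e z y] :\ z|.
    by move: hz; rewrite (cardsD1 z); case: (z \in _) => /=; slia.
  have lt (i : 'I_k) : i < #|[set y | e z y] :\ z| by apply: leq_trans cz.
  exists (fun i => enum_val (Ordinal (lt i))); split.
    by move=> i j /enum_val_inj/(congr1 val) /= E; exact: ord_inj.
  right; exists z => i; have := enum_valP (Ordinal (lt i)); rewrite !inE eq_sym => /andP[-> ->] //.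
have deg z : #|[set y | e z y]| <= k by rewrite leqNgt; apply/negP => ?; apply: nz; exists z.
have [x0 _] : exists x0 : T, True.
  have /card_gt0P[x _] : 0 < #|T| by slia.
  by exists x.
pose B t := iter t (fun A : {set T} => A :|: \bigcup_(y in A) [set w | e y w]) [set x0].
have cB t : #|B t| <= k.+2 ^ t.
  elim: t => [|t IH]; first by rewrite cards1.
  rewrite /B iterS -/(B t); apply: leq_trans (leq_card_setU _ _).1 _.
  have : #|\bigcup_(y in B t) [set w | e y w]| <= #|B t| * k.
    rewrite -sum_nat_const; elim/big_rec2: _ => [|y s A _ le]; first by rewrite cards0.
    by apply: leq_trans (leq_card_setU _ _).1 _; exact: leq_add.
  move=> le; apply: (@leq_trans (#|B t| * k.+2)); last by rewrite expnS mulnC leq_mul2l IH orbT.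
  by rewrite mulnS mulnS; move: le; set a := _ * k; slia.
have inB p x t : path e x p -> x \in B t -> last x p \in B (t + size p).
  elim: p x t => [|y p IH] x t /=; first by rewrite addn0.
  move=> /andP[xy pp] xB; rewrite addnS -addSn; apply: IH => //.
  by rewrite /B iterS -/(B t) in_setU; apply/orP; right; apply/bigcupP; exists x => //; rewrite inE.
have [y yB] : exists y, y \notin B k.
  apply: contrapT => ny; move: cT; rewrite ltnNge => /negP; apply; apply: leq_trans (cB k).
  by rewrite -cardsT; apply/subset_leq_card/subsetP => y _; apply: contraT => yB; case: ny; exists y.
have /connectP[p0 pp0 Ey] := con x0 y; move: yB; rewrite Ey; case/shortenP: pp0 => p pp up _ yB.
have kp : k < size p.
  rewrite ltnNge; apply: contra yB => le.
  have BS s t : B t \subset B (t + s).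
    elim: s => [|s IH]; first by rewrite addn0.
    by rewrite addnS /B iterS -/(B _); apply: subset_trans IH _; exact: subsetUl.
  have := inB p x0 0 pp; rewrite /B /= inE eqxx add0n => /(_ isT).
  by move/(subsetP (BS (k - size p) _)); rewrite subnKC.
have ip (i : 'I_k) : i < size p by exact: ltn_trans (ltn_ord i) kp.
exists (fun i => nth x0 (x0 :: p) i); split.
  move=> i j /eqP; rewrite nth_uniq //= ?ltnS; last 2 first.
  - exact: ltnW.
  - exact: ltnW.
  by move/eqP/ord_inj.
left=> i j Ej; rewrite Ej /=; have /(pathP x0) h := pp; exact: h.
Qed.

Lemma incr_enum d (A : {set 'I_d}) D : D <= #|A| ->
  exists h : 'I_D -> 'I_d, (forall i j : 'I_D, i < j -> h i < h j) /\ forall i, h i \in A.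
Proof.
move=> DA; have srt : pairwise (fun i j : 'I_d => i < j) (enum A).
  rewrite {1}/enum_mem; apply: (subseq_pairwise (filter_subseq _ _)).
  rewrite -enumT -(@pairwise_map _ _ val ltn) val_enum_ord.
  by rewrite -(sorted_pairwise ltn_trans) iota_ltn_sorted.
case: D DA => [|D] DA.
  have f : 'I_0 -> 'I_d by case.
  by exists f; split=> -[].
have sz (i : 'I_D.+1) : i < size (enum A) by rewrite -cardE; apply: leq_trans DA.
have x0 : 'I_d by case: (enum A) (sz ord0).
exists (fun i => nth x0 (enum A) i); split.
  by move=> i j ij; move/pairwiseP: srt => h; apply: h => //; exact: sz.
by move=> i; rewrite -mem_enum mem_nth.
Qed.

Definition seg (G : sgraph) (s : seq G) p q := [set x in s | p <= index x s < q].

Lemma conn_seg (G : sgraph) (s : seq G) p q : uniq s -> sorted (@sedge G) s -> conn (seg s p q).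
Proof.
move=> us ss.
have -> : seg s p q = [set x in drop p (take q s)].
  apply/setP => x; rewrite !inE; apply/andP/idP => [[xs /andP[px xq]]|].
    have xt : x \in take q s by rewrite in_take.
    have E : index x (take q s) = index x s.
      by rewrite -{2}[s](cat_take_drop q) index_cat xt.
    by rewrite -(nth_index x xt) E; apply/(nthP x); exists (index x s - p);
      rewrite ?nth_drop ?subnKC // size_drop ltn_sub2r //; move: xt; rewrite -index_mem E //; exact: leq_trans.
  move=> /(nthP x)[i]; rewrite size_drop size_take_min ltn_subRL leq_min => /andP[ltq lts].
  by rewrite nth_drop nth_take // => <-; rewrite mem_nth // index_uniq // leq_addr.
apply: conn_sorted; apply: drop_sorted; exact: take_sorted.
Qed.

Section Rung.
Variables (G : sgraph) (n : nat) (rows : 'I_n -> seq G).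
Hypothesis rdis : forall (r r' : 'I_n) x, x \in rows r -> x \in rows r' -> r = r'.

Definition offrows (C : {set G}) := [set x in C | [forall r, x \notin rows r]].

Lemma offrowsP (C : {set G}) x : reflect (x \in C /\ forall r, x \notin rows r) (x \in offrows C).
Proof. by rewrite inE; apply: (iffP andP) => -[h1 /forallP h2]. Qed.

Definition rung (C : {set G}) : rel 'I_n := [rel r r' | `[< exists D u v,
  [/\ conn D, D \subset offrows C, u \in C /\ u \in rows r, v \in C /\ v \in rows r' &
      u -- v \/ exists x y, [/\ x \in D, y \in D, u -- x & y -- v]] >]].

(** A walk in the column passes from row to row by rungs. Hence the rungs of a column that meets all
    rows form a connected relation, to which [path_or_star] applies. *)
Lemma rung_conn (C : {set G}) r0 : conn C -> (exists2 x, x \in C & x \in rows r0) ->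
  forall r, (exists2 y, y \in C & y \in rows r) -> connect (rung C) r0 r.
Proof.
move=> cC [x0 x0C x0r] r [y0 y0C y0r]; pose F := offrows C.
(* The vertices on rows already reached, and the vertices off the rows whose component there is
   attached to such a row. *)
pose A := [set x | `[< (exists r, x \in rows r /\ connect (rung C) r0 r) \/
  x \in F /\ exists r u z, [/\ connect (rung C) r0 r, u \in C, u \in rows r, z \in comp F x & u -- z] >]].
have AP x : reflect ((exists r, x \in rows r /\ connect (rung C) r0 r) \/
  x \in F /\ exists r u z, [/\ connect (rung C) r0 r, u \in C, u \in rows r, z \in comp F x & u -- z]) (x \in A).
  by rewrite [_ \in A]in_set; exact: asboolP.
suff sub : C \subset A.
  have /AP[[r' [yr' cr']]|[/offrowsP[_ /(_ r)]]] := subsetP sub _ y0C; last by rewrite y0r.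
  by rewrite (rdis y0r yr').
apply: (conn_closed cC _ x0C).
  by apply/AP; left; exists r0; rewrite x0r; split=> //; exact: connect0.
move=> y z yC zC yA yz; apply/AP.
have [[rz zr]|nz] := pselect (exists r, z \in rows r).
  left; exists rz; split=> //.
  case/AP: yA => [[r1 [yr1 c1]]|[yF [r1 [u [w [c1 uC ur wc uw]]]]]]; apply: connect_trans c1 _; apply: connect1; apply/asboolP.
    by exists set0, y, z; split=> //; [exact: conn0 | exact: sub0set | left].
  exists (comp F y), u, z; split=> //; [exact: conn_comp | exact: comp_sub|].
  by right; exists w, y; split=> //; exact: comp_refl.
have zF : z \in F by apply/offrowsP; split=> // r1; apply/negP => ?; apply: nz; exists r1.
right; split=> //.
case/AP: yA => [[r1 [yr1 c1]]|[yF [r1 [u [w [c1 uC ur wc uw]]]]]].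
  by exists r1, y, z; split=> //; exact: comp_refl.
exists r1, u, w; split=> //.
have zc : z \in comp F y by apply: comp_closed yz => //; exact: comp_refl.
by rewrite (comp_eq yF zc).
Qed.

(* A rung, cut before its second end. *)
Lemma rung_set (C : {set G}) r r' : rung C r r' -> exists Y u y v,
  [/\ conn Y, Y \subset C, u \in Y /\ u \in rows r, forall x r2, x \in Y -> x \in rows r2 -> r2 = r &
      [/\ y \in Y, v \in C, v \in rows r' & y -- v]].
Proof.
move/asboolP => [D [u [v [cD DF [uC ur] [vC vr] h]]]].
have sub : u |: D \subset C.
  by apply/subsetP => x; rewrite in_setU1 => /orP[/eqP->//|/(subsetP DF)/offrowsP[]].
have off x r2 : x \in u |: D -> x \in rows r2 -> r2 = r.
  rewrite in_setU1 => /orP[/eqP->|/(subsetP DF)/offrowsP[_ /(_ r2)/negbTE->//]] ur2.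
  exact: rdis ur2 ur.
case: h => [uv|[x [y [xD yD ux yv]]]].
  exists [set u], u, u, v; split=> //; rewrite ?inE //; first exact: conn1.
    by rewrite sub1set.
  by move=> x r2 /set1P-> ur2; exact: rdis ur2 ur.
exists (u |: D), u, y, v; split=> //; rewrite ?in_setU1 ?eqxx ?yD ?orbT //.
exact: conn_U1 cD xD ux.
Qed.

End Rung.

Lemma rung_sym (G : sgraph) n (rows : 'I_n -> seq G) C : symmetric (rung rows C).
Proof.
suff h r r' : rung rows C r r' -> rung rows C r' r by move=> r r'; apply/idP/idP; exact: h.
move/asboolP => [D [u [v [cD DF hu hv h]]]]; apply/asboolP; exists D, v, u; split=> //.
case: h => [uv|[x [y [xD yD ux yv]]]]; first by left; rewrite sedgeC.
by right; exists y, x; split=> //; rewrite sedgeC.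
Qed.

Section Grid.
Variables (G : sgraph) (n k D : nat) (rows : 'I_n -> seq G) (cl : nat -> {set G}) (m : 'I_k -> 'I_n).
Hypothesis runiq : forall r, uniq (rows r).
Hypothesis rsort : forall r, sorted (@sedge G) (rows r).
Hypothesis rdis : forall (r r' : 'I_n) x, x \in rows r -> x \in rows r' -> r = r'.
Hypothesis cldis : forall c c' x, x \in cl c -> x \in cl c' -> c = c'.
Hypothesis clrow : forall c r, c < D.*2 -> exists2 y, y \in cl c & y \in rows r.
Hypothesis clord : forall c c' r y y', c < c' -> y \in cl c -> y' \in cl c' ->
  y \in rows r -> y' \in rows r -> index y (rows r) < index y' (rows r).
Hypothesis minj : injective m.
Hypothesis links : (forall (i j : 'I_k) c, j = i.+1 :> nat -> c < D.*2 -> rung rows (cl c) (m i) (m j)) \/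
  exists z, forall (i : 'I_k) c, c < D.*2 -> z != m i /\ rung rows (cl c) z (m i).

(** Rows are divided into zones: zone [z] begins at the first vertex of a column with index at least
    [z.*2], and so contains the crossings with columns [z.*2] and [z.*2.+1]. *)
Let late z x := `[< exists2 c, z.*2 <= c & x \in cl c >].
Let cut r z := find (late z) (rows r).

Lemma cut_le r z c x : x \in cl c -> x \in rows r -> z.*2 <= c -> cut r z <= index x (rows r).
Proof.
move=> xc xr zc; rewrite leqNgt; apply/negP => lt.
by have := before_find x lt; rewrite nth_index // => /asboolP; apply; exists c.
Qed.

Lemma cut_gt r z c x : x \in cl c -> x \in rows r -> c < z.*2 -> index x (rows r) < cut r z.
Proof.
move=> xc xr cz; case: (ltnP (cut r z) (size (rows r))) => lt; last first.
  by apply: leq_trans lt; rewrite index_mem.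
have /asboolP[c' zc' xc'] : late z (nth x (rows r) (cut r z)) by apply: nth_find; rewrite has_find.
rewrite -[cut r z in X in _ < X](@index_uniq _ x (cut r z) (rows r)) //.
by apply: clord xc xc' xr _; [exact: leq_trans zc' | exact: mem_nth].
Qed.

Lemma cut_mono r z z' : z <= z' -> cut r z <= cut r z'.
Proof.
move=> le; apply: sub_find => x /asboolP[c h1 h2]; apply/asboolP; exists c => //.
by apply: leq_trans h1; rewrite leq_double.
Qed.

Lemma cut_lt r z z' : z < z' -> z < D -> cut r z < cut r z'.
Proof.
move=> lt zD; have [|y yc yr] := @clrow z.*2 r; first by rewrite ltn_double.
by apply: leq_ltn_trans (cut_le yc yr (leqnn _)) (cut_gt yc yr _); rewrite ltn_double.
Qed.

Let zone r z := seg (rows r) (cut r z) (cut r z.+1).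

Lemma zone_in r z c x : x \in cl c -> x \in rows r -> c = z.*2 \/ c = z.*2.+1 -> x \in zone r z.
Proof.
move=> xc xr h; rewrite inE xr (cut_le xc xr) ?(cut_gt xc xr) //; case: h => ->; rewrite ?doubleS //.
Qed.

Definition bridge z (i : 'I_k) X :=
  [/\ conn X, exists2 u, u \in X & u \in zone (m i) z,
      forall x, x \in X -> (forall r, x \notin rows r) /\ (x \in cl z.*2 \/ x \in cl z.*2.+1) \/
        exists2 r, x \in zone r z & forall i', r = m i' -> i' = i &
      forall j : 'I_k, j = i.+1 :> nat -> exists y v, [/\ y \in X, v \in zone (m j) z & y -- v]].

Lemma bridge_exists z i : z < D -> exists X, bridge z i X.
Proof.
move=> zD.
have z0 : z.*2 < D.*2 by rewrite ltn_double.
have z1 : z.*2.+1 < D.*2 by rewrite -ltn_Sdouble ?ltn_double //; slia.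
have [jE|nj] := pselect (exists j : 'I_k, j = i.+1 :> nat); last first.
  have [u uc ur] := clrow (m i) z0; exists [set u]; split.
  - exact: conn1.
  - by exists u; [exact: set11 | apply: (zone_in uc ur); left].
  - move=> x /set1P->; right; exists (m i); first by apply: (zone_in uc ur); left.
    by move=> i' /minj.
  by move=> j Ej; case: nj; exists j.
have [j Ej] := jE; have uj (j' : 'I_k) : j' = i.+1 :> nat -> j' = j by move=> E; apply: ord_inj; rewrite E.
have rowX (Y : {set G}) r c x : (forall x r2, x \in Y -> x \in rows r2 -> r2 = r) -> Y \subset cl c ->
    c = z.*2 \/ c = z.*2.+1 -> (forall i', r = m i' -> i' = i) -> x \in Y ->
    (forall r, x \notin rows r) /\ (x \in cl z.*2 \/ x \in cl z.*2.+1) \/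
        exists2 r, x \in zone r z & forall i', r = m i' -> i' = i.
  move=> h Yc hc hr xY; have xc := subsetP Yc _ xY.
  have [[r2 xr2]|nr] := pselect (exists r2, x \in rows r2).
    right; exists r2; first exact: zone_in xc xr2 hc.
    by rewrite (h _ _ xY xr2).
  left; split; first by move=> r2; apply/negP => ?; apply: nr; exists r2.
  by case: hc xc => ->; [left | right].
case: links => [h|[z' h]].
  have [Y [u [y [v [cY Yc [uY ur] off [yY vc vr yv]]]]]] := rung_set rdis (h _ _ _ Ej z0).
  exists Y; split=> //.
  - by exists u => //; apply: zone_in (subsetP Yc _ uY) ur _; left.
  - by move=> x; apply: rowX off Yc _ _ => [|i' /minj]; [left|].
  move=> j' /uj->; exists y, v; split=> //; by apply: zone_in vc vr _; left.
have [zi rzi] := h i _ z0; have [zj rzj] := h j _ z1; rewrite rung_sym in rzi.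
have [Y [u [y [v [cY Yc [uY ur] off [yY vc vr yv]]]]]] := rung_set rdis rzi.
have [Y' [u' [y' [v' [cY' Yc' [uY' ur'] off' [yY' vc' vr' yv']]]]]] := rung_set rdis rzj.
have nz i' : z' = m i' -> i' = i by have [/eqP ne _] := h i' _ z0.
have vz : v \in zone z' z by apply: zone_in vc vr _; left.
have uz : u' \in zone z' z by apply: zone_in (subsetP Yc' _ uY') ur' _; right.
exists (Y :|: (zone z' z :|: Y')); split.
- apply: conn_setU => //; last first.
    by apply/touchP; exists y, v; split=> //; [rewrite in_setU vz | right].
  apply: conn_setU => //; first exact: conn_seg.
  by apply/touchP; exists u', u'; split=> //; left.
- by exists u; [rewrite in_setU uY | apply: zone_in (subsetP Yc _ uY) ur _; left].
- move=> x; rewrite !in_setU => /or3P[|xz|].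
  + by apply: rowX off Yc _ _ => [|i' /minj]; [left|].
  + by right; exists z'.
  by apply: rowX off' Yc' _ nz; right.
move=> j' /uj->; exists y', v'; split=> //; first by rewrite !in_setU yY' !orbT.
by apply: zone_in vc' vr' _; right.
Qed.

Lemma zone_eq r z z' x : x \in zone r z -> x \in zone r z' -> z = z'.
Proof.
rewrite !inE => /and3P[_ a1 a2] /and3P[_ b1 b2]; case: (ltngtP z z') => // lt.
  by have := cut_mono r lt; have := leq_ltn_trans b1 a2; slia.
by have := cut_mono r lt; have := leq_ltn_trans a1 b2; slia.
Qed.

(** Column [j] of [Gamma k] takes up [k] consecutive zones, and the bridge below row [i] lies in the
    zone [j * k + i]. All bridges are in different zones and therefore disjoint. *)
Lemma grid_model : 0 < k -> D = 2 * k * k -> exists psi, @model (Gamma k) G psi.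
Proof.
move=> k0 ED.
have gen a i h : i < k -> a < h -> a * k + i < h * k.
  move=> ik ah; apply: (@leq_trans (a.+1 * k)); first by rewrite mulSn addnC ltn_add2r.
  by rewrite leq_mul2r ah orbT.
have zD (w : Gamma k) : w.2 * k + w.1 < D.
  by rewrite ED; apply: gen.
have /choice[X hX] : forall w : Gamma k, exists X, bridge (w.2 * k + w.1) w.1 X.
  by move=> w; exact: bridge_exists.
pose blk (i : 'I_k) (j : nat) := seg (rows (m i)) (cut (m i) (j * k)) (cut (m i) (j.+1 * k)).
pose psi (w : Gamma k) := blk w.1 w.2 :|: X w.
have zblk (i i' : 'I_k) (j : nat) : zone (m i) (j * k + i') \subset blk i j.
  apply/subsetP => x; rewrite !inE => /and3P[-> a1 a2] /=; apply/andP; split.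
    by apply: leq_trans a1; apply: cut_mono; exact: leq_addr.
  apply: leq_trans a2 _; apply: cut_mono; rewrite mulSn addnC ltn_add2r //.
have blkj (i : 'I_k) (j : nat) x z : x \in blk i j -> x \in zone (m i) z -> z %/ k = j.
  rewrite !inE => /and3P[_ a1 a2] /and3P[_ b1 b2]; apply/eqP; rewrite eqn_leq -ltnS.
  rewrite ltn_divLR // leq_divRL //; apply/andP; split.
    by rewrite ltnNge; apply/negP => /(cut_mono (m i)) le; move: (leq_trans a2 le); slia.
  by rewrite leqNgt; apply/negP => /(cut_mono (m i)) le; move: (leq_trans b2 le); slia.
have divz (w : Gamma k) : (w.2 * k + w.1) %/ k = w.2 by rewrite divnMDl // divn_small ?addn0.
have blkX (w w' : Gamma k) x : x \in blk w.1 w.2 -> x \in X w' -> w.1 = w'.1 /\ w.2 = w'.2.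
  move=> xb /[dup] xX; have [_ _ h _] := hX w'.
  have xr : x \in rows (m w.1) by move: xb; rewrite inE => /andP[].
  case/h => [[/(_ (m w.1))/negP[]//]|[r xz hr]].
  have Er : r = m w.1 by apply: rdis xr; move: xz; rewrite inE => /andP[].
  rewrite (hr _ Er); split=> //; apply: ord_inj; rewrite Er in xz.
  by rewrite -(divz w') (blkj _ _ _ _ xb xz).
have blkne (i : 'I_k) (j : 'I_(2 * k)) : cut (m i) (j * k) < cut (m i) (j.+1 * k).
  apply: cut_lt; first by rewrite ltn_pmul2r.
  by rewrite ED ltn_pmul2r.
have cutsz r z : cut r z <= size (rows r) by exact: find_size.
exists psi; split.
- move=> w; have [cX [u uX uz] _ _] := hX w; apply: conn_setU => //; first exact: conn_seg.
  apply/touchP; exists u, u; split=> //; [exact: (subsetP (zblk _ _ _)) uz | by left].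
- move=> w; have [cX [u uX uz] _ _] := hX w; apply/set0Pn; exists u; rewrite in_setU uX orbT //.
- move=> w w' x xw xw'.
  suff [E1 E2] : w.1 = w'.1 /\ w.2 = w'.2 by move: E1 E2; case: (w) (w') => ? ? [? ?] /= -> ->.
  move: xw xw'; rewrite !in_setU => /orP[xb|xX] /orP[xb'|xX'].
  + have Er : m w.1 = m w'.1 by move: xb xb'; rewrite !inE => /andP[r1 _] /andP[r2 _]; exact: rdis r1 r2.
    split; first exact: minj.
    move: xb xb'; rewrite /blk -Er !inE => /and3P[_ a1 a2] /and3P[_ b1 b2]; apply: ord_inj.
    case: (ltngtP w.2 w'.2) => // lt.
      have := @cut_mono (m w.1) (w.2.+1 * k) (w'.2 * k); rewrite leq_mul2r lt orbT => /(_ isT).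
      by have := leq_ltn_trans b1 a2; slia.
    have := @cut_mono (m w.1) (w'.2.+1 * k) (w.2 * k); rewrite leq_mul2r lt orbT => /(_ isT).
    by have := leq_ltn_trans a1 b2; slia.
  + exact: blkX xb xX'.
  + by have [-> ->] := blkX _ _ _ xb' xX.
  have Ez : w.2 * k + w.1 = w'.2 * k + w'.1.
    have [_ _ /(_ _ xX) h _] := hX w; have [_ _ /(_ _ xX') h' _] := hX w'.
    case: h h' => [[nr xc]|[r xz _]] [[nr' xc']|[r' xz' _]].
    + have dbl c c' : c.*2 = c'.*2 \/ c.*2 = c'.*2.+1 \/ c.*2.+1 = c'.*2 \/ c.*2.+1 = c'.*2.+1 -> c = c' by clear; lia.
      by apply: dbl; case: xc xc' => [h1|h1] [h2|h2]; have := cldis h1 h2; auto.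
    + by have := nr r'; move: xz'; rewrite inE => /andP[->].
    + by have := nr' r; move: xz; rewrite inE => /andP[->].
    have Er : r = r' by move: xz xz'; rewrite !inE => /andP[r1 _] /andP[r2 _]; exact: rdis r1 r2.
    by rewrite -Er in xz'; exact: zone_eq xz xz'.
  have E2 : w.2 = w'.2 by apply: ord_inj; rewrite -(divz w) Ez divz.
  by split=> //; apply: ord_inj; apply: (@addnI (w.2 * k)); rewrite Ez E2.
suff arc w w' : gamma_arc w w' -> exists x y, [/\ x \in psi w, y \in psi w' & x -- y].
  move=> w w' /orP[/arc//|/arc[x [y [h1 h2 xy]]]]; exists y, x; split=> //.
  by rewrite sedgeC.
rewrite /gamma_arc /gamma_row /gamma_col /= => /orP[/andP[/eqP[E1] /eqP E2]|/and3P[/eqP[E1] /eqP E2 _]].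
  have {}E1 : w'.1 = w.1 by exact: ord_inj.
  pose a := cut (m w.1) (w'.2 * k).
  have lt1 : cut (m w.1) (w.2 * k) < a by have := blkne w.1 w.2; rewrite -E2.
  have lt2 := blkne w.1 w'.2; rewrite -/a in lt2.
  have as1 : a < size (rows (m w.1)) by apply: leq_trans lt2 (cutsz _ _).
  have a0 : 0 < a by apply: leq_ltn_trans lt1.
  have [x0 _] : exists x0 : G, True by case: (rows (m w.1)) as1 => // x0; exists x0.
  have as0 : a.-1 < size (rows (m w.1)) by apply: leq_ltn_trans as1; exact: leq_pred.
  exists (nth x0 (rows (m w.1)) a.-1), (nth x0 (rows (m w.1)) a); split.
  - rewrite in_setU inE mem_nth // index_uniq //= -E2 -/a; apply/orP; left; apply/andP; slia.
  - by rewrite in_setU /blk E1 inE mem_nth // index_uniq //= -/a leqnn lt2.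
  move: as1 (rsort (m w.1)); rewrite -(ltn_predK a0) /=; case: (rows _) => //= y p lt /(pathP x0) h.
  exact: h.
have [_ _ _ /(_ w'.1 E1)[y [v [yX vz yv]]]] := hX w.
exists y, v; rewrite !in_setU yX orbT E2; split=> //.
by rewrite (subsetP (zblk _ _ _) _ vz).
Qed.

End Grid.

Definition crow k := (k.+2 ^ k).+1.
(** There are [2 ^ (crow k * crow k)] possible rung relations on the rows; enough columns share one
    of them to give two columns to each of the [2 * k * k] zones. *)
Definition ccol k := 2 ^ (crow k * crow k) * (2 * k * k).*2.+1.

(** A path or star of rows found in one of the selected columns is valid in all of them, because
    they have the same rungs. *)
Lemma crossing_model k (G : sgraph) (rows : 'I_(crow k) -> seq G) (cols : 'I_(ccol k) -> {set G}) :
  0 < k -> crossing rows cols -> exists psi, @model (Gamma k) G psi.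
Proof.
move=> k0 [hr rdis ccon cdis [cmeet cord]].
pose f c := [set p | rung rows (cols c) p.1 p.2].
have [|A cA] := @pigeon _ _ [set: 'I_(ccol k)] f (2 * k * k).*2.+1.
  have -> : #|{set 'I_(crow k) * 'I_(crow k)}| = 2 ^ (crow k * crow k).
    by rewrite -cardsT -powersetT card_powerset cardsT card_prod card_ord.
  by rewrite cardsT card_ord /= /ccol ltn_pmul2l ?expn_gt0.
have [h [hi hA]] := incr_enum (ltnW cA).
have z0 : 0 < (2 * k * k).*2 by rewrite double_gt0 !muln_gt0 k0.
pose cl c := if insub c is Some i then cols (h i) else set0.
have clE c (lt : c < (2 * k * k).*2) : cl c = cols (h (Ordinal lt)) by rewrite /cl insubT.
have clI c x : x \in cl c -> exists2 i : 'I_((2 * k * k).*2), c = i & x \in cols (h i).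
  by rewrite /cl; case: insubP => [i _ <-|_]; [exists i | rewrite inE].
have clR c r r' : c < (2 * k * k).*2 -> rung rows (cl c) r r' = ((r, r') \in A).
  by move=> lt; rewrite (clE _ lt); have := hA (Ordinal lt); rewrite !inE => /eqP <-; rewrite inE.
have [||m [mi lk]] := @path_or_star _ (rung rows (cl 0)) k; last 1 first.
  apply: (@grid_model G _ k (2 * k * k) rows cl m) => //.
  - by move=> r; case: (hr r).
  - by move=> r; case: (hr r).
  - move=> c c' x /clI[i -> xi] /clI[j -> xj]; have := cdis _ _ _ xi xj => E.
    case: (ltngtP i j) => // lt.
      by have := hi _ _ lt; rewrite E ltnn.
    by have := hi _ _ lt; rewrite E ltnn.
  - by move=> c r lt; rewrite (clE _ lt); exact: cmeet.
  - move=> c c' r y y' lt /clI[i Ei yi] /clI[j Ej yj]; apply: cord yi yj.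
    by apply: hi; rewrite -Ei -Ej.
  case: lk => [lk|[z lk]]; [left=> i j c Ej lt | right; exists z => i c lt].
    by rewrite clR // -(clR 0) //; exact: lk.
  by have [zi] := lk i; split=> //; rewrite clR // -(clR 0).
- by move=> r r'; rewrite (clE _ z0); apply: rung_conn => //; exact: cmeet.
by rewrite card_ord.
Qed.

(** * The grid theorem *)

(** The stretch from the last vertex in [A] before the first vertex in [B]. *)
Lemma trim (G : sgraph) (K A B : {set G}) s : apath (arcs (K :|: (A :|: B))) A B s -> [disjoint A & B] ->
  exists a t b, [/\ a \in A, b \in B, path (@sedge G) a (rcons t b), {subset t <= K} & {subset t <= s}].
Proof.
move=> ap dAB.
have sR x : x \in s -> x \in K :|: (A :|: B).
  by move/(apath_in ap (subset_trans (subsetUl A B) (subsetUr K _))).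
have hB : has (mem B) s.
  case: s ap {sR} => // x p /and4P[_ _ _ lB]; apply/hasP; exists (last x p) => //; exact: mem_last.
have [s1 [b [s2 [E bB nB]]]] := first_split hB.
have hA : has (mem A) s1.
  case: s1 E nB => [|x s1] E nB; last first.
    by move: ap; rewrite E => /and4P[_ _ /= -> _].
  by move: ap; rewrite E => /and4P[_ _ bA _]; case: (disjP dAB bA bB).
have [t1 [a [t [E1 aA nA]]]] := last_split hA.
exists a, t, b; split=> //.
- have [_ + _ _ _] := apathP a ap; rewrite E E1 -!catA sorted_split => /andP[_].
  rewrite -[X in is_true X -> _]/(path (arc (arcs (K :|: (A :|: B)))) a (t ++ b :: s2)) -cat_rcons cat_path => /andP[pp _]; apply: sub_path pp => x y.
  by rewrite arcsE => /and3P[].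
- move=> x xt; have : x \in s by rewrite E E1 !mem_cat inE xt !orbT.
  move/sR; rewrite !in_setU => /or3P[//|xA|xB].
    by move/hasPn: nA => /(_ x xt)/negP; case.
  by move/hasPn: nB => /(_ x); rewrite E1 mem_cat inE xt !orbT => /(_ isT)/negP; case.
by move=> x xt; rewrite E E1 !mem_cat inE xt !orbT.
Qed.

Lemma min_linkage (G : sgraph) (R A B : {set G}) n m (Q : 'I_m -> {set G}) (P : 'I_n -> seq G) :
  linkage (arcs R) A B P -> exists P0 : 'I_n -> seq G, linkage (arcs R) A B P0 /\
    forall P' : 'I_n -> seq G, linkage (arcs R) A B P' -> cost Q P0 <= cost Q P'.
Proof.
move=> lP; have ex : exists c, `[< exists P0 : 'I_n -> seq G, linkage (arcs R) A B P0 /\ cost Q P0 = c >].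
  by exists (cost Q P); apply/asboolP; exists P.
have [c /asboolP[P0 [l0 Ec]] mn] := ex_minnP ex.
exists P0; split=> // P' l'; rewrite Ec; apply: mn; apply/asboolP; by exists P'.
Qed.

Lemma linkage_sub (G : sgraph) (E : {set G * G}) (A B : {set G}) n n' (P : 'I_n -> seq G) (J : {set 'I_n}) :
  linkage E A B P -> n' <= #|J| -> exists2 h : 'I_n' -> 'I_n, (forall i, h i \in J) & linkage E A B (P \o h).
Proof.
move=> [ap dj] cJ; exists (fun i => enum_val (widen_ord cJ i)); first by move=> i; exact: enum_valP.
split=> [i|i j x xi xj]; first exact: ap.
have /enum_val_inj/(congr1 val) /= E0 := dj _ _ _ xi xj; exact: ord_inj.
Qed.

Section Iter.
Variables (n1 d : nat).
Hypothesis n1p : 0 < n1.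

(** Paths per demand that suffice for [M] demands. The first entry is for the demands still to come:
    [kbound M'] of the paths are kept, or else they are dense enough for [n1] rows. The second is
    for the demand being treated, with a factor [M'] for the pigeonhole principle over the other
    demands. *)
Fixpoint kbound M : nat := if M is M'.+1 then
  maxn (kbound M' * n1) (M' * (kbound M' * (d * (kbound M' * n1).*2))).+1 else 0.

(** If one path of the first demand avoids many paths of every other demand, it is taken and the
    rest is linked off it. Otherwise each path of the first demand meets almost all paths of some
    other one; a demand that occurs often yields a crossing. *)
Lemma link_all (G : sgraph) (I : finType) (A B : I -> {set G}) (l : seq I) (K : {set G}) : uniq l ->
  (forall e, [disjoint A e & B e]) ->
  (forall e e' x, x \in A e :|: B e -> x \in A e' :|: B e' -> e = e') ->
  (forall e, [disjoint A e :|: B e & K]) ->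
  (forall e, e \in l -> exists P : 'I_(kbound (size l)) -> seq G, linkage (arcs (K :|: (A e :|: B e))) (A e) (B e) P) ->
  (exists (rows : 'I_n1 -> seq G) (cols : 'I_d -> {set G}), crossing rows cols) \/
  exists t : I -> seq G, [/\ forall e, e \in l -> {subset t e <= K},
    forall e e' x, e \in l -> e' \in l -> x \in t e -> x \in t e' -> e = e' &
    forall e, e \in l -> exists a b, [/\ a \in A e, b \in B e & path (@sedge G) a (rcons (t e) b)]].
Proof.
move=> ul dAB dAA; elim: l K ul => [|e0 l IH] K /=.
  by move=> _ _ _; right; exists (fun _ => [::]).
move=> /andP[e0l ul] dK hl; set n := kbound (size l) in hl *.
set k2 := n * n1 in hl; set k1 := (_ * _).+1 in hl.
have sub q e : e \in e0 :: l -> q <= maxn k2 k1 ->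
    exists P : 'I_q -> seq G, linkage (arcs (K :|: (A e :|: B e))) (A e) (B e) P.
  move=> el le; have [P lP] := hl e el.
  by have [|h _ lh] := @linkage_sub _ _ _ _ _ q P [set: _] lP; [rewrite cardsT card_ord | exists (P \o h)].
have [P0 [ap0 dj0]] := sub k1 e0 (mem_head _ _) (leq_maxr _ _).
have /choice[t0 ht0] : forall i, exists t, exists a b, [/\ a \in A e0, b \in B e0,
    path (@sedge G) a (rcons t b), {subset t <= K} & {subset t <= P0 i}].
  by move=> i; have [a [t [b h]]] := trim (ap0 i) (dAB e0); exists t, a, b.
pose Q i := [set x in t0 i].
have QK i : Q i \subset K.
  by apply/subsetP => x; rewrite inE; have [a [b [_ _ _ h _]]] := ht0 i; exact: h.
have Qconn i : conn (Q i).
  have [a [b [_ _ h _ _]]] := ht0 i; apply: conn_sorted.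
  by move: h; rewrite rcons_path => /andP[/path_sorted].
have Qdis i j x : x \in Q i -> x \in Q j -> i = j.
  rewrite !inE => xi xj; have [_ [_ [_ _ _ _ si]]] := ht0 i; have [_ [_ [_ _ _ _ sj]]] := ht0 j.
  exact: dj0 (si _ xi) (sj _ xj).
have /choice[P hP] : forall e, exists P : 'I_k2 -> seq G, e \in l ->
    linkage (arcs (K :|: (A e :|: B e))) (A e) (B e) P /\
    forall P' : 'I_k2 -> seq G, linkage (arcs (K :|: (A e :|: B e))) (A e) (B e) P' -> cost Q P <= cost Q P'.
  move=> e; case: (boolP (e \in l)) => el; last by exists (fun _ => [::]).
  have [|P1 /(min_linkage Q)[P2 h]] := sub k2 e _ (leq_maxl _ _); first by rewrite inE el orbT.
  by exists P2.
pose miss e i := [set j | [disjoint Q i & [set x in P e j]]].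
have [[i hi]|no] := pselect (exists i, forall e, e \in l -> n <= #|miss e i|).
  have [//||e el|cr|[t [tK tdis tpath]]] := IH (K :\: Q i).
  - by move=> e; apply: disjointWr (dK e); exact: subsetDl.
  - have [lP _] := hP _ el; have [h hJ lh] := linkage_sub lP (hi _ el); exists (P e \o h).
    have [ap dj] := lh; split=> // j; apply: apath_mono (ap j) _ => s1 a b s2 E.
    rewrite !inE /= => /and3P[ab].
    have nQ x : x \in P e (h j) -> x \notin t0 i.
      move=> xP; apply/negP => xt; have := hJ j; rewrite inE => dis; apply: (disjP dis (x := x)); rewrite inE //.
    have -> : a \notin t0 i by apply: nQ; rewrite [P e (h j)]E mem_cat inE eqxx orbT.
    have -> : b \notin t0 i by apply: nQ; rewrite [P e (h j)]E mem_cat !inE eqxx !orbT.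
    by rewrite ab => -> ->.
  - by left.
  right; exists (fun e => if e == e0 then t0 i else t e); split.
  - move=> e; rewrite inE; case: eqP => [-> _|_ /= el].
      by have [a [b [_ _ _ h _]]] := ht0 i.
    by move=> x /(tK e el); rewrite in_setD => /andP[].
  - have tQ e x : e \in l -> x \in t e -> x \notin t0 i.
      by move=> el /(tK e el); rewrite !inE => /andP[].
    move=> e e' x; rewrite !inE; case: eqP => [->|_] /=; case: eqP => [->|_] //=.
    + by move=> _ /tQ h xt /h; rewrite xt.
    + by move=> /tQ h _ /h /negbTE->.
    exact: tdis.
  move=> e; rewrite inE; case: eqP => [-> _|_ /= /tpath//].
  by have [a [b [h1 h2 h3 _ _]]] := ht0 i; exists a, b.
left; have /choice[f hf] : forall i, exists e, e \in l /\ #|miss e i| < n.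
  move=> i; apply: contrapT => ne; apply: no; exists i => e el; rewrite leqNgt; apply/negP => lt.
  by apply: ne; exists e.
have [z0 _] : exists z0 : 'I_(size l), True.
  have k1p : 0 < k1 by [].
  have [e0l' _] := hf (Ordinal k1p); have : 0 < size l by case: (l) e0l'.
  by move=> h; exists (Ordinal h).
pose g i := odflt z0 (insub (index (f i) l)).
have gE i : nth e0 l (g i) = f i.
  have [fl _] := hf i; have lt : index (f i) l < size l by rewrite index_mem.
  by rewrite /g (insubT (fun i => i < size l) lt) /= nth_index.
have [|z hz] := @pigeon _ _ [set: 'I_k1] g (n * (d * k2.*2)).+1.
  by rewrite cardsT !card_ord /k1 /k2 ltnS.
have zl : nth e0 l z \in l by rewrite mem_nth.
have [lP mP] := hP _ zl.
apply: (@dense_crossing G (K :|: (A (nth e0 l z) :|: B (nth e0 l z))) _ _ k2 k1 Q (P (nth e0 l z)) _ Qconn Qdis lP mP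
  d n n1 [set i in [set: _] | g i == z] n1p erefl) => //.
  by move=> i; apply: subset_trans (QK i) (subsetUl _ _).
move=> i; rewrite !inE /= => /eqP <-; rewrite gE; by case: (hf i).
Qed.

End Iter.

Lemma chunks (T : finType) (X : {set T}) q r : q * r <= #|X| -> exists f : 'I_r -> {set T},
  (forall i, f i \subset X /\ q <= #|f i|) /\ forall i j x, x \in f i -> x \in f j -> i = j.
Proof.
move=> qr; exists (fun i : 'I_r => [set x in X | index x (enum X) %/ q == i]); split=> [i|i j x].
  split; first by apply/subsetP => x; rewrite inE => /andP[].
  have [->//|q0] := posnP q.
  have lt (j : 'I_q) : i * q + j < #|X|.
    apply: leq_trans qr; apply: (@leq_trans (i.+1 * q)); first by rewrite mulSn addnC ltn_add2r.
    by rewrite mulnC leq_mul2l (ltn_ord i) orbT.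
  have inj : injective (fun j : 'I_q => enum_val (Ordinal (lt j))).
    by move=> j j' /enum_val_inj/(congr1 val) /= /addnI/ord_inj.
  rewrite -[X in X <= _]card_ord -cardsT -(card_imset _ inj); apply: subset_leq_card.
  apply/subsetP => _ /imsetP[j _ ->]; rewrite inE enum_valP /=.
  have x0 := enum_val (Ordinal (lt j)).
  rewrite (enum_val_nth x0) /= index_uniq ?enum_uniq -?cardE //.
  by rewrite divnMDl // divn_small // addn0.
by rewrite !inE => /andP[_ /eqP Ei] /andP[_ /eqP Ej]; apply: ord_inj; rewrite -Ei -Ej.
Qed.

(** A mesh with a set for every vertex of [Gamma k] provides the vertices of the model, and
    [link_all] either joins them through [K] as required or gives a crossing. *)
Theorem grid_theorem k : exists N, forall (G : sgraph) (P : {set {set G}}),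
  bramble P N -> exists psi, @model (Gamma k) G psi.
Proof.
have [->|k0] := posnP k.
  by exists 0 => G P _; exists (fun _ => set0); split=> -[[]].
pose l := enum [set e : Gamma k * Gamma k | gamma_arc e.1 e.2].
pose q := kbound (crow k) (ccol k) (size l).
pose U : finType := (Gamma k * Gamma k * bool)%type.
(* Room for a block of [q] boundary vertices for each ordered pair and each of its ends; the
   successor keeps the sets nonempty also for [q = 0]. *)
pose c (w : Gamma k) := (q * #|U|).+1.
(* The summand [q] is the slack that [mesh_linked] asks for. *)
exists (\sum_w c w + q).+1 => G P brP.
have [|K [T M]] := mesh_exists brP (c := c); first by rewrite ltnS leq_addr.
have [bK cT dT TK cov cc sw tight] := M.
have /choice[f hf] : forall g, exists f : 'I_#|U| -> {set G},
  (forall i, f i \subset NB K :&: T g /\ q <= #|f i|) /\ forall i j x, x \in f i -> x \in f j -> i = j.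
  by move=> g; apply: chunks; rewrite cc.
pose grp (u : U) := if u.2 then u.1.1 else u.1.2.
pose blk (u : U) := f (grp u) (enum_rank u).
have blkT u x : x \in blk u -> x \in NB K /\ x \in T (grp u).
  by have [h _] := hf (grp u); have [/subsetP s _] := h (enum_rank u) => /s/setIP.
have blkq u : q <= #|blk u| by have [h _] := hf (grp u); have [] := h (enum_rank u).
have blkd u u' x : x \in blk u -> x \in blk u' -> u = u'.
  move=> xu xu'; have [_ x1] := blkT _ _ xu; have [_ x2] := blkT _ _ xu'.
  move: xu xu'; rewrite /blk (dT _ _ _ x1 x2) => xu xu'.
  by have [_ h] := hf (grp u'); apply: enum_rank_inj; exact: h xu xu'.
pose A e := blk (e, true); pose B e := blk (e, false).
have dAB e : [disjoint A e & B e].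
  by rewrite -[_ (mem _) _]negbK; apply/disjointNP => -[y y1 y2]; have := blkd _ _ _ y1 y2.
have [||||] := @link_all (crow k) (ccol k) isT G _ A B l K (enum_uniq _) dAB.
- move=> e e' x; rewrite !in_setU => /orP[] x1 /orP[] x2; by have [] := blkd _ _ _ x1 x2.
- move=> e; rewrite -[_ (mem _) _]negbK; apply/disjointNP => -[y]; rewrite in_setU.
  by move=> /orP[] /blkT[_ yT] yK; exact: TK yT yK.
- move=> e _; apply: (mesh_linked brP M) => //.
  + by apply/subsetP => x /blkT[].
  + by apply/subsetP => x /blkT[].
  + exact: blkq.
  + exact: blkq.
  by rewrite sw leqnSn.
- by move=> [rows [cols cr]]; exact: crossing_model cr.
move=> [t [tK tdis tpath]].
pose psi w := T w :|: \bigcup_(e | [&& e \in l, e.1 == w & t e != [::]]) [set x in t e].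
have psiP w x : x \in psi w -> x \in T w \/ exists e, [/\ e \in l, e.1 = w & x \in t e].
  rewrite in_setU => /orP[|]; first by left.
  move=> /bigcupP[e /and3P[el /eqP e1 _]]; rewrite inE => xt.
  by right; exists e.
have psiT w x : x \in T w -> x \in psi w by rewrite in_setU => ->.
have psit e x : e \in l -> x \in t e -> x \in psi e.1.
  move=> el xt; rewrite in_setU; apply/orP; right; apply/bigcupP; exists e; rewrite ?inE //.
  by rewrite el eqxx /=; case: (t e) xt.
exists psi; split.
- move=> w1; apply: conn_bigcup => // e /and3P[el /eqP <- te].
  have [a [b [/blkT[_ aT] bB]]] := tpath _ el; rewrite rcons_path => /andP[pt _]; split.
    by apply: conn_sorted; exact: path_sorted pt.
  case: (t e) te pt => // y s _ /= /andP[ay _]; apply/touchP; exists a, y.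
  by rewrite inE mem_head; split=> //; right.
- move=> g; have : 0 < #|NB K :&: T g| by rewrite cc.
  by case/card_gt0P => x /setIP[_ xT]; apply/set0Pn; exists x; exact: psiT.
- move=> g h x /psiP[xg|[e [el <- xe]]] /psiP[xh|[e' [el' <- xe']]].
  + exact: dT xg xh.
  + by case: (TK _ _ xg); exact: tK xe'.
  + by case: (TK _ _ xh); exact: tK xe.
  by rewrite (tdis _ _ _ el el' xe xe').
suff arc w1 w2 : gamma_arc w1 w2 -> exists x y, [/\ x \in psi w1, y \in psi w2 & x -- y].
  move=> w1 w2 /orP[/arc//|/arc[x [y [h1 h2 xy]]]]; exists y, x; split=> //.
  by rewrite sedgeC.
move=> a12; have el : (w1, w2) \in l by rewrite mem_enum inE.
have [a [b [aA bB]]] := tpath _ el.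
have aT : a \in psi w1 by have [_ /psiT] := blkT _ _ aA.
have bT : b \in psi w2 by have [_ /psiT] := blkT _ _ bB.
case/lastP Et : (t (w1, w2)) => [|s z]; first by rewrite /= andbT => ab; exists a, b.
rewrite rcons_path last_rcons => /andP[_ zb]; exists z, b; split=> //.
by apply: (psit _ z el); rewrite Et mem_rcons mem_head.
Qed.

(** * Brambles from treewidth *)

Lemma connected_induced (G : sgraph) (A : {set G}) : connected (induced A) <-> conn A.
Proof.
split=> [h|/connP h].
  suff sub (a b : induced A) : connect (rin A) (val a) (val b).
    by apply/connP => x y xA yA; exact: (sub (exist _ x xA) (exist _ y yA)).
  have /connectP[p pp ->] := h a b; apply/connectP; exists (map val p); last by rewrite last_map.
  by rewrite path_map; apply: sub_path pp => x y xy; apply/and3P; split; [exact: xy | exact: valP | exact: valP].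
move=> [x xA] [y yA]; have /connectP[p pp Ey] := h _ _ xA yA.
elim: p x xA pp Ey => [|z p IH] x xA /=.
  by move=> _ Ey; have -> : exist _ x xA = exist (fun x => x \in A) y yA by apply: val_inj.
move=> /andP[/and3P[xz _ zA] pz] Ey; apply: connect_trans (IH z zA pz Ey); exact: connect1.
Qed.

Lemma connectedP (G : sgraph) : connected G <-> conn [set: G].
Proof.
split=> [h|/connP h x y].
  apply/connP => x y _ _; apply: connect_sub (h x y) => a b ab.
  by apply: connect1; rewrite /rin /= ab !inE.
by apply: connect_sub (h x y (in_setT _) (in_setT _)) => a b /and3P[ab _ _]; exact: connect1.
Qed.

Lemma conn_imset (G H : sgraph) (f : G -> H) (A : {set G}) :
  (forall x y, x -- y -> f x -- f y) -> conn A -> conn (f @: A).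
Proof.
move=> hf /connP cA; apply/connP => _ _ /imsetP[x xA ->] /imsetP[y yA ->].
have /connectP[p pp ->] := cA _ _ xA yA; elim: p x xA pp => [|z p IH] x xA /=; first by rewrite connect0.
move=> /andP[/and3P[xz _ zA] pz]; apply: connect_trans (IH z zA pz).
by apply: connect1; rewrite /rin /= hf //= !imset_f.
Qed.

Section Leaf.
Variables (T : sgraph) (t0 : T).

Definition leaf_edge : rel (option T) := fun a b => match a, b with
  | Some x, Some y => x -- y
  | Some x, None | None, Some x => x == t0
  | None, None => false end.

Lemma leaf_sym : symmetric leaf_edge.
Proof. by move=> [x|] [y|] //=; exact: sedgeC. Qed.

Lemma leaf_irrefl : irreflexive leaf_edge.
Proof. by move=> [x|] //=; exact: sedgexx. Qed.

Definition add_leaf : sgraph := SGraph leaf_sym leaf_irrefl.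

(** On a cycle through [None] both neighbours of [None] would be [t0]. *)
Lemma tree_add_leaf : tree T -> tree add_leaf.
Proof.
move=> [T0 conT acT]; split.
- by apply/card_gt0P; exists None.
- apply/connectedP; have -> : [set: add_leaf] = (None : add_leaf) |: [set (Some x : add_leaf) | x in [set: T]].
    by apply/esym/setP => -[x|]; rewrite !inE ?eqxx //; apply/imsetP; exists x.
  apply: (@conn_U1 add_leaf _ _ (Some t0)); last exact: eqxx.
    by apply: (@conn_imset T add_leaf); [|exact/connectedP].
  by apply/imsetP; exists t0.
move=> c sc uc; apply/negP => cc.
have [Nc|Nc] := boolP ((None : add_leaf) \in c).
  have [i c' Ec] := rot_to Nc.
  have : cycle (@sedge add_leaf) (None :: c') by rewrite -Ec rot_cycle.
  have : uniq (None :: c') by rewrite -Ec rot_uniq.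
  have : 2 < size (None :: c') by rewrite -Ec size_rot.
  case: c' {Ec} => [|a c'] //; case/lastP: c' => [|c' b] // _ /=.
  rewrite rcons_path last_rcons !inE !mem_rcons !inE !negb_or => /andP[_ /andP[/andP[ab _] _]].
  case: a ab => [a|] //=; case: b => [b|] ab /= /andP[/eqP Ea /andP[_ Eb]]; last by [].
  by move: ab; rewrite Ea (eqP Eb) eqxx.
have [c0 Ec] : exists c0 : seq T, c = map Some c0.
  exists (pmap id c); elim: (c) Nc => //= -[x|] s IH; rewrite inE //= => /IH {1}->.
  by [].
have := acT c0; rewrite -(size_map (@Some T)) -Ec => /(_ sc).
have : uniq c0 by move: uc; rewrite Ec (map_inj_uniq Some_inj).
by move=> -> /(_ isT)/negP; apply; move: cc; rewrite Ec; case: (c0) => //= x s; rewrite -map_rcons path_map.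
Qed.

End Leaf.

Section Bramble.
Variables (G : sgraph) (N : nat).
Hypothesis N0 : 0 < N.
Hypothesis noB : forall P : {set {set G}}, bramble P N -> False.

(** Otherwise every [S] leaves a component with more than [N] of the at most [N.*2.+1] vertices of
    [W]. Any two such components share a vertex of [W], and they form a bramble. *)
Lemma balanced (W : {set G}) : #|W| <= N.*2.+1 ->
  exists S : {set G}, #|S| < N /\ forall x, x \notin S -> #|W :&: comp (~: S) x| <= N.
Proof.
move=> WN; apply: contrapT => nS.
have /choice[f hf] : forall S : {set G}, exists x, #|S| < N -> x \notin S /\ N < #|W :&: comp (~: S) x|.
  move=> S; case: (boolP (#|S| < N)) => SN; last first.
    have [x _] : exists x : G, True; last by exists x.
    apply: contrapT => nx; apply: nS; exists set0; rewrite cards0; split=> // x; case: nx; by exists x.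
  apply: contrapT => nx; apply: nS; exists S; split=> // x xS; rewrite leqNgt; apply/negP => lt.
  by apply: nx; exists x.
suff br : bramble [set comp (~: S) (f S) | S in [set S : {set G} | #|S| < N]] N by exact: noB br.
split.
- by move=> _ /imsetP[S + ->]; rewrite inE => /hf[h _]; apply: conn_comp; rewrite inE.
- move=> _ _ /imsetP[S + ->] /imsetP[S' + ->]; rewrite !inE => /hf[_ h] /hf[_ h'].
  have /set0Pn[x] : (W :&: comp (~: S) (f S)) :&: (W :&: comp (~: S') (f S')) != set0.
    rewrite -card_gt0; have := cardsUI (W :&: comp (~: S) (f S)) (W :&: comp (~: S') (f S')).
    have : #|(W :&: comp (~: S) (f S)) :|: (W :&: comp (~: S') (f S'))| <= #|W|.
      by apply: subset_leq_card; rewrite subUset !subsetIl.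
    slia.
  by rewrite !in_setI => /andP[/andP[_ x1] /andP[_ x2]]; apply/touchP; exists x, x; split=> //; left.
move=> Y YN; exists (comp (~: Y) (f Y)); first by apply/imsetP; exists Y; rewrite ?inE.
have [h _] := hf Y YN; have sub : comp (~: Y) (f Y) \subset ~: Y by apply: comp_sub; rewrite inE.
rewrite -[_ (mem _) _]negbK; apply/disjointNP => -[y /(subsetP sub) + yY].
by rewrite inE yY.
Qed.

(** A tree decomposition of the graph outside [U] that can be continued into each component of [U],
    because the boundary of the component is small and lies in one bag. *)
Definition pd (T : sgraph) (B : T -> {set G}) (U : {set G}) :=
  [/\ tree T, forall v, conn [set t | v \in B t], forall t, #|B t| <= 3 * N,
      forall v, (v \in U) = [forall t, v \notin B t] &
      (forall u v, u -- v -> u \notin U -> v \notin U -> exists t, (u \in B t) && (v \in B t)) /\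
      (forall x, x \in U -> #|NB (comp U x)| <= N.*2 /\ exists t, NB (comp U x) \subset B t)].

(** The new bag, a leaf of the tree, has at most [(2N + 1) + (N - 1)] vertices. A component left
    over inside [C] sees at most [N] vertices of [W], by balance, and fewer than [N] of [S]. *)
Lemma pd_step (T : sgraph) (B : T -> {set G}) U x : pd B U -> x \in U ->
  exists (T' : sgraph) (B' : T' -> {set G}) U', pd B' U' /\ #|U'| < #|U|.
Proof.
move=> [trT con card UE [edges comps]] xU.
set C := comp U x; have [NC [t0 NCt0]] := comps _ xU; rewrite -/C in NC NCt0.
have xC : x \in C := comp_refl _ _.
have CU : C \subset U := comp_sub xU.
have NCU y : y \in NB C -> y \notin U by move/(subsetP (NB_comp xU)); rewrite inE.
(* The vertex [x] is added so that [U] shrinks. *)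
pose W := x |: NB C.
have WN : #|W| <= N.*2.+1 by rewrite cardsU1; case: (_ \notin _); slia.
have [S [SN hS]] := balanced WN.
pose bag := W :|: (S :&: C).
have bagC y : y \in bag -> y \in C \/ y \in NB C.
  by rewrite !in_setU in_set1 in_setI => /orP[/orP[/eqP->|]|/andP[_]]; auto.
have NCbag y : y \in NB C -> y \in bag by move=> h; rewrite !in_setU h orbT.
pose B' (t : add_leaf t0) := if t is Some s then B s else bag.
pose U' := U :\: bag.
have U'U : U' \subset U by exact: subsetDl.
have U'E y : (y \in U') = (y \notin bag) && (y \in U) by rewrite in_setD.
have clo y z : y \in C -> y -- z -> z \in C \/ z \in NB C.
  move=> yC yz; case: (boolP (z \in C)) => zC; first by left.
  by right; apply/NBP; split=> //; exists y.
exists (add_leaf t0), B', U'; split; last first.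
  apply: proper_card; rewrite properE U'U; apply/subsetPn; exists x => //.
  by rewrite U'E !in_setU in_set1 eqxx.
split.
- exact: tree_add_leaf.
- move=> v; pose A := [set (Some t : add_leaf t0) | t in [set t | v \in B t]].
  have cA : conn A by exact: (@conn_imset T (add_leaf t0)).
  have inA t : (Some t \in A) = (v \in B t).
    apply/imsetP/idP => [[s + [->]]|vt]; first by rewrite inE.
    by exists t; rewrite ?inE.
  have NA : (None : add_leaf t0) \notin A by apply/negP => /imsetP[].
  have E : [set t | v \in B' t] = if v \in bag then None |: A else A.
    apply/setP => -[t|]; case: ifP => vb; rewrite [LHS]in_set /= ?in_setU1 ?inA ?eqxx //.
    by rewrite (negbTE NA) vb.
  rewrite E; case: ifP => // vb.
  case: (bagC _ vb) => [vC|vN]; last first.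
    by apply: (@conn_U1 (add_leaf t0) _ _ (Some t0)) => //; [rewrite inA (subsetP NCt0) | exact: eqxx].
  have -> : A = set0; last by rewrite setU0; exact: conn1.
  apply/setP => -[t|]; rewrite ?inA ?(negbTE NA) !inE //.
  by have := subsetP CU _ vC; rewrite UE => /forallP/(_ t)/negbTE.
- move=> [t|] /=; first exact: card.
  have := (leq_card_setU W (S :&: C)).1; have := subset_leq_card (subsetIl S C); rewrite -/bag.
  move: WN SN; slia.
- move=> v; rewrite U'E UE; apply/andP/forallP => [[vb /forallP h] [t|]|h]; [exact: h | exact: vb |].
  split; first exact: (h (None : add_leaf t0)).
  by apply/forallP => t; exact: (h (Some t : add_leaf t0)).
split.
  have half u v : u \in U -> u -- v -> u \notin U' -> v \notin U' -> (u \in bag) && (v \in bag).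
    move=> uU uv; rewrite !U'E uU andbT negbK => ub; rewrite ub /=.
    case: (bagC _ ub) => [uC|/NCU]; last by rewrite uU.
    case: (clo _ _ uC uv) => [vC|/NCbag->//]; by rewrite (subsetP CU _ vC) andbT negbK.
  move=> u v uv uU' vU'; case: (boolP (u \in U)) => uU; first by exists None; exact: half.
  case: (boolP (v \in U)) => vU; first by exists None; rewrite andbC; apply: half; rewrite 1?sedgeC.
  by have [t h] := edges _ _ uv uU vU; exists (Some t).
move=> y yU'; have yU := subsetP U'U _ yU'.
have [yC|yC] := boolP (y \in C).
  have C'C : comp U' y \subset C.
    rewrite /C -(comp_eq xU yC); apply: (comp_max yU (conn_comp yU')); last exact: comp_refl.
    by apply: subset_trans U'U; exact: comp_sub.
  have C'S : comp U' y \subset ~: S.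
    apply/subsetP => z zC'; rewrite in_setC; apply/negP => zS.
    have := subsetP (comp_sub yU') _ zC'; rewrite U'E => /andP[/negP zb _]; apply: zb.
    by rewrite in_setU in_setI zS (subsetP C'C) ?orbT.
  have yS : y \notin S by have := subsetP C'S y (comp_refl _ _); rewrite inE.
  have NC'bag z : z \in NB (comp U' y) -> z \in bag.
    move=> zN; have /NBP[zC' [w wC' wz]] := zN.
    case: (clo _ _ (subsetP C'C _ wC') wz) => [zC|]; last exact: NCbag.
    have := subsetP (NB_comp yU') _ zN; rewrite in_setC U'E (subsetP CU _ zC) andbT negbK //.
  split; last by exists None; apply/subsetP.
  have sub : NB (comp U' y) \subset (W :&: comp (~: S) y) :|: S.
    apply/subsetP => z zN; rewrite in_setU; case: (boolP (z \in S)); rewrite ?orbT // orbF => zS.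
    have := NC'bag _ zN; rewrite in_setU !in_setI (negbTE zS) orbF => -> /=.
    have /NBP[_ [w wC' wz]] := zN.
    have wC'' : w \in comp (~: S) y.
      have yS' : y \in ~: S by rewrite in_setC.
      exact: (subsetP (comp_max yS' (conn_comp yU') C'S (comp_refl _ _))).
    by apply: comp_closed wz; rewrite ?in_setC.
  have := subset_leq_card sub; have := (leq_card_setU (W :&: comp (~: S) y) S).1.
  have := hS y yS; move: SN; slia.
have dis : [disjoint comp U y & C].
  rewrite -[_ (mem _) _]negbK; apply/disjointNP => -[z zy zC].
  by case/negP: yC; rewrite /C -(comp_eq xU zC) (comp_eq yU zy) comp_refl.
have E : comp U' y = comp U y.
  apply/eqP; rewrite eqEsubset; apply/andP; split.
    apply: (comp_max yU (conn_comp yU')); last exact: comp_refl.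
    by apply: subset_trans U'U; exact: comp_sub.
  apply: (comp_max yU' (conn_comp yU)); last exact: comp_refl.
  apply/subsetP => z zy; have zU := subsetP (comp_sub yU) _ zy; rewrite U'E zU andbT.
  apply/negP => /bagC[|/NCU]; last by rewrite zU.
  exact: disjP dis zy.
have [h1 [t h2]] := comps _ yU; rewrite E; split=> //; by exists (Some t).
Qed.

Lemma treewidth_le : treewidth G <= 3 * N.
Proof.
have [n] : exists n : nat, exists (T : sgraph) (B : T -> {set G}) U, pd B U /\ #|U| < n.
  have sym : symmetric (fun _ _ : unit => false) by [].
  have irr : irreflexive (fun _ : unit => fun _ : unit => false) by [].
  exists #|G|.+1, (SGraph sym irr), (fun _ => set0), [set: G]; rewrite cardsT; split=> //; split.
  - split; first by rewrite card_unit.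
    + by move=> [] []; exact: connect0.
    + by case=> [|[] [|[] c]].
  - move=> v; have -> : [set t : SGraph sym irr | v \in set0] = set0 by apply/setP => t; rewrite !inE.
    exact: conn0.
  - by move=> t; rewrite cards0.
  - by move=> v; rewrite inE; apply/esym/forallP => t; rewrite inE.
  split=> [u v _|x _]; first by rewrite inE.
  have -> : NB (comp [set: G] x) = set0.
    by apply/setP => y; rewrite in_set0; apply/negP => /(subsetP (NB_comp (in_setT x))); rewrite setCT inE.
  by rewrite cards0; split=> //; exists tt; exact: sub0set.
elim: n => [|n IH] [T [B [U [hpd Un]]]] //.
have [U0|[x xU]] := set_0Vmem U; last first.
  by have [T' [B' [U' [h lt]]]] := pd_step hpd xU; apply: IH; exists T', B', U'; split=> //; exact: leq_trans lt _.
have [trT con card UE [edges _]] := hpd.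
have td : tree_decomposition B.
  split=> //.
  - move=> v; apply: contrapT => nt; have := UE v; rewrite U0 inE => /esym/negP; apply.
    by apply/forallP => t; apply/negP => vt; apply: nt; exists t.
  - by move=> u v uv; apply: edges; rewrite // U0 inE.
  by move=> v; apply/connected_induced.
rewrite /treewidth; case: ex_minnP => m _ /(_ (width B)) h; apply: leq_trans (h _) _.
  by apply/asboolP; exists T, B.
rewrite /width; apply: leq_trans (leq_pred _) _; apply/bigmax_leqP => t _; exact: card.
Qed.

End Bramble.

(** * From wall models to induced subdivisions *)

Section Spider.
Variable G : sgraph.
Implicit Types (A : {set G}) (x y z s a b c r t : G) (L M : seq G).

Lemma ipath_gap p1 p2 p3 x y : ipath (p1 ++ p2 ++ p3 : seq G) -> p2 != [::] -> x \in p1 -> y \in p3 ->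
  x != y /\ ~~ (x -- y).
Proof.
move=> ip p0 /path.splitPr xp /path.splitPr yp; case: xp yp ip => q1 q2 [q3 q4].
have -> : (q1 ++ x :: q2) ++ p2 ++ q3 ++ y :: q4 = q1 ++ x :: (q2 ++ p2 ++ q3) ++ y :: q4 by rewrite -!catA.
move=> /ipath_cross[-> h]; split=> //; apply: h.
by case: (q2) p0 => //=; case: (p2).
Qed.

Lemma ipath_edge M x y : ipath M -> x \in M -> y \in M -> x -- y -> consecutive M x y.
Proof.
suff h (u v : G) (q1 q2 : seq G) : ipath (q1 ++ u :: q2) -> v \in q2 -> u -- v -> infix [:: u; v] (q1 ++ u :: q2).
  move=> ip /path.splitPr xM; case: xM ip => q1 q2 ip; rewrite mem_cat inE => /or3P[yq|/eqP->|yq] xy.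
  - move: yq ip => /path.splitPr yq; case: yq => q3 q4; rewrite -catA cat_cons => ip.
    by apply/orP; right; apply: h => //; rewrite ?mem_cat ?mem_head ?orbT // sedgeC.
  - by rewrite sedgexx in xy.
  by apply/orP; left; exact: h.
move=> ip /path.splitPr vq uv; case: vq ip => [q3 q4] ip.
case: q3 ip => [|z q3] ip.
  by apply/(@seq.infixP G); exists q1, q4.
by have [_ /(_ isT)] := ipath_cross ip; rewrite uv.
Qed.

Definition leg A s L t := [/\ ipath (s :: L), {subset L <= A} & last s L = t].
Definition apart L M := forall x y, x \in L -> y \in M -> x != y /\ ~~ (x -- y).

Lemma apartC L M : apart L M -> apart M L.
Proof. by move=> h x y xM yL; rewrite eq_sym sedgeC; exact: h. Qed.

(* Attach a shortest path from c to a shortest path P from a to b: the centre is c itself, the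
   only contact on P, or, with several contacts, the last vertex before P; in a triangle-free
   graph the outermost contacts are then not adjacent. *)
Lemma spider3 A a b c : tfree G -> conn A -> a \in A -> b \in A -> c \in A ->
  exists s La Lb Lc, [/\ s \in A, leg A s La a, leg A s Lb b, leg A s Lc c &
    [/\ apart La Lb, apart La Lc & apart Lb Lc]].
Proof.
move=> tf cA aA bA cAA.
have [P lP] := link_conn cA (set11 a) (set11 b) aA bA; have [ipP P0 PA _] := lP.
have hP : head a P = a by have [/set1P] := link_head a lP.
have lastab : last a P = b by have [/set1P] := link_last a lP.
have [cP|cP] := boolP (c \in P).
  case/path.splitPr: cP ipP PA hP lastab => P1 P2 ipP PA hP lastab.
  exists c, (rev P1), P2, [::]; split=> //.
  - split.
    + by rewrite -rev_rcons; apply: ipath_rev; move: ipP; rewrite -cat_rcons => /ipath_cat[].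
    + by move=> x; rewrite mem_rev => xP; apply: PA; rewrite mem_cat xP.
    by case: (P1) hP => [|x q] //= ->; rewrite rev_cons last_rcons.
  - split; first by have [] := ipath_cat ipP.
      by move=> x xP; apply: PA; rewrite mem_cat inE xP !orbT.
    by move: lastab; rewrite last_cat.
  split=> // x y; rewrite mem_rev => xP yP.
  by apply: (@ipath_gap P1 [:: c] P2).
pose F := A :\: [set x in P].
have cF : c \in F by rewrite !inE cP.
have FA x : x \in F -> x \in A /\ x \notin P by rewrite !inE => /andP[].
pose Y := [set r | has (fun p => r -- p) P].
have [u [v [uA vA uC vC uv]]] : exists u v, [/\ u \in A, v \in A, u \in comp F c, v \notin comp F c & u -- v].
  apply: (conn_exit cA cAA aA); first exact: comp_refl.
  apply/negP => /(subsetP (comp_sub cF))/FA[_ /negP]; apply.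
  by rewrite -hP; case: (P) P0 => // x q _; exact: mem_head.
have vP : v \in P.
  apply: contraNT vC => vP; apply: comp_closed uC _ uv => //; by rewrite !inE vP.
have uY : u \in Y by rewrite inE; apply/hasP; exists v.
have cu : connect (rin F) c u by move: uC; rewrite inE.
have [R lR] := linkI (set11 c) uY cF cu; have [ipR R0 RF hR] := lR.
have headR : head c R = c by have [/set1P] := link_head c lR.
case/(@seq.lastP G) ER : R R0 => [|R' r] // _.
have rY : r \in Y by have [] := link_last c lR; rewrite ER last_rcons.
have nR' x p : x \in R' -> p \in P -> ~~ (x -- p).
  move=> /path.splitPr xR pP; move: hR; rewrite ER; case: xR => q1 q2 h.
  have [|_ E] := h q1 x (rcons q2 r); first by rewrite rcons_cat.
  apply/negP => xp; move: E; have -> : x \in Y by rewrite inE; apply/hasP; exists p.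
  by case: (q2).
have RP x p : x \in rcons R' r -> p \in P -> x != p.
  rewrite -ER => /RF/FA[_ xP] pP; by apply: contraNneq xP => ->.
have RA x : x \in rcons R' r -> x \in A by rewrite -ER => /RF/FA[].
have ipr : ipath (r :: rev R') by rewrite -rev_rcons -ER; exact: ipath_rev.
have lastr : last r (rev R') = c.
  by move: headR; rewrite ER; case: (R') => [|x q] //= ->; rewrite rev_cons last_rcons.
have hasr : has (fun p => r -- p) P by move: rY; rewrite inE.
have [P1 [x [P2 [EP rx nP1]]]] := first_split hasr.
have nrP1 p : p \in P1 -> ~~ (r -- p) by move/hasPn: nP1; apply.
have rR : r \in rcons R' r by rewrite mem_rcons mem_head.
have R'R z : z \in R' -> z \in rcons R' r by move=> zR; rewrite mem_rcons inE zR orbT.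
have P1P p : p \in P1 -> p \in P by move=> pP; rewrite EP mem_cat pP.
have P2P p : p \in P2 -> p \in P by move=> pP; rewrite EP mem_cat inE pP !orbT.
have xP : x \in P by rewrite EP mem_cat mem_head orbT.
have [hP2|/hasPn nP2] := boolP (has (fun p => r -- p) P2).
  have [P3 [y [P4 [EP2 ry nP4]]]] := last_split hP2.
  have P30 : P3 != [::].
    apply/negP => /eqP E; move: ipP; rewrite EP EP2 E => /ipath_cat[_ /=].
    by case/and3P => _ /andP[xy _] _; exact: tf rx xy ry.
  have EP' : P = rcons P1 x ++ P3 ++ y :: P4 by rewrite EP EP2 cat_rcons.
  have P4P p : p \in y :: P4 -> p \in P by move=> pP; rewrite EP' !mem_cat pP !orbT.
  exists r, (rev (rcons P1 x)), (y :: P4), (rev R'); split; first exact: RA.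
  - split.
    + rewrite rev_rcons; apply/and3P; split.
      * rewrite inE mem_rev negb_or (RP _ _ rR xP) /=; apply/negP => /P1P rP.
        by have := RP _ _ rR rP; rewrite eqxx.
      * by rewrite rx; apply/allP => z; rewrite mem_rev => /nrP1.
      by rewrite -[X in is_true X]/(ipath (x :: rev P1)) -rev_rcons; apply: ipath_rev; move: ipP; rewrite EP' => /ipath_cat[].
    + move=> z; rewrite mem_rev mem_rcons inE => /orP[/eqP->|/P1P/PA//]; exact: PA.
    by move: hP; rewrite EP; case: (P1) => [|e q] /= <-; rewrite // rev_cons last_rcons.
  - split.
    + apply/and3P; split.
      * by apply/negP => /P4P rP; have := RP _ _ rR rP; rewrite eqxx.
      * by rewrite ry; apply/allP => z; move/hasPn: nP4; apply.
      by move: ipP; rewrite EP' catA => /ipath_cat[].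
    + by move=> z /P4P/PA.
    by move: lastab; rewrite EP' catA last_cat.
  - by split=> // z; rewrite mem_rev => /R'R/RA.
  split.
  + move=> p q; rewrite mem_rev => pP qP; apply: (@ipath_gap (rcons P1 x) P3 (y :: P4)) => //.
    by rewrite -EP'.
  + move=> p z; rewrite !mem_rev mem_rcons inE => pP zR.
    have {}pP : p \in P by case/orP: pP => [/eqP->|/P1P].
    by rewrite eq_sym sedgeC; split; [exact: RP (R'R _ zR) pP | exact: nR'].
  move=> p z; rewrite !mem_rev => /P4P pP zR.
  by rewrite eq_sym sedgeC; split; [exact: RP (R'R _ zR) pP | exact: nR'].
have apR p z : p \in P -> ~~ (r -- p) -> z \in rcons R' r -> p != z /\ ~~ (p -- z).
  move=> pP rp zR; rewrite eq_sym sedgeC; split; first exact: RP zR pP.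
  by move: zR; rewrite mem_rcons inE => /orP[/eqP->//|zR]; exact: nR'.
exists x, (rev P1), P2, (rev (rcons R' r)); split; first exact: PA.
- split.
  + by rewrite -rev_rcons; apply: ipath_rev; move: ipP; rewrite EP -cat_rcons => /ipath_cat[].
  + by move=> z; rewrite mem_rev => /P1P/PA.
  by move: hP; rewrite EP; case: (P1) => [|e q] //= ->; rewrite rev_cons last_rcons.
- split; first by move: ipP; rewrite EP => /ipath_cat[].
    by move=> z /P2P/PA.
  by move: lastab; rewrite EP last_cat.
- split.
  + rewrite rev_rcons; apply/and3P; split=> //.
      rewrite -rev_rcons mem_rev; apply/negP => xR; by have := RP _ _ xR xP; rewrite eqxx.
    rewrite sedgeC rx; apply/allP => z; rewrite mem_rev sedgeC => zR; exact: nR'.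
  + by move=> z; rewrite mem_rev => /RA.
  by rewrite rev_rcons.
split.
- move=> p q; rewrite mem_rev => pP qP; apply: (@ipath_gap P1 [:: x] P2) => //; by rewrite -EP.
- move=> p z; rewrite !mem_rev => pP zR; apply: apR => //; [exact: P1P | exact: nrP1].
move=> p z pP; rewrite mem_rev => zR; apply: apR => //; [exact: P2P | exact: nP2].
Qed.

Lemma spider A (W : finType) (J : {set W}) (t : W -> G) : tfree G -> conn A -> 2 <= #|J| <= 3 ->
  {in J, forall w, t w \in A} -> exists s (L : W -> seq G), [/\ s \in A,
    forall w, w \in J -> leg A s (L w) (t w) &
    forall w w', w \in J -> w' \in J -> w != w' -> apart (L w) (L w')].
Proof.
move=> tf cA; rewrite cardE => cJ tJ.
have [w1 [w2 [w3 [w12 w1J w2J w3J h]]]] : exists w1 w2 w3, [/\ w1 != w2, w1 \in J, w2 \in J, w3 \in J &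
    forall w, w \in J -> w = w1 \/ w = w2 \/ w = w3].
  have uJ := enum_uniq J; have mJ w : (w \in J) = (w \in enum J) by rewrite mem_enum.
  case: (enum J) cJ uJ mJ => [|w1 [|w2 [|w3 [|]]]] //= _ + mJ.
    (* With only two targets the first one is repeated. *)
    rewrite inE andbT => w12; exists w1, w2, w1; rewrite !mJ !inE !eqxx ?orbT; split=> // w.
    by rewrite mJ !inE => /orP[] /eqP; auto.
  rewrite !inE negb_or => /andP[/andP[w12 _] _]; exists w1, w2, w3; rewrite !mJ !inE !eqxx ?orbT; split=> // w.
  by rewrite mJ !inE => /or3P[] /eqP; auto.
have [s [L1 [L2 [L3 [sA l1 l2 l3 [a12 a13 a23]]]]]] := spider3 tf cA (tJ _ w1J) (tJ _ w2J) (tJ _ w3J).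
exists s, (fun w => if w == w1 then L1 else if w == w2 then L2 else L3); split=> //.
  move=> w /h [->|[->|->]]; rewrite ?eqxx //; first by rewrite eq_sym (negbTE w12).
  by case: eqP => [->//|_]; case: eqP => [->|].
move=> w w' wJ w'J ww'.
case: (eqVneq w w1) => [E1|n1]; case: (eqVneq w' w1) => [E1'|n1'].
- by rewrite E1 E1' eqxx in ww'.
- by case: ifP.
- by case: ifP => _; exact: apartC.
case: (eqVneq w w2) => [E2|n2]; case: (eqVneq w' w2) => [E2'|n2'] //.
- by rewrite E2 E2' eqxx in ww'.
- exact: apartC.
have three v : v \in J -> v != w1 -> v != w2 -> v = w3 by case/h => [->|[->|]] //; rewrite eqxx.
by rewrite (three _ wJ n1 n2) (three _ w'J n1' n2') eqxx in ww'.
Qed.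

End Spider.

(** * Induced subdivisions *)

Section Subdiv.
Variables (W G : sgraph) (f : W -> G) (p : W -> W -> seq G).

Definition route u v := f u :: rcons (p u v) (f v).
Definition route_edge x y := exists u v, u -- v /\ infix [:: x; y] (route u v).
Definition on_route x := (exists u, x = f u) \/ exists u v, u -- v /\ x \in p u v.

(** [subdivision_of] relative to a larger graph: adjacency is prescribed on the route vertices only,
    so it is these that induce a subdivision. *)
Definition subdiv_in :=
  [/\ injective f,
      forall u v, u -- v -> [/\ p v u = rev (p u v), uniq (p u v) & forall w, f w \notin p u v],
      forall u v u' v' x, u -- v -> u' -- v' -> x \in p u v -> x \in p u' v' ->
        (u' = u /\ v' = v) \/ (u' = v /\ v' = u) &
      forall x y, on_route x -> on_route y -> (x -- y <-> route_edge x y)].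
End Subdiv.

Lemma infix_map_inj (T T' : eqType) (h : T -> T') s1 s2 : injective h ->
  infix (map h s1) (map h s2) = infix s1 s2.
Proof.
move=> hi; apply/(@seq.infixP T')/(@seq.infixP T) => [[q [q' E]]|[q [q' ->]]]; last first.
  by exists (map h q), (map h q'); rewrite !map_cat.
exists (take (size q) s2), (drop (size s1) (drop (size q) s2)); apply: (inj_map hi).
by rewrite !map_cat map_take map_drop map_drop E take_size_cat // drop_size_cat // drop_size_cat ?size_map.
Qed.

Lemma subdiv_in_val (W G : sgraph) (U : {set G}) (f : W -> induced U) p :
  subdiv_in f p -> subdiv_in (val \o f) (fun u v => map val (p u v)).
Proof.
move=> [fi hp ov ed].
have rE u v : route (val \o f) (fun u v => map val (p u v)) u v = map val (route f p u v).
  by rewrite /route /= map_rcons.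
split.
- by move=> u v /val_inj/fi.
- move=> u v uv; have [h1 h2 h3] := hp _ _ uv; rewrite h1 map_rev map_inj_uniq //; last exact: val_inj.
  by split=> // w; rewrite /= (mem_map val_inj).
- move=> u v u' v' _ uv uv' /mapP[x xp ->]; rewrite (mem_map val_inj); exact: ov.
have on x : on_route (val \o f) (fun u v => map val (p u v)) x -> exists2 x', x = val x' & on_route f p x'.
  case=> [[u ->]|[u [v [uv /mapP[x' xp ->]]]]]; first by exists (f u) => //; left; exists u.
  by exists x' => //; right; exists u, v.
move=> _ _ /on[x -> ox] /on[y -> oy].
have -> : (val x -- val y) = ((x : induced U) -- (y : induced U)) by [].
split=> [/(ed _ _ ox oy)|] [u [v [uv h]]].
  by exists u, v; split=> //; rewrite rE; have := infix_map_inj [:: x; y] (route f p u v) val_inj => ->.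
apply/(ed _ _ ox oy); exists u, v; split=> //.
by move: h; rewrite rE; have := infix_map_inj [:: x; y] (route f p u v) val_inj => ->.
Qed.

Lemma subdiv_in_induced (W G : sgraph) (f : W -> G) p :
  subdiv_in f p -> contains_induced (subdivision_of W) G.
Proof.
move=> [fi hp ov ed]; pose S := [set x | `[< on_route f p x >]].
have SP x : reflect (on_route f p x) (x \in S) by rewrite in_set; exact: asboolP.
have fS u : f u \in S by apply/SP; left; exists u.
have pS u v : u -- v -> {subset p u v <= S} by move=> uv x xp; apply/SP; right; exists u, v.
exists S; pose f' u : induced S := exist _ (f u) (fS u).
pose p' u v : seq (induced S) := pmap insub (p u v).
have pE u v : u -- v -> map val (p' u v) = p u v.
  move=> uv; rewrite /p' (pmap_filter (insubK _)); apply/all_filterP/allP => x /(pS _ _ uv) xS /=.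
  by rewrite insubT.
have memp u v x : u -- v -> (x \in p' u v) = (val x \in p u v).
  by move=> uv; rewrite -(pE _ _ uv) (mem_map val_inj).
have rE u v : u -- v -> map val (route f' p' u v) = route f p u v.
  by move=> uv; rewrite /route /= map_rcons pE.
exists f', p'; split.
- by move=> u v /(congr1 val)/fi.
- move=> u v uv; have [h1 h2 h3] := hp _ _ uv; split.
  + apply: (inj_map val_inj); rewrite map_rev !pE // sedge_sym //.
  + by rewrite -(map_inj_uniq val_inj) pE.
  by move=> w; rewrite memp //; exact: h3.
- by move=> u v u' v' x uv uv'; rewrite !memp //; exact: ov.
- move=> x; have /SP[[u xu]|[u [v [uv xp]]]] := valP x; [left | right].
    by exists u; apply: val_inj.
  by exists u, v; rewrite memp.
move=> x y; have ox := SP _ (valP x); have oy := SP _ (valP y).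
have -> : ((x : induced S) -- (y : induced S)) = (val x -- val y) by [].
split=> [/(ed _ _ ox oy)|] [u [v [uv h]]].
  exists u, v; split=> //; rewrite -(infix_map_inj _ _ val_inj) -/(route f' p' u v) rE //.
apply/(ed _ _ ox oy); exists u, v; split=> //.
by move: h; rewrite -(infix_map_inj _ _ val_inj) -/(route f' p' u v) rE.
Qed.

Section Assemble.
Variables (W H : sgraph) (phi : W -> {set H}).
Hypothesis tf : tfree H.
Hypothesis mp : model phi.
Hypothesis deg : forall w : W, 2 <= #|nbh w| <= 3.
Hypothesis clo : forall w x y, x \in phi w -> bb x y -> y \in phi w.

Lemma assemble : exists f p, @subdiv_in W H f p.
Proof.
have [cphi phi0 dis edge] := mp.
have /choice[g hg] : forall e : W * W, exists xy : H * H,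
    e.1 -- e.2 -> [/\ xy.1 \in phi e.1, xy.2 \in phi e.2 & xy.1 -- xy.2].
  move=> [u v] /=; case: (boolP (u -- v)) => uv.
    by have [x [y [h1 h2 h3]]] := edge _ _ uv; exists (x, y).
  by have /set0Pn[x _] := phi0 u; exists (x, x).
(* One edge is chosen for each adjacent pair, whatever its orientation; [al u v] is its end in
   [phi u]. *)
pose al u v := if enum_rank u < enum_rank v then (g (u, v)).1 else (g (v, u)).2.
have rk (u v : W) : u -- v -> (enum_rank u < enum_rank v) = ~~ (enum_rank v < enum_rank u).
  move=> uv; have ne : enum_rank u != enum_rank v :> nat.
    by apply: contraTneq uv => /(@ord_inj _ _)/enum_rank_inj ->; rewrite sedgexx.
  by rewrite -leqNgt [RHS]leq_eqVlt (negbTE ne).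
have alphi u v : u -- v -> al u v \in phi u.
  move=> uv; rewrite /al; case: ifP => _; first by have [] := hg (u, v) uv.
  by have [] := hg (v, u); rewrite //= sedgeC.
have vC (u v : W) : u -- v -> v -- u by rewrite sedgeC.
have ale u v : u -- v -> al u v -- al v u.
  move=> uv; rewrite /al (rk v u (vC _ _ uv)); case: (enum_rank u < enum_rank v) => /=.
    by have [] := hg (u, v) uv.
  by rewrite sedgeC; have [] := hg (v, u) (vC _ _ uv).
have /choice[s hs] : forall w, exists s, exists L : W -> seq H, [/\ s \in phi w,
    forall w', w' \in nbh w -> leg (phi w) s (L w') (al w w') &
    forall w1 w2, w1 \in nbh w -> w2 \in nbh w -> w1 != w2 -> apart (L w1) (L w2)].
  by move=> w; apply: spider => // w'; rewrite inE => /alphi.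
have {hs}/choice[L hL] := hs.
have sphi w : s w \in phi w by have [] := hL w.
have Lleg u v : u -- v -> leg (phi u) (s u) (L u v) (al u v) by move=> uv; have [_ h _] := hL u; apply: h; rewrite inE.
have Lip u v : u -- v -> ipath (s u :: L u v) by move/Lleg=> [].
have Lphi u v x : u -- v -> x \in L u v -> x \in phi u by move/Lleg=> [_ h _]; exact: h.
have Lap u v v' : u -- v -> u -- v' -> v != v' -> apart (L u v) (L u v').
  by move=> uv uv'; have [_ _ h] := hL u; apply: h; rewrite inE.
pose p u v := L u v ++ rev (L v u).
have rE u v : route s p u v = (s u :: L u v) ++ rev (s v :: L v u).
  by rewrite /route /p rev_cons /= rcons_cat.
have rR u v : route s p v u = rev (route s p u v) by rewrite !rE rev_cat revK.
have Tphi u v x : u -- v -> x \in s u :: L u v -> x \in phi u.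
  by move=> uv; rewrite inE => /orP[/eqP->//|]; exact: Lphi.
have ru u v : u -- v -> uniq (route s p u v).
  move=> uv; rewrite rE cat_uniq rev_uniq (ipath_uniq (Lip _ _ uv)) (ipath_uniq (Lip _ _ (vC _ _ uv))) andbT.
  apply/hasPn => x; rewrite mem_rev => /(Tphi _ _ _ (vC _ _ uv)) xv; apply/negP => /(Tphi _ _ _ uv) xu.
  by have E := dis _ _ _ xu xv; rewrite E sedgexx in uv.
have rs u v : u -- v -> sorted (@sedge H) (route s p u v).
  move=> uv; have := ipath_sorted (Lip _ _ uv); have := ipath_sorted (ipath_rev (Lip _ _ (vC _ _ uv))).
  have [_ _ l1] := Lleg _ _ uv; have [_ _ l2] := Lleg _ _ (vC _ _ uv).
  rewrite rE /= cat_path => + -> /=; rewrite l1.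
  case E : (rev (s v :: L v u)) => [|z q] //= ->; rewrite andbT.
  have -> : z = al v u; last exact: ale.
  have := congr1 (last (s v)) (congr1 rev E); rewrite revK rev_cons last_rcons /= => <-.
  by rewrite l2.
have es x y : route_edge s p x y -> route_edge s p y x.
  move=> [u [v [uv h]]]; exists v, u; split; first exact: vC.
  by rewrite rR -[[:: y; x]]/(rev [:: x; y]) infix_rev.
have ee x y : route_edge s p x y -> x -- y.
  move=> [u [v [uv /(@seq.infixP H)[q [q' E]]]]]; have := rs _ _ uv; rewrite E sorted_split.
  by move=> /andP[_ /= /andP[]].
have onT x : on_route s p x -> exists w w', w -- w' /\ x \in s w :: L w w'.
  case=> [[w ->]|[u [v [uv]]]].
    have /card_gt0P[w'] : 0 < #|nbh w| by have /andP[h _] := deg w; exact: leq_trans h.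
    by rewrite inE => ww'; exists w, w'; rewrite mem_head.
  rewrite mem_cat mem_rev => /orP[xL|xL]; [exists u, v | exists v, u]; rewrite inE xL orbT //.
  by split=> //; exact: vC.
have cons_edge u v x y : u -- v -> x \in s u :: L u v -> y \in s u :: L u v -> x -- y -> route_edge s p x y.
  move=> uv xs ys xy; have h a b : infix [:: a; b] (s u :: L u v) -> route_edge s p a b.
    move=> ab; exists u, v; split=> //; rewrite rE; apply: infix_trans ab _; apply/(@seq.infixP H).
    by exists [::], (rev (s v :: L v u)).
  by case/orP: (ipath_edge (Lip _ _ uv) xs ys xy) => /h //; exact: es.
have mid u v q1 x q2 : u -- v -> route s p u v = q1 ++ x :: q2 -> q1 != [::] -> q2 != [::] ->
    exists z1 z2, [/\ z1 != z2, route_edge s p x z1 & route_edge s p x z2].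
  move=> uv; case/(@seq.lastP H): q1 => // q1 z1; case: q2 => // z2 q2 E _ _.
  have := ru _ _ uv; rewrite E cat_uniq => /and3P[_ /hasPn/(_ z2) h _]; exists z1, z2; split.
  - by apply: contraTneq (h _) => [->|]; rewrite ?mem_rcons !inE ?eqxx ?orbT.
  - apply: es; exists u, v; split=> //; apply/(@seq.infixP H); exists q1, (z2 :: q2).
    by rewrite E cat_rcons.
  by exists u, v; split=> //; apply/(@seq.infixP H); exists (rcons q1 z1), q2.
have hd u v : u -- v -> exists z, route_edge s p (s u) z /\ (z \in L u v \/ z \in phi v).
  move=> uv; have E : route s p u v = s u :: (L u v ++ rev (s v :: L v u)) by rewrite rE.
  case El : (L u v) E => [|z q] E.
    case Er : (rev (s v :: L v u)) E => [|z q] E; first by have := congr1 size Er; rewrite size_rev.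
    exists z; split; last first.
      by right; apply: (Tphi _ _ _ (vC _ _ uv)); rewrite -mem_rev Er mem_head.
    by exists u, v; split=> //; apply/(@seq.infixP H); exists [::], q; rewrite E.
  exists z; split; last by left; rewrite mem_head.
  by exists u, v; split=> //; apply/(@seq.infixP H); exists [::], (q ++ rev (s v :: L v u)); rewrite E.
have two x : on_route s p x -> exists z1 z2, [/\ z1 != z2, route_edge s p x z1 & route_edge s p x z2].
  case=> [[w ->]|[u [v [uv /path.splitPr xp]]]]; last first.
    have E : route s p u v = s u :: rcons (p u v) (s v) by [].
    move: E; case: xp => q1 q2 E; apply: (mid _ _ (s u :: q1) x (rcons q2 (s v)) uv) => //.
      by rewrite E rcons_cat.
    by case: (q2).
  have : 1 < #|nbh w| by have /andP[] := deg w.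
  case/card_gt1P => [w1 [w2 []]]; rewrite !inE => ww1 ww2 w12.
  have [z1 [e1 h1]] := hd _ _ ww1; have [z2 [e2 h2]] := hd _ _ ww2.
  exists z1, z2; split=> //; apply/eqP => E.
  have irr (a b : W) : a -- b -> a = b -> False by move=> ab E0; rewrite E0 sedgexx in ab.
  case: h1 h2 => h1 [h2|h2].
  - by have [/eqP] := Lap _ _ _ ww1 ww2 w12 _ _ h1 h2.
  - by apply: (irr _ _ ww2); apply: dis h2; rewrite -E; exact: Lphi h1.
  - by apply: (irr _ _ ww1); apply: dis h1; rewrite E; exact: Lphi h2.
  by rewrite E in h1; rewrite (dis _ _ _ h1 h2) eqxx in w12.
have low x y : on_route s p x -> x -- y -> ~~ branch x -> route_edge s p x y.
  move=> /two[z1 [z2 [z12 e1 e2]]] xy; rewrite /branch -leqNgt => d2.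
  have sub : [set z1; z2] \subset nbh x by apply/subsetP => z; rewrite !inE => /orP[] /eqP->; exact: ee.
  have /eqP E : [set z1; z2] == nbh x by rewrite eqEcard sub cards2 z12.
  have : y \in nbh x by rewrite inE.
  by rewrite -E !inE => /orP[] /eqP->.
exists s, p; split.
- by move=> u v E; apply: (dis _ _ (s u)) => //; rewrite E.
- move=> u v uv; split.
  + by rewrite /p rev_cat revK.
  + by have := ru _ _ uv; rewrite /route /= rcons_uniq => /and3P[].
  move=> w; apply/negP; rewrite mem_cat mem_rev => /orP[wL|wL].
    have E := dis _ _ _ (sphi w) (Lphi _ _ _ uv wL); rewrite E in wL.
    by have /and3P[] := Lip _ _ uv; rewrite wL.
  have E := dis _ _ _ (sphi w) (Lphi _ _ _ (vC _ _ uv) wL); rewrite E in wL.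
  by have /and3P[] := Lip _ _ (vC _ _ uv); rewrite wL.
- have key u v u' v' x : u -- v -> u' -- v' -> x \in L u v -> x \in L u' v' -> u' = u /\ v' = v.
    move=> uv uv' xL xL'; have E := dis _ _ _ (Lphi _ _ _ uv xL) (Lphi _ _ _ uv' xL').
    rewrite -E in uv' xL' *; split=> //; apply/eqP; rewrite eq_sym; apply: contraT => ne.
    by have [] := Lap _ _ _ uv uv' ne _ _ xL xL'; rewrite eqxx.
  move=> u v u' v' x uv uv'; rewrite !mem_cat !mem_rev => /orP[xL|xL] /orP[xL'|xL'].
  + by left; exact: key xL xL'.
  + by right; have [-> ->] := key _ _ _ _ _ uv (vC _ _ uv') xL xL'.
  + by right; have [-> ->] := key _ _ _ _ _ (vC _ _ uv) uv' xL xL'.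
  by left; have [-> ->] := key _ _ _ _ _ (vC _ _ uv) (vC _ _ uv') xL xL'.
move=> x y ox oy; split; last exact: ee.
move=> xy; have [w [w1 [ww1 xT]]] := onT _ ox; have [w' [w2 [ww2 yT]]] := onT _ oy.
have [E|ne] := eqVneq w w'.
  rewrite -E in ww2 yT => {E}.
  have xT1 : x \in s w :: L w w1 := xT; have yT1 : y \in s w :: L w w2 := yT.
  move: xT; rewrite inE => /orP[/eqP Ex|xL].
    by apply: (cons_edge w w2); rewrite // Ex mem_head.
  move: yT; rewrite inE => /orP[/eqP Ey|yL].
    by apply: (cons_edge w w1); rewrite // Ey mem_head.
  have [E|ne] := eqVneq w1 w2.
    by apply: (cons_edge w w1) => //; rewrite E.
  by have [_ /negP] := Lap _ _ _ ww1 ww2 ne _ _ xL yL.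
have [bx|nbx] := boolP (branch x); last exact: low.
have [by'|nby] := boolP (branch y); last by apply: es; apply: low; rewrite // sedgeC.
have yw : y \in phi w by apply: (clo (Tphi _ _ _ ww1 xT)); rewrite /bb /= xy bx.
by case/eqP: ne; apply: dis yw _; exact: Tphi ww2 yT.
Qed.

End Assemble.

(** * Walls *)

Lemma succ_neq (a b : nat) (P Q : Prop) : (b = a.+1 /\ P) \/ (a = b.+1 /\ Q) -> a <> b /\ b <> a.
Proof. by case=> -[-> _]; split=> /eqP; rewrite ?(ltn_eqF (ltnSn _)) ?(gtn_eqF (ltnSn _)). Qed.

Section WallFacts.
Variable k : nat.

(* In 0-based rows and columns: the vertex (r, c) has a neighbour in another row. *)
Definition vert (r c : nat) := if odd (r + c) then 0 < r else r.+1 < k.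

Lemma GammaP (x y : Gamma k) : x -- y ->
  (x.1 = y.1 :> nat /\ (y.2 = x.2.+1 :> nat \/ x.2 = y.2.+1 :> nat)) \/
  (x.2 = y.2 :> nat /\ ((y.1 = x.1.+1 :> nat /\ ~~ odd (x.1 + x.2)) \/ (x.1 = y.1.+1 :> nat /\ odd (x.1 + x.2)))).
Proof.
case: x y => [r c] [r' c'] /=; rewrite /sedge /= /gamma_edge /gamma_arc /gamma_row /gamma_col /=.
move: (r : nat) (r' : nat) (c : nat) (c' : nat) => {}r {}r' {}c {}c'; lia.
Qed.

Lemma GammaH (x y : Gamma k) : x.1 = y.1 :> nat -> y.2 = x.2.+1 :> nat -> x -- y.
Proof. by move=> h1 h2; rewrite /sedge /= /gamma_edge /gamma_arc /gamma_row /gamma_col /= h1 h2 !eqxx. Qed.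

Lemma GammaV (x y : Gamma k) : x.2 = y.2 :> nat -> y.1 = x.1.+1 :> nat -> ~~ odd (x.1 + x.2) -> x -- y.
Proof.
move=> h1 h2 h3; rewrite /sedge /= /gamma_edge /gamma_arc /gamma_row /gamma_col /= h1 h2 !eqxx.
by rewrite addSn /= -h1 h3 orbT.
Qed.

Lemma Gamma_eq (x y : Gamma k) : x.1 = y.1 :> nat -> x.2 = y.2 :> nat -> x = y.
Proof. by case: x y => [r c] [r' c'] /= /ord_inj-> /ord_inj->. Qed.

Lemma Gamma_at r c : r < k -> c < 2 * k -> exists x : Gamma k, x.1 = r :> nat /\ x.2 = c :> nat.
Proof. by move=> hr hc; exists (Ordinal hr, Ordinal hc). Qed.

Lemma vertP (x : Gamma k) : vert x.1 x.2 <-> exists y, [/\ x -- y, x.2 = y.2 :> nat & x.1 <> y.1 :> nat].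
Proof.
rewrite /vert; split=> [|[y [/GammaP h1 h2 h3]]]; last first.
  have := ltn_ord y.1; move: h1 h2 h3; case: ifP; clear; lia.
case: ifP => od h.
  have lt : x.1.-1 < k by apply: leq_ltn_trans (leq_pred _) (ltn_ord _).
  have [y [y1 y2]] := Gamma_at lt (ltn_ord x.2); exists y; split=> //; last by move: h y1; clear; lia.
  rewrite sedgeC; apply: GammaV => //; first by move: h y1; clear; lia.
  by move: od h; rewrite y1 y2; clear; lia.
have [y [y1 y2]] := Gamma_at h (ltn_ord x.2); exists y; split=> //; last by move: y1; clear; lia.
by apply: GammaV; rewrite ?y1 ?y2 ?od.
Qed.

Lemma two_trim (x y z : Gamma k) : x -- y -> x -- z -> y != z -> x \in [set x : Gamma k | #|nbh x| != 1].
Proof.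
move=> xy xz yz; rewrite inE; suff : 1 < #|nbh x| by case: #|_| => [|[]].
by apply/card_gt1P; exists y, z; rewrite !inE.
Qed.

Lemma Gamma_hor (x : Gamma k) : exists y, x -- y /\ x.1 = y.1 :> nat.
Proof.
have := ltn_ord x.2; case: (ltnP x.2.+1 (2 * k)) => [lt _|ge lt].
  by have [y [y1 y2]] := Gamma_at (ltn_ord x.1) lt; exists y; split=> //; apply: GammaH; rewrite ?y1 ?y2.
have x0 : 0 < x.2 by have := ltn_ord x.1; move: ge; clear; lia.
have [y [y1 y2]] := Gamma_at (ltn_ord x.1) (leq_ltn_trans (leq_pred _) lt); exists y; split=> //.
by rewrite sedgeC; apply: GammaH; rewrite ?y1 ?y2 ?prednK.
Qed.

Lemma vert_trim (x : Gamma k) : vert x.1 x.2 -> x \in [set x : Gamma k | #|nbh x| != 1].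
Proof.
move/vertP => [y [xy _ r1]]; have [z [xz r2]] := Gamma_hor x; apply: two_trim xy xz _.
by apply/eqP => E; apply: r1; rewrite E.
Qed.

Lemma vert_sym (x y : Gamma k) : x -- y -> x.2 = y.2 :> nat -> x.1 <> y.1 :> nat -> vert y.1 y.2.
Proof. by move=> xy h1 h2; apply/vertP; exists x; rewrite sedgeC; split=> // /esym. Qed.

(** A vertex without vertical neighbour lies in the first or the last row. Thus the vertices of the
    wall are those with a vertical neighbour. *)
Lemma suppressedP (z : Gamma_trim k) :
  (z \in wall_suppressed k) = ~~ vert (val z).1 (val z).2.
Proof.
rewrite inE; apply/idP/idP => [/andP[_ /forall_inP h]|nv].
  apply/negP => /[dup] v /vertP[y [zy y2 y1]].
  have yt := vert_trim (vert_sym zy y2 y1).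
  have := h (exist _ y yt : Gamma_trim k); rewrite inE => /(_ zy); rewrite /gamma_row /= eqSS => /eqP.
  by move/esym.
apply/andP; split.
  move: nv (ltn_ord (val z).1); rewrite /vert /gamma_row; case: ifP => _; set a := nat_of_ord _; move: a; clear; lia.
apply/forall_inP => y; rewrite inE => /[dup] zy /GammaP h; apply/eqP; rewrite /gamma_row.
case: h => [[-> //]|[h1 h2]]; exfalso; move/negP: nv; apply; apply/vertP; exists (val y); split=> //.
by case: (succ_neq h2).
Qed.

Definition at_wall (w : wall k) : Gamma k := val (val w).

Lemma at_wall_inj : injective at_wall.
Proof. by move=> w w' /val_inj/val_inj. Qed.

Lemma wall_vert (w : wall k) : vert (at_wall w).1 (at_wall w).2.
Proof. by have := valP w; rewrite suppressedP negbK. Qed.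

Lemma vert_wall (x : Gamma k) : vert x.1 x.2 -> exists w, at_wall w = x.
Proof.
move=> v; pose xt : Gamma_trim k := exist _ x (vert_trim v).
have xs : xt \notin wall_suppressed k by rewrite suppressedP negbK.
by exists (exist _ xt xs).
Qed.

Lemma wall_edgeP (w w' : wall k) : w -- w' -> at_wall w -- at_wall w' \/
  exists z : Gamma k, [/\ ~~ vert z.1 z.2, z.1 = (at_wall w).1 :> nat, z.1 = (at_wall w').1 :> nat &
    (z.2 = (at_wall w).2.+1 :> nat /\ (at_wall w').2 = z.2.+1 :> nat) \/
    (z.2 = (at_wall w').2.+1 :> nat /\ (at_wall w).2 = z.2.+1 :> nat)].
Proof.
case/orP => [|/andP[ww' /existsP[z /and3P[zs wz zw']]]]; first by left.
right; exists (val z); move: zs; rewrite suppressedP => nz.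
have step (v : wall k) : val z -- at_wall v -> (val z).1 = (at_wall v).1 :> nat /\
    ((val z).2 = (at_wall v).2.+1 :> nat \/ (at_wall v).2 = (val z).2.+1 :> nat).
  move=> zv; case: (GammaP zv) => [[-> []]|[h1 h2]]; [by auto | by auto |].
  by case/negP: nz; apply/vertP; exists (at_wall v); split=> //; case: (succ_neq h2).
have zw : val z -- at_wall w by rewrite sedgeC.
have [r1 c1] := step w zw; have [r2 c2] := step w' zw'.
split=> //; have ne : (at_wall w).2 <> (at_wall w').2 :> nat.
  by move=> h2; case/eqP: ww'; apply: at_wall_inj; apply: Gamma_eq; rewrite -?r1.
case: c1 c2 => [c1|c1] [c2|c2]; [|by left|by right|].
  by case: ne; apply: succn_inj; rewrite -c1 -c2.
by case: ne; rewrite c1 c2.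
Qed.

Lemma wall_edge (w w' : wall k) : at_wall w -- at_wall w' -> w -- w'.
Proof. by move=> h; apply/orP; left. Qed.

Lemma wall_edge2 (w w' : wall k) (z : Gamma k) : ~~ vert z.1 z.2 ->
  z.1 = (at_wall w).1 :> nat -> z.1 = (at_wall w').1 :> nat ->
  z.2 = (at_wall w).2.+1 :> nat -> (at_wall w').2 = z.2.+1 :> nat -> w -- w'.
Proof.
move=> nz r1 r2 c1 c2; apply/orP; right.
have wz : at_wall w -- z by apply: GammaH.
have zw' : z -- at_wall w' by apply: GammaH.
have ne : at_wall w != at_wall w' by apply/eqP => E; move: c1 c2; rewrite E; clear; lia.
apply/andP; split; first by apply: contraNneq ne => ->.
have zt : z \in [set x : Gamma k | #|nbh x| != 1] by apply: two_trim _ zw' ne; rewrite sedgeC.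
apply/existsP; exists (exist _ z zt); rewrite suppressedP /= nz /=.
by apply/andP.
Qed.

Lemma wall_deg (w : wall k) : 2 <= #|nbh w| <= 3.
Proof.
have vw := wall_vert w; have [y [xy y2 y1]] := (vertP _).1 vw.
have [wy Ey] := vert_wall (vert_sym xy y2 y1).
have k2 : 1 < k by have := ltn_ord (at_wall w).1; move: vw; rewrite /vert; case: ifP => _; clear; lia.
apply/andP; split.
  have [w2 [ww2 E2]] : exists w2, w -- w2 /\ (at_wall w).1 = (at_wall w2).1 :> nat.
    have r := ltn_ord (at_wall w).1; have c := ltn_ord (at_wall w).2.
    (* Parity repeats with period two: two places further in the row there is again a vertical
       neighbour. *)
    have ev (u : Gamma k) : u.1 = (at_wall w).1 :> nat ->
        u.2 = (at_wall w).2.+2 :> nat \/ (at_wall w).2 = u.2.+2 :> nat -> vert u.1 u.2.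
      by move=> h1 h2; move: vw; rewrite /vert h1; case: h2 => ->; rewrite ?addnS /= ?negbK.
    case: (ltnP 1 (at_wall w).2) => c2.
      have lt1 : (at_wall w).2.-1 < 2 * k by move: c; clear; lia.
      have lt2 : (at_wall w).2.-2 < 2 * k by move: c; clear; lia.
      have [x1 [r1 h1]] := Gamma_at r lt1; have [x2 [r2 h2]] := Gamma_at r lt2.
      have [v1|nv1] := boolP (vert x1.1 x1.2).
        have [w1 E1] := vert_wall v1; exists w1; rewrite E1; split=> //; apply: wall_edge.
        by rewrite sedgeC E1; apply: GammaH => //; move: c2 h1; clear; lia.
      have [|w2 E2] := @vert_wall x2; first by apply: ev => //; right; move: c2 h2; clear; lia.
      exists w2; rewrite E2; split=> //; rewrite sedgeC; apply: (wall_edge2 nv1); rewrite ?E2 ?r1 ?r2 ?h1 ?h2 //.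
        by move: c2; clear; lia.
      by move: c2; clear; lia.
    have lt1 : (at_wall w).2.+1 < 2 * k by move: c2 k2; clear; lia.
    have lt2 : (at_wall w).2.+2 < 2 * k by move: c2 k2; clear; lia.
    have [x1 [r1 h1]] := Gamma_at r lt1; have [x2 [r2 h2]] := Gamma_at r lt2.
    have [v1|nv1] := boolP (vert x1.1 x1.2).
      by have [w1 E1] := vert_wall v1; exists w1; rewrite E1; split=> //; apply: wall_edge; rewrite E1; apply: GammaH.
    have [|w2 E2] := @vert_wall x2; first by apply: ev => //; left.
    exists w2; rewrite E2; split=> //; apply: (wall_edge2 nv1); rewrite ?E2 ?r1 ?r2 ?h1 ?h2 //.
  apply/card_gt1P; exists wy, w2; rewrite !in_set; split; [by apply: wall_edge; rewrite Ey | exact: ww2 |].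
  by apply/eqP => E; apply: y1; rewrite E2 -E Ey.
(* Vertical, left or right: a vertex of the wall has at most one neighbour in each direction. *)
pose dir (u : wall k) : 'I_3 := if (at_wall u).1 != (at_wall w).1 :> nat then inord 0 else
  if (at_wall u).2 < (at_wall w).2 then inord 1 else inord 2.
rewrite -[X in _ <= X]card_ord -cardsT; apply: (@leq_trans #|dir @: nbh w|); last exact/subset_leq_card/subsetT.
rewrite card_in_imset // => u u'; rewrite !in_set => wu wu' E; apply: at_wall_inj.
have vu := wall_vert u; have vu' := wall_vert u'.
have o01 : (inord 0 : 'I_3) <> inord 1 by move/(congr1 val); rewrite /= !inordK.
have o02 : (inord 0 : 'I_3) <> inord 2 by move/(congr1 val); rewrite /= !inordK.
have o12 : (inord 1 : 'I_3) <> inord 2 by move/(congr1 val); rewrite /= !inordK.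
set r := nat_of_ord (at_wall w).1 in dir E *; set c := nat_of_ord (at_wall w).2 in dir E *.
have E' : (((at_wall u).1 != r :> nat) == ((at_wall u').1 != r :> nat)) &&
    (((at_wall u).1 != r :> nat) || (((at_wall u).2 < c) == ((at_wall u').2 < c))).
  move: E; rewrite /dir; case: (_ != r); case: (_ != r); case: (_ < c); case: (_ < c) => //= E;
   by [case: (o01 E) | case: (o01 (esym E)) | case: (o02 E) | case: (o02 (esym E)) | case: (o12 E) | case: (o12 (esym E))].
pose F (u : wall k) := ((at_wall u).2 = c :> nat /\ ((at_wall u).1 = r.+1 :> nat /\ ~~ odd (r + c) \/
      r = (at_wall u).1.+1 /\ odd (r + c))) \/
  ((at_wall u).1 = r :> nat /\
   [\/ (at_wall u).2 = c.+1 :> nat /\ vert r c.+1, c = (at_wall u).2.+1 /\ vert r c.-1,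
       (at_wall u).2 = c.+2 :> nat /\ ~~ vert r c.+1 | c = (at_wall u).2.+2 /\ ~~ vert r c.-1]).
have FE v : w -- v -> F v.
  have vv := wall_vert v.
  move=> /wall_edgeP[/GammaP[[h1 h2]|[h1 h2]]|[z [nz z1 z2 h]]].
  - right; split; first by rewrite /r h1.
    rewrite -h1 -/r in vv; case: h2 => h2; [apply: Or41 | apply: Or42].
      by rewrite -/c in h2; rewrite h2 in vv.
    by rewrite -/c in h2; rewrite h2.
  - by left; split; [rewrite /c h1 | case: h2 => -[h2 h3]; [left | right]].
  right; split; first by rewrite -z2 z1.
  rewrite z1 -/r in nz; case: h => -[h1 h2]; [apply: Or43 | apply: Or44].
    by rewrite h1 -/c in nz h2; rewrite h2.
  by rewrite /c h2 h1 in nz *.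
have := FE _ wu; have := FE _ wu'; rewrite /F => f1 f2.
have [e1 e2] : (at_wall u).1 = (at_wall u').1 :> nat /\ (at_wall u).2 = (at_wall u').2 :> nat.
  move: f1 f2 E'; move: (vert r c.+1) (vert r c.-1) => b1 b2.
  move: (nat_of_ord (at_wall u).1) (nat_of_ord (at_wall u').1) (nat_of_ord (at_wall u).2) (nat_of_ord (at_wall u').2).
  move: (r) (c); clear => r c u1 u1' u2 u2'.
  move=> f1 f2; case: f1 => [[? ?]|[? [[? ?]|[? ?]|[? ?]|[? ?]]]]; case: f2 => [[? ?]|[? [[? ?]|[? ?]|[? ?]|[? ?]]]]; lia.
exact: Gamma_eq.
Qed.

(* A vertex without vertical neighbour is merged into its left neighbour. *)
Lemma wall_model (G : sgraph) (psi : Gamma k -> {set G}) : model psi ->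
  exists psi' : wall k -> {set G}, model psi'.
Proof.
move=> [cpsi psi0 dis edge].
pose right_of (x : Gamma k) : pred (Gamma k) :=
  fun z => [&& ~~ vert z.1 z.2, z.1 == x.1 :> nat & z.2 == x.2.+1 :> nat].
pose psi' (w : wall k) := psi (at_wall w) :|: \bigcup_(z | right_of (at_wall w) z) psi z.
have psiP w x : x \in psi' w -> exists v, x \in psi v /\ (v = at_wall w \/ right_of (at_wall w) v).
  rewrite in_setU => /orP[h|/bigcupP[z rz xz]]; first by exists (at_wall w); auto.
  by exists z; auto.
have psi1 w x : x \in psi (at_wall w) -> x \in psi' w by rewrite in_setU => ->.
exists psi'; split.
- move=> w; apply: conn_bigcup => // z /and3P[_ /eqP z1 /eqP z2]; split=> //.
  have [x [y [h1 h2 h3]]] := edge _ _ (GammaH (esym z1) z2).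
  by apply/touchP; exists x, y; split=> //; right.
- by move=> w; have /set0Pn[x xw] := psi0 (at_wall w); apply/set0Pn; exists x; exact: psi1.
- move=> w w' x /psiP[v [xv hv]] /psiP[v' [xv' hv']]; rewrite -(dis _ _ _ xv xv') {v' xv'} in hv'.
  have vw := wall_vert w; have vw' := wall_vert w'; apply: at_wall_inj.
  case: hv hv' => [->|/and3P[nv /eqP r1 /eqP c1]] [//|/and3P[nv' /eqP r2 /eqP c2]].
  + by rewrite vw in nv'.
  + by move=> E; rewrite E vw' in nv.
  by apply: Gamma_eq; [rewrite -r1 -r2 | apply: succn_inj; rewrite -c1 -c2].
have mid (w w' : wall k) (z : Gamma k) : ~~ vert z.1 z.2 -> z.1 = (at_wall w).1 :> nat ->
    z.1 = (at_wall w').1 :> nat -> z.2 = (at_wall w).2.+1 :> nat -> (at_wall w').2 = z.2.+1 :> nat ->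
    exists x y, [/\ x \in psi' w, y \in psi' w' & x -- y].
  move=> nz r1 r2 c1 c2; have [x [y [h1 h2 h3]]] := edge _ _ (GammaH r2 c2).
  exists x, y; split=> //; last exact: psi1.
  rewrite in_setU; apply/orP; right; apply/bigcupP; exists z => //.
  by rewrite /right_of nz r1 c1 !eqxx.
move=> w w' /wall_edgeP[/edge[x [y [h1 h2 h3]]]|[z [nz r1 r2 [[c1 c2]|[c1 c2]]]]].
- by exists x, y; split=> //; exact: psi1.
- exact: mid nz r1 r2 c1 c2.
by have [x [y [h1 h2 h3]]] := mid _ _ _ nz r2 r1 c1 c2; exists y, x; rewrite sedgeC.
Qed.

End WallFacts.

(** * The theorem *)

Lemma pullback (W H : sgraph) (psi : W -> {set quot H}) : model psi ->
  (forall w : W, 0 < #|nbh w|) ->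
  exists phi : W -> {set H}, model phi /\ forall w x y, x \in phi w -> bb x y -> y \in phi w.
Proof.
move=> [cpsi _ dis edge] deg; pose phi w := [set x : H | rtq x \in psi w].
have clo w x y : x \in phi w -> bb x y -> y \in phi w.
  rewrite !inE => xw xy; have /rtP E : connect (@bb H) x y by exact: connect1.
  by rewrite /rtq -E.
have edgeH w w' : w -- w' -> exists x y, [/\ x \in phi w, y \in phi w' & x -- y].
  move/edge=> [x [y [xw yw /andP[_ /existsP[x' /existsP[y' /and3P[/eqP Ex /eqP Ey xy]]]]]]].
  by exists x', y'; rewrite !inE /rtq Ex Ey.
exists phi; split=> //; split=> //.
- move=> w.
  have same x y : x \in phi w -> rt x = rt y -> connect (rin (phi w)) x y.
    move=> xw /rtP/connectP[p pp ->] {y}; elim: p x xw pp => [|z p IH] x xw /=; first by rewrite connect0.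
    move=> /andP[xz pz]; have zw := clo _ _ _ xw xz; apply: connect_trans (IH z zw pz).
    by apply: connect1; rewrite /rin /= xw zw; case/and3P: xz => ->.
  apply/connP => x y xw yw.
  have xr : rtq x \in psi w by rewrite inE in xw.
  have yr : rtq y \in psi w by rewrite inE in yw.
  have /connectP[p pp Ep] := connP _ (cpsi w) _ _ xr yr.
  have {xr yr} : rt y = last (rtq x) p by [].
  elim: p x xw pp {Ep} => [|z p IH] x xw /=; first by move=> _ E; apply: same.
  move=> /andP[/and3P[/andP[_ /existsP[x' /existsP[z' /and3P[/eqP Ex /eqP Ez xz]]]] xr zr] pz] E.
  have x'w : x' \in phi w by rewrite inE /rtq Ex.
  have z'w : z' \in phi w by rewrite inE /rtq Ez.
  apply: connect_trans (same _ _ xw (esym Ex)) _.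
  apply: (@connect_trans _ _ z'); first by apply: connect1; rewrite /rin /= xz x'w z'w.
  by apply: IH; rewrite // /rtq Ez.
(* [psi w] could consist of a vertex of [quot] that represents no component, with empty preimage; an
   edge of [W] at [w] excludes this. *)
- move=> w; have /card_gt0P[w'] := deg w; rewrite inE => /edgeH[x [_ [xw _ _]]].
  by apply/set0Pn; exists x.
by move=> w w' x; rewrite !inE; exact: dis.
Qed.

(** * Passing to induced subgraphs *)

Section Induced.
Variables (G : sgraph) (U : {set G}).

Lemma conn_val (A : {set induced U}) : conn (val @: A) -> conn A.
Proof.
move=> cA; apply: connI => B x y BA xB yA cl.
have sub : val @: A \subset val @: B.
  apply: (conn_closed cA (imset_f val xB) (imset_f val (subsetP BA _ xB))).
  move=> _ _ /imsetP[a aA ->] /imsetP[b bA ->] /imsetP[a' aB /val_inj Ea] ab.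
  by apply: imset_f; apply: cl ab => //; rewrite Ea.
by have /imsetP[b bB /val_inj ->] := subsetP sub _ (imset_f val yA).
Qed.

Lemma ipath_val (s : seq (induced U)) : ipath (map val s) = ipath s.
Proof.
elim: s => //= x s ->; rewrite (mem_map val_inj); congr [&& _, _ & _].
by case: s => //= y s; rewrite all_map.
Qed.

Lemma ihole_val (x : induced U) s : ihole x s -> ihole (val x) (map val s).
Proof.
case/and4P => h1 h2 h3 /allP h4; apply/and4P; split; rewrite ?ipath_val ?size_map //.
  by rewrite (mem_map val_inj).
apply/allP => _ /mapP[y ys ->]; have := h4 _ ys.
case: s {h1 h2 h3 h4 ys} => [|z s]; rewrite /= ?(inj_eq val_inj) //.
by rewrite (last_map val) (inj_eq val_inj).
Qed.

Lemma clean_induced : clean G -> clean (induced U).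
Proof.
move=> [tf h1]; split; first by move=> x y z xy yz xz; exact: tf xy yz xz.
move=> x s v y1 y2 /ihole_val hx vx y1x y2x v1 v2; apply: val_inj.
by apply: (h1 _ _ (val v)) hx _ _ _ v1 v2; rewrite -map_cons (mem_map val_inj).
Qed.

Lemma bramble_val (P : {set {set induced U}}) N : bramble P N ->
  bramble [set val @: (b : {set induced U}) | b in P] N.
Proof.
move=> [cP tP hP]; split.
- by move=> _ /imsetP[b bP ->]; apply: conn_imset (cP _ bP).
- move=> _ _ /imsetP[b bP ->] /imsetP[b' bP' ->]; have /touchP[x [y [xb yb xy]]] := tP _ _ bP bP'.
  apply/touchP; exists (val x), (val y); rewrite !imset_f //; split=> //.
  by case: xy => [->|xy]; [left | right].
move=> Y YN; have [|b bP dis] := hP (val @^-1: Y).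
  apply: leq_ltn_trans YN; rewrite -(card_imset _ val_inj); apply: subset_leq_card.
  by apply/subsetP => _ /imsetP[x + ->]; rewrite inE.
exists (val @: b); first exact: imset_f.
rewrite -[_ (mem _) _]negbK; apply/disjointNP => -[_ /imsetP[x xb ->] xY].
by apply: (disjP dis xb); rewrite inE.
Qed.

Lemma bramble_preim (P : {set {set G}}) N : bramble P N -> {in P, forall b : {set G}, b \subset U} ->
  bramble [set (val @^-1: (b : {set G}) : {set induced U}) | b in P] N.
Proof.
move=> [cP tP hP] PU.
have lift b x : b \in P -> x \in b -> exists2 y : induced U, val y = x & y \in val @^-1: b.
  by move=> bP xb; exists (exist _ x (subsetP (PU _ bP) _ xb)); rewrite ?inE.
split.
- move=> _ /imsetP[b bP ->]; apply: conn_val.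
  have -> : [set val x | x in (val @^-1: b : {set induced U})] = b; last exact: cP.
  apply/setP => x; apply/imsetP/idP => [[y + ->]|xb]; first by rewrite inE.
  by have [y <- yb] := lift _ _ bP xb; exists y.
- move=> _ _ /imsetP[b bP ->] /imsetP[b' bP' ->]; have /touchP[x [y [xb yb xy]]] := tP _ _ bP bP'.
  have [x' Ex xb'] := lift _ _ bP xb; have [y' Ey yb'] := lift _ _ bP' yb.
  apply/touchP; exists x', y'; split=> //; case: xy => xy; [left | right].
    by apply: val_inj; rewrite Ex Ey.
  by rewrite -Ex -Ey in xy.
move=> Y YN; have [|b bP dis] := hP (val @: Y); first by rewrite (card_imset _ val_inj).
exists (val @^-1: b); first exact: imset_f.
rewrite -[_ (mem _) _]negbK; apply/disjointNP => -[x]; rewrite inE => xb xY.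
exact: disjP dis xb (imset_f val xY).
Qed.

End Induced.

Theorem theorem3p4 (k : nat) :
  exists c : nat, forall G : sgraph,
    class_F2 G -> ~ has_star_cutset G -> c < treewidth G ->
    contains_induced (subdivision_of (wall k)) G.
Proof.
(* Contraction turns order [M.*2] into [M]; the 5 is for the separators of up to four vertices. *)
have [M grid] := grid_theorem k; pose N := maxn 5 M.*2.
have N5 : 4 < N by exact: leq_maxl.
exists (3 * N) => G /class_F2_clean cG _ tw.
have [P0 br0] : exists P : {set {set G}}, bramble P N.
  apply: contrapT => nb; move: tw; rewrite ltnNge => /negP; apply; apply: treewidth_le; first by case: (N) N5.
  by move=> P brP; apply: nb; exists P.
have ex : exists n, `[< exists U : {set G}, bramble_in U N /\ #|U| = n >].
  by exists #|[set: G]|; apply/asboolP; exists [set: G]; split=> //; exists P0 => // b _; exact: subsetT.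
have [n /asboolP[U [[P brP PU] Un]] mn] := ex_minnP ex.
pose H := induced U; have cH : clean H := clean_induced U cG.
have minH U' : @bramble_in H U' N -> U' = [set: H].
  move=> [P' brP' PU']; apply/eqP; rewrite eqEcard subsetT /=.
  have -> : #|[set: H]| = n by rewrite cardsT card_sig -Un; apply: eq_card.
  rewrite -(card_imset _ val_inj); apply: mn; apply/asboolP; exists (val @: U'); split=> //.
  exists [set val @: (b : {set H}) | b in P']; first exact: bramble_val.
  by move=> _ /imsetP[b bP ->]; apply: imsetS; exact: PU'.
have [|PQ /grid[psi /wall_model[psi' mp]]] := quot_bramble cH N5 minH (bramble_preim brP PU) (M := M).
  exact: leq_maxr.
have [|phi [mphi clo]] := pullback mp.
  by move=> w; have /andP[h _] := wall_deg w; exact: leq_trans h.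
have [tf _] := cH.
have [f [p sub]] := assemble tf mphi (@wall_deg k) clo.
exact: subdiv_in_induced (subdiv_in_val sub).
Qed.
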